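(* Let $\rho$ be a unital endomorphism of a unital $C^*$-algebra $\mathcal{A}$ with centre $\mathcal{Z}$, $E\to X^\rho$ a vector bundle, and $\mathcal{G}\subseteq\mathcal{U}E$ a compact group bundle with a dual action $\mu:(\mathcal{O}_{\mathcal{G}},\sigma_{\mathcal{G}})\to(\mathcal{A},\rho)$. If $\mathcal{A}'\cap(\mathcal{A}\rtimes_\mu\widehat{\mathcal{G}})=\mathcal{Z}$, then the following properties hold: (1) there is a finitely generated $C(X^\rho)$-Hilbert $\mathcal{Z}$-bimodule $\mathcal{M}\subset\mathcal{A}\rtimes_\mu\widehat{\mathcal{G}}$ with support $1$, isomorphic to $\widehat E\otimes_{C(X^\rho)}\mathcal{Z}$ as a right Hilbert $\mathcal{Z}$-module; (2) the gauge action $\alpha$ of $\mathcal{G}$ on $\mathcal{A}\rtimes_\mu\widehat{\mathcal{G}}$ restricts to a gauge action $U:\mathcal{G}\times_{X^\rho}\widehat{\mathcal{M}}\to\widehat{\mathcal{M}}$; (3) $(\mathcal{M}^r,\mathcal{M}^s)_{\mathcal{G}}=(\rho^r,\rho^s)$ for all $r,s\in\mathbb{N}$.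
   Context: **$C(X)$-algebras.** $X$ is compact Hausdorff. A unital $C(X)$-algebra is a unital $C^*$-algebra $\mathcal{A}$ with an injective unital morphism of $C(X)$ into its centre. Its fibre at $x$ is $\mathcal{A}_x=\mathcal{A}/(C_x(X)\mathcal{A})$, $C_x(X)=\{f\in C(X):f(x)=0\}$, with quotient map $\pi_x$; $\widehat{\mathcal{A}}=\dot\cup_x\mathcal{A}_x$ has the topology with basic open sets $\{v\in\dot\cup_{x\in U}\mathcal{A}_x:\|v-\pi_x(a)\|<\delta \text{ for } v\in\mathcal{A}_x\}$ ($U\subseteq X$ open, $a\in\mathcal{A}$, $\delta>0$), and $\mathcal{A}$ is identified with the continuous sections of $\widehat{\mathcal{A}}\to X$. $C(X)$-morphisms are the $C(X)$-linear $*$-homomorphisms $\eta$; the induced map of bundles is $\widehat\eta$. **Group bundles and gauge actions.** A bundle is a continuous surjection of locally compact Hausdorff spaces onto $X$. A group bundle is a bundle $p:\mathcal{G}\to X$ whose fibres $G_x=p^{-1}(x)$ are locally compact groups. A gauge action of $\mathcal{G}$ on a $C(X)$-algebra $\mathcal{A}$ is a family of strongly continuous actions $\alpha^x:G_x\to\mathbf{aut}\,\mathcal{A}_x$ such that $\mathcal{G}\times_X\widehat{\mathcal{A}}\to\widehat{\mathcal{A}}$, $(y,v)\mapsto\alpha(y,v)=\alpha^x_y(v)$, is continuous. **Vector bundles.** $E\to X$ is a rank $d$ Hermitian vector bundle, $\widehat{E}$ its Hilbert $C(X)$-bimodule of sections, $\{\psi_l\}$ a finite set of generators of $\widehat E$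 with $\sum_l\psi_l\langle\psi_l,\cdot\rangle=\mathrm{id}$. $\mathcal{O}_E$ is the Cuntz–Pimsner algebra of $\widehat E$ (generated by $C(X)$ and the $\psi_l$ with $\psi_l^*\psi_m=\langle\psi_l,\psi_m\rangle$, $f\psi_l=\psi_lf$, $\sum_l\psi_l\psi_l^*=1$); it is a $C(X)$-algebra with fibres the Cuntz algebra $\mathcal{O}_d$. $E^r$ is the $r$-th tensor power ($E^0=\iota$ the trivial line bundle); $(E^r,E^s)$ is the set of $C(X)$-module maps $\widehat E^r\to\widehat E^s$, regarded as a subspace of $\mathcal{O}_E$. $\sigma_E(t)=\sum_l\psi_lt\psi_l^*$. $\mathcal{U}E$ is the bundle of unitary endomorphisms of the fibres of $E$. Each $y\in\mathcal{U}E_x$ defines the automorphism $\widehat y$ of $(\mathcal{O}_E)_x$ extending $y$ on $E_x$. For a compact group bundle $\mathcal{G}\subseteq\mathcal{U}E$: $(E^r,E^s)_{\mathcal{G}}=\{t\in(E^r,E^s):y^{\otimes s}t(x)=t(x)y^{\otimes r},\ y\in\mathcal{G},x=p(y)\}$; $\mathcal{O}_{\mathcal{G}}$ is the fixed-point algebra of $\mathcal{O}_E$ under $(y,\xi)\mapsto\widehat y(\xi)$, i.e. the set of $t$ with $\widehat y(t(x))=t(x)$ for all $y\in\mathcal{G}$, $x=p(y)$; $\sigma_{\mathcal{G}}=\sigma_E|_{\mathcal{O}_{\mathcal{G}}}$. Standing assumption: $\mathcal{G}=\mathcal{SG}$, where $\mathcal{SG}=\{u\in\mathcal{U}E:\widehat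 u(t)=t,\ t\in(\mathcal{O}_{\mathcal{G}})_{p(u)}\}$. **Dual actions.** $\rho^0=\iota$ is the identity; $(\rho^r,\rho^s)=\{t\in\mathcal{A}:t\rho^r(a)=\rho^s(a)t,\ a\in\mathcal{A}\}$. $C(X^\rho)=\{f\in\mathcal{A}\cap\mathcal{A}':\rho(f)=f\}$, with spectrum $X^\rho$. A dual $\mathcal{G}$-action is a $C(X^\rho)$-monomorphism $\mu:\mathcal{O}_{\mathcal{G}}\to\mathcal{A}$ with $\mu\circ\sigma_{\mathcal{G}}=\rho\circ\mu$ and $\mu((E^r,E^s)_{\mathcal{G}})\subseteq(\rho^r,\rho^s)$ for all $r,s$. The crossed product $\mathcal{A}\rtimes_\mu\widehat{\mathcal{G}}$ is the universal $C(X^\rho)$-algebra generated by $\mathcal{A}$ and the image of a unital $C(X^\rho)$-monomorphism $j$ of $\mathcal{O}_E$ such that $\mu(t)=j(t)$ for $t\in\mathcal{O}_{\mathcal{G}}$ and $\rho(a)\psi=\psi a$ for $a\in\mathcal{A}$, $\psi\in j(\widehat E)$. It carries the gauge $\mathcal{G}$-action $\alpha(y,v\cdot\widehat j(\xi))=v\cdot\widehat j(\widehat y(\xi))$, $v\in\widehat{\mathcal{A}}$, $\xi\in\widehat{\mathcal{O}}_E$. **Hilbert bimodules in an algebra.** A Hilbert $\mathcal{Z}$-bimodule in a unital $C^*$-algebra $\mathcal{B}\supset\mathcal{Z}$ is a norm-closed subspace $\mathcal{M}\subset\mathcal{B}$ stable under left and right multiplication by $\mathcal{Z}$, with scalar product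 $\psi^*\psi'\in\mathcal{Z}$ ($\{\psi^*\psi':\psi,\psi'\in\mathcal{M}\}=\mathcal{Z}$); it is a $C(X^\rho)$-Hilbert bimodule if $f\psi=\psi f$ for $f\in C(X^\rho)$, and has support $1$ if there is a finite set $\{\psi_l\}\subset\mathcal{M}$ with $\sum_l\psi_l\psi_l^*=1$. $\mathcal{M}^r\subset\mathcal{B}$ is the closed span of products $\psi_1\cdots\psi_r$ (identified with the $r$-fold internal tensor power), and the space $(\mathcal{M}^r,\mathcal{M}^s)$ of right $\mathcal{Z}$-module operators is identified with the closed span of $\psi'\psi^*$, $\psi'\in\mathcal{M}^s$, $\psi\in\mathcal{M}^r$. $\mathcal{M}_x=\mathcal{M}\otimes_{\mathcal{Z}}\mathcal{Z}_x$ and $\widehat{\mathcal{M}}=\dot\cup_x\mathcal{M}_x$, topologized by tubes around elements of $\mathcal{M}$. A gauge action $U$ of $\mathcal{G}$ on $\mathcal{M}$ (with trivial actions on $\mathcal{Z}$) is a family of actions $U^x$ of $G_x$ on $\mathcal{M}_x$ by isometric linear operators that preserve the $\mathcal{Z}_x$-valued scalar product and commute with the left action of $\mathcal{Z}_x$, such that $\mathcal{G}\times_{X^\rho}\widehat{\mathcal{M}}\to\widehat{\mathcal{M}}$ is continuous. $(\mathcal{M}^r,\mathcal{M}^s)_{\mathcal{G}}$ is the set of operators in $(\mathcal{M}^r,\mathcal{M}^s)$ equivariant for the tensor powers of $U$.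
   Formalization: In the definition of a Hilbert Z-bimodule, the condition {ψ*ψ'} = Z is read as: all ψ*ψ' lie in Z and their closed linear span is Z; literal equality of sets fails, for example, when E has no nowhere vanishing section. *)

(* Defs.v *)
From Stdlib Require List.
From HB Require Import structures.
From mathcomp Require Import all_boot all_order all_algebra.
From mathcomp Require Import complex.
From mathcomp Require Import all_classical all_reals all_analysis.

Set Implicit Arguments.
Unset Strict Implicit.
Unset Printing Implicit Defensive.

Import Order.TTheory GRing.Theory Num.Theory.
Import numFieldNormedType.Exports.

Local Open Scope classical_set_scope.
Local Open Scope ring_scope.

(* Naming the field R[i] keeps its structure visible as a variable-like
   numClosedFieldType, which is what the library attaches a topology to. *)
Definition cplx (R : realType) : numClosedFieldType := R[i].

Section CStarType.
Variable R : realType.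
Local Notation C := (cplx R).

(* Unital C*-algebras over the complex numbers, not reduced to 0. The carrier
   cs_sort below is both a completeNormedModType and an algType; no
   Hierarchy-Builder structure joins the two. *)
Record cstarType := CStarType {
  cs_space : completeNormedModType C;
  cs_mul : cs_space -> cs_space -> cs_space;
  cs_one : cs_space;
  cs_adj : cs_space -> cs_space;
  cs_mulA : associative cs_mul;
  cs_mul1l : left_id cs_one cs_mul;
  cs_mulr1 : right_id cs_one cs_mul;
  cs_mulDl : left_distributive cs_mul +%R;
  cs_mulDr : right_distributive cs_mul +%R;
  cs_neq0 : cs_one != 0;
  cs_scalel : forall (k : C) a b, k *: cs_mul a b = cs_mul (k *: a) b;
  cs_scaler : forall (k : C) a b, k *: cs_mul a b = cs_mul a (k *: b);
  cs_adjD : forall a b, cs_adj (a + b) = cs_adj a + cs_adj b;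
  cs_adjZ : forall (k : C) a, cs_adj (k *: a) = k^* *: cs_adj a;
  cs_adjM : forall a b, cs_adj (cs_mul a b) = cs_mul (cs_adj b) (cs_adj a);
  cs_adjK : involutive cs_adj;
  cs_normM : forall a b, `|cs_mul a b| <= `|a| * `|b|;
  cs_normC : forall a, `|cs_mul (cs_adj a) a| = `|a| ^+ 2
}.

Definition cs_sort (A : cstarType) : Type := cs_space A.
Coercion cs_sort : cstarType >-> Sortclass.

HB.instance Definition _ (A : cstarType) :=
  CompleteNormedModule.copy (cs_sort A) (cs_space A).
HB.instance Definition _ (A : cstarType) :=
  GRing.Zmodule_isNzRing.Build (cs_sort A) (@cs_mulA A) (@cs_mul1l A)
    (@cs_mulr1 A) (@cs_mulDl A) (@cs_mulDr A) (@cs_neq0 A).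
HB.instance Definition _ (A : cstarType) :=
  GRing.Lmodule_isLalgebra.Build C (cs_sort A) (@cs_scalel A).
HB.instance Definition _ (A : cstarType) :=
  GRing.Lalgebra_isAlgebra.Build C (cs_sort A) (@cs_scaler A).
Definition adj (A : cstarType) : A -> A := @cs_adj A.

End CStarType.

Section CStar.
Variable R : realType.
Local Notation C := (cplx R).

Section OneAlgebra.
Variable A : cstarType R.
Implicit Types S D M : set A.

Definition rnorm (a : A) : R := complex.Re (`|a| : R[i]).

Definition lspan S : set A :=
  [set a | exists n (k : 'I_n -> C) (s : 'I_n -> A),
     (forall i, S (s i)) /\ a = \sum_i k i *: s i].

Definition clspan S : set A := closure (lspan S).

Definition star_subalgebra D : Prop :=
  [/\ D 1, forall a b, D a -> D b -> D (a + b),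
      forall (k : C) a, D a -> D (k *: a),
      forall a b, D a -> D b -> D (a * b) &
      forall a, D a -> D (adj a)].

Definition generated_by S : Prop :=
  forall D, star_subalgebra D -> closed D -> S `<=` D -> D = setT.

Definition centre : set A := [set z | forall a, z * a = a * z].

(* M^r is the closed span of the products of r elements of M; M^0 is the
   coefficient algebra Z0. *)
Fixpoint mpow (Z0 M : set A) (r : nat) : set A :=
  if r is r'.+1 then clspan [set m * n | m in M & n in mpow Z0 M r'] else Z0.

Definition intertwiners (rho : A -> A) (r s : nat) : set A :=
  [set t | forall a, t * iter r rho a = iter s rho a * t].

End OneAlgebra.

(* f restricts to a unital *-morphism on D; its values off D are irrelevant. *)
Definition star_hom_on (A B : cstarType R) (D : set A) (f : A -> B) : Prop :=
  [/\ f 1 = 1, forall a b, D a -> D b -> f (a + b) = f a + f b,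
      forall (k : C) a, D a -> f (k *: a) = k *: f a,
      forall a b, D a -> D b -> f (a * b) = f a * f b &
      forall a, D a -> f (adj a) = adj (f a)].

Definition star_hom (A B : cstarType R) (f : A -> B) : Prop :=
  star_hom_on setT f.

(* Morphisms of C(X) are functions on X -> C of which only the values at
   continuous arguments are used. *)
Definition cfun_hom (X : topologicalType) (A : cstarType R)
    (iota : (X -> C) -> A) : Prop :=
  [/\ iota (fun=> 1) = 1,
      forall f g : X -> C, continuous f -> continuous g ->
        iota (fun x => f x + g x) = iota f + iota g,
      forall (k : C) (f : X -> C), continuous f ->
        iota (fun x => k * f x) = k *: iota f,
      forall f g : X -> C, continuous f -> continuous g ->
        iota (fun x => f x * g x) = iota f * iota g &
      forall f : X -> C, continuous f ->
        iota (fun x => (f x)^*) = adj (iota f)].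

Definition cx_algebra (X : topologicalType) (A : cstarType R)
    (iota : (X -> C) -> A) : Prop :=
  [/\ cfun_hom iota,
      forall f g : X -> C, continuous f -> continuous g ->
        iota f = iota g -> f = g &
      forall f : X -> C, continuous f -> centre (iota f)].

Section Fibres.
Variables (X : topologicalType) (A : cstarType R) (iota : (X -> C) -> A).

Section Submodule.
Variable N : set A.

(* The closed subspace C_x(X)N of N. *)
Definition fib_ker (x : X) : set A :=
  clspan [set b | exists (f : X -> C) (n : A),
                    [/\ continuous f, f x = 0, N n & b = iota f * n]].

Definition fib_class (x : X) (a : A) : set A := [set b | fib_ker x (b - a)].

(* The fibre N_x = N / C_x(X)N of a closed C(X)-submodule N of A, as a set of
   cosets. For N = setT this is the fibre A_x of the C(X)-algebra A; for a
   Hilbert Z-bimodule N it is N (x)_Z Z_x, since N C_x(X)Z = C_x(X)N. *)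
Definition fibre (x : X) : Type :=
  {u : set A | exists2 a, N a & u = fib_class x a}.

HB.instance Definition _ (x : X) := gen_eqMixin (fibre x).
HB.instance Definition _ (x : X) := gen_choiceMixin (fibre x).

Definition fib_norm (x : X) (u : fibre x) : R :=
  inf [set rnorm a | a in sval u].

Definition fib_dist (x : X) (u v : fibre x) : R :=
  inf [set rnorm (a - b) | a in sval u & b in sval v].

Definition fbundle : Type := {x : X & fibre x}.

Definition fpoint (x : X) (v : fibre x) : fbundle := existT _ x v.

(* The tube of radius delta around the section a of N over U: for v in N_x the
   infimum is the quotient norm of v - pi_x(a). *)
Definition tube (U : set X) (a : A) (delta : R) : set fbundle :=
  [set v | U (projT1 v) /\
           inf [set rnorm (b - a) | b in sval (projT2 v)] < delta].

Definition tubes : set (set fbundle) :=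
  [set T | exists (U : set X) (a : A) (delta : R),
             [/\ open U, N a, 0 < delta & T = tube U a delta]].

HB.instance Definition _ := gen_eqMixin fbundle.
HB.instance Definition _ := gen_choiceMixin fbundle.
HB.instance Definition _ := @isSubBaseTopological.Build fbundle
  (set fbundle) tubes id.

(* T maps the class of a to the class of a'. The operations of N_x are those
   induced by representatives, and the predicates below express that T is
   compatible with them. *)
Definition maps_class (x : X) (T : fibre x -> fibre x) (a a' : A) : Prop :=
  exists u : fibre x, sval u a /\ sval (T u) a'.

Definition fib_linear (x : X) (T : fibre x -> fibre x) : Prop :=
  (forall a b a' b', maps_class T a a' -> maps_class T b b' ->
     maps_class T (a + b) (a' + b')) /\
  (forall (k : C) a a', maps_class T a a' -> maps_class T (k *: a) (k *: a')).

End Submodule.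

Definition fib_automorphism (x : X) (T : fibre setT x -> fibre setT x) : Prop :=
  [/\ bijective T, fib_linear T,
      forall a b a' b', maps_class T a a' -> maps_class T b b' ->
        maps_class T (a * b) (a' * b') &
      forall a a', maps_class T a a' -> maps_class T (adj a) (adj a')].

(* Tensor powers of a linear operator on M_x. The operator is given by the
   relation "T maps the class of m to the class of m'"; the r-th power is the
   linear operator on (M^r)_x with
   (m_1 ... m_r) |-> (T m_1) ... (T m_r), and the identity on (M^0)_x. *)
Fixpoint tpow (Z0 M : set A) (x : X) (T : A -> A -> Prop) (r : nat) :
    fibre (mpow Z0 M r) x -> fibre (mpow Z0 M r) x :=
  match r with
  | 0%N => id
  | r'.+1 => xget (fun u : fibre (mpow Z0 M r'.+1) x => u)
      [set V : fibre (mpow Z0 M r'.+1) x -> fibre (mpow Z0 M r'.+1) x |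
         fib_linear V /\
         forall m m' n n', T m m' -> maps_class (@tpow Z0 M x T r') n n' ->
           maps_class V (m * n) (m' * n')]
  end.

(* V_s t = t V_r on (M^r)_x, for the tensor powers V of T. *)
Definition tpow_equivariant (Z0 M : set A) (x : X) (T : A -> A -> Prop)
    (r s : nat) (t : A) : Prop :=
  forall xi xi', maps_class (@tpow Z0 M x T r) xi xi' ->
    maps_class (@tpow Z0 M x T s) (t * xi) (t * xi').

End Fibres.

(* A rank d Hermitian vector bundle over X, presented by an atlas: triv i x
   (for x in dom i) is the restriction to the fibre over x of a local
   trivialization over dom i, the transition matrices are continuous, and the
   Hermitian metric has a continuous Gram matrix in every chart. *)
Record herm_bundle (X : topologicalType) (d : nat) := HermBundle {
  vb_fib :> X -> lmodType C;
  vb_ip : forall x, vb_fib x -> vb_fib x -> C;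
  vb_ix : Type;
  vb_dom : vb_ix -> set X;
  vb_triv : vb_ix -> forall x, vb_fib x -> 'cV[C]_d;
  vb_ipDr : forall x (u v w : vb_fib x),
    vb_ip u (v + w) = vb_ip u v + vb_ip u w;
  vb_ipZr : forall x (k : C) (u v : vb_fib x),
    vb_ip u (k *: v) = k * vb_ip u v;
  vb_ipC : forall x (u v : vb_fib x), vb_ip v u = (vb_ip u v)^*;
  vb_ip_ge0 : forall x (u : vb_fib x), 0 <= vb_ip u u;
  vb_ip_eq0 : forall x (u : vb_fib x), vb_ip u u = 0 -> u = 0;
  vb_dom_open : forall i, open (vb_dom i);
  vb_dom_cover : forall x, exists i, vb_dom i x;
  vb_trivP : forall i x, vb_dom i x ->
    (forall (k : C) (u v : vb_fib x),
       vb_triv i (k *: u + v) = k *: vb_triv i u + vb_triv i v) /\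
    bijective (@vb_triv i x);
  vb_transition : forall i j, exists g : X -> 'M[C]_d,
    forall x, vb_dom i x -> vb_dom j x ->
      {for x, continuous g} /\
      forall v : vb_fib x, vb_triv j v = g x *m vb_triv i v;
  vb_gram : forall i, exists h : X -> 'M[C]_d,
    forall x, vb_dom i x ->
      {for x, continuous h} /\
      forall u v : vb_fib x, vb_ip u v =
        (map_mx Num.conj (vb_triv i u)^T *m h x *m vb_triv i v) 0 0
}.

Section VectorBundle.
Variables (X : topologicalType) (d : nat) (E : herm_bundle X d).

Definition bsection : Type := forall x, E x.

Definition cont_section (psi : bsection) : Prop :=
  forall i x, vb_dom (h := E) i x ->
    {for x, continuous (fun x => vb_triv i (psi x))}.

Definition sec_ip (phi psi : bsection) : X -> C :=
  fun x => vb_ip (phi x) (psi x).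

(* psi is a finite set of generators with sum_l psi_l <psi_l, .> = id. *)
Definition section_frame (n : nat) (psi : 'I_n -> bsection) : Prop :=
  (forall l, cont_section (psi l)) /\
  (forall phi : bsection, cont_section phi -> forall x,
     \sum_l sec_ip (psi l) phi x *: psi l x = phi x).

(* Total space of the endomorphisms of the fibres, with the topology given by
   the trivializations: over dom i, u corresponds to its matrix in chart i. *)
Definition fendo : Type := {x : X & E x -> E x}.

Definition epoint (x : X) (u : E x -> E x) : fendo := existT _ x u.

Definition fendo_subbase : set (set fendo) :=
  [set S | exists i (V : set X) (W : set 'M[C]_d),
     [/\ open V, V `<=` vb_dom (h := E) i, open W &
         S = [set u | let: existT x y := u in V x /\ exists2 m, W m &
               forall v : E x, vb_triv i (y v) = m *m vb_triv i v]]].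

HB.instance Definition _ := gen_eqMixin fendo.
HB.instance Definition _ := gen_choiceMixin fendo.
HB.instance Definition _ := @isSubBaseTopological.Build fendo
  (set fendo) fendo_subbase id.

Definition unitary_bundle : set fendo :=
  [set u | let: existT x y := u in
     [/\ forall (k : C) (v w : E x), y (k *: v + w) = k *: y v + y w,
         bijective y &
         forall v w : E x, vb_ip (y v) (y w) = vb_ip v w]].

(* A compact subset of UE whose fibres are subgroups of the unitary groups. *)
Definition compact_group_bundle (G : set fendo) : Prop :=
  [/\ G `<=` unitary_bundle, compact G,
      forall x, G (epoint (x := x) id),
      forall x (y y' : E x -> E x), G (epoint y) -> G (epoint y') ->
        G (epoint (y \o y')) &
      forall x (y : E x -> E x), G (epoint y) ->
        exists y', [/\ G (epoint y'), cancel y y' & cancel y' y]].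

Section Gauge.
Variables (G : set fendo) (A : cstarType R) (iota : (X -> C) -> A).

Section OnSubmodule.
Variable N : set A.
Variable alpha : forall x, (E x -> E x) -> fibre iota N x -> fibre iota N x.

Definition group_action : Prop :=
  (forall x (v : fibre iota N x), alpha id v = v) /\
  (forall x (y y' : E x -> E x) (v : fibre iota N x),
     G (epoint y) -> G (epoint y') ->
     alpha (y \o y') v = alpha y (alpha y' v)).

Definition strongly_continuous : Prop :=
  forall x (v : fibre iota N x) (y : E x -> E x), G (epoint y) ->
    forall e : R, 0 < e -> exists2 P : set fendo, nbhs (epoint y) P &
      forall y' : E x -> E x, G (epoint y') -> P (epoint y') ->
        fib_dist (alpha y' v) (alpha y v) < e.

(* Continuity of (y, v) |-> alpha(y, v) on the fibre product of G and the
   bundle of fibres of N. *)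
Definition jointly_continuous : Prop :=
  forall x (y : E x -> E x) (v : fibre iota N x), G (epoint y) ->
    forall W : set (fbundle iota N), nbhs (fpoint (alpha y v)) W ->
    exists (P : set fendo) (Q : set (fbundle iota N)),
      [/\ nbhs (epoint y) P, nbhs (fpoint v) Q &
          forall x' (y' : E x' -> E x') (v' : fibre iota N x'),
            G (epoint y') -> P (epoint y') -> Q (fpoint v') ->
            W (fpoint (alpha y' v'))].

End OnSubmodule.

Definition gauge_action
    (alpha : forall x, (E x -> E x) -> fibre iota setT x -> fibre iota setT x) :
    Prop :=
  [/\ forall x (y : E x -> E x), G (epoint y) -> fib_automorphism (alpha x y),
      group_action alpha, strongly_continuous alpha &
      jointly_continuous alpha].

(* Gauge action on a Hilbert Z-bimodule M; adj m * n is the scalar product,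
   and its class in Z_x is its class modulo C_x(X)Z. *)
Definition module_gauge_action (Z M : set A)
    (U : forall x, (E x -> E x) -> fibre iota M x -> fibre iota M x) : Prop :=
  [/\ forall x (y : E x -> E x), G (epoint y) ->
        [/\ fib_linear (U x y),
            forall v : fibre iota M x, fib_norm (U x y v) = fib_norm v,
            forall m m' n n',
              maps_class (U x y) m m' -> maps_class (U x y) n n' ->
              fib_ker iota Z x (adj m' * n' - adj m * n) &
            forall z m m', Z z -> maps_class (U x y) m m' ->
              maps_class (U x y) (z * m) (z * m')],
      group_action U &
      jointly_continuous U].

End Gauge.

Section CuntzPimsner.
Variables (n : nat) (psi : 'I_n -> bsection).

Record cp_relations (O : cstarType R) (iC : (X -> C) -> O)
    (iE : bsection -> O) : Prop := CPRelations {
  cp_cfun : cfun_hom iC;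
  cp_add : forall phi phi' : bsection, cont_section phi -> cont_section phi' ->
    iE (fun x => phi x + phi' x) = iE phi + iE phi';
  cp_scale : forall (f : X -> C) (phi : bsection),
    continuous f -> cont_section phi ->
    iE (fun x => f x *: phi x) = iE phi * iC f;
  cp_central : forall (f : X -> C) (phi : bsection),
    continuous f -> cont_section phi -> iC f * iE phi = iE phi * iC f;
  cp_ip : forall phi phi' : bsection, cont_section phi -> cont_section phi' ->
    adj (iE phi) * iE phi' = iC (sec_ip phi phi');
  cp_sum : \sum_l iE (psi l) * adj (iE (psi l)) = 1
}.

Definition cfun_image (O : cstarType R) (iC : (X -> C) -> O) : set O :=
  [set iC f | f in [set f : X -> C | continuous f]].

Definition section_image (O : cstarType R) (iE : bsection -> O) : set O :=
  [set iE phi | phi in cont_section].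

(* O is the universal C*-algebra generated by C(X) and the sections of E,
   subject to the relations above. *)
Definition is_cuntz_pimsner (O : cstarType R) (iC : (X -> C) -> O)
    (iE : bsection -> O) : Prop :=
  [/\ cp_relations iC iE,
      generated_by (cfun_image iC `|` section_image iE) &
      forall (O' : cstarType R) (iC' : (X -> C) -> O') (iE' : bsection -> O'),
        cp_relations iC' iE' ->
        exists! h : O -> O',
          [/\ star_hom h, forall f : X -> C, continuous f -> h (iC f) = iC' f &
              forall phi : bsection, cont_section phi -> h (iE phi) = iE' phi]].

Variables (O : cstarType R) (iC : (X -> C) -> O) (iE : bsection -> O).

Definition sigma (t : O) : O := \sum_l iE (psi l) * t * adj (iE (psi l)).

(* The sections of E^r, the r-th tensor power, as products of r sections. *)
Definition epow (r : nat) : set O := mpow (cfun_image iC) (section_image iE) r.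

(* (E^r, E^s): the module maps from sections of E^r to sections of E^s, acting
   by left multiplication; right C(X)-linearity is then automatic. *)
Definition arrows (r s : nat) : set O :=
  [set t | forall xi, epow r xi -> epow s (t * xi)].

(* phi(x) = y psi(x), for the sections with image a and a' in O_E. *)
Definition moves (x : X) (y : E x -> E x) (a a' : O) : Prop :=
  exists phi phi' : bsection,
    [/\ cont_section phi, cont_section phi', phi' x = y (phi x),
        a = iE phi & a' = iE phi'].

(* The automorphism of (O_E)_x extending y on E_x. *)
Definition hat (x : X) (y : E x -> E x) :
    fibre iC setT x -> fibre iC setT x :=
  xget (fun u : fibre iC setT x => u)
       [set T : fibre iC setT x -> fibre iC setT x |
          fib_automorphism T /\
          forall a a', moves y a a' -> maps_class T a a'].

Variable G : set fendo.

Definition equivariant_arrows (r s : nat) : set O :=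
  [set t | arrows r s t /\
     forall x (y : E x -> E x), G (epoint y) ->
       tpow_equivariant iC (cfun_image iC) (section_image iE) x (moves y) r s t].

Definition fixed_algebra : set O :=
  [set t | forall x (y : E x -> E x), G (epoint y) ->
             maps_class (hat y) t t].

Definition stabilizer_bundle : set fendo :=
  [set u | unitary_bundle u /\
     let: existT x y := u in
     forall t, fixed_algebra t -> maps_class (hat y) t t].

End CuntzPimsner.
End VectorBundle.

Section Spectrum.
Variables (A : cstarType R) (rho : A -> A).

Definition fixed_centre : set A := [set f | centre f /\ rho f = f].

(* A character of C(X^rho), extended by 0 to A. *)
Definition is_character (chi : A -> C) : Prop :=
  [/\ chi 1 = 1,
      forall f g, fixed_centre f -> fixed_centre g ->
        chi (f + g) = chi f + chi g,
      forall (k : C) f, fixed_centre f -> chi (k *: f) = k * chi f,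
      forall f g, fixed_centre f -> fixed_centre g ->
        chi (f * g) = chi f * chi g &
      forall a, ~ fixed_centre a -> chi a = 0].

Definition spectrum : Type := {chi : A -> C | is_character chi}.

Definition gelfand (f : A) : spectrum -> C := fun chi => sval chi f.

Definition weak_star_subbase : set (set spectrum) :=
  [set S | exists (f : A) (W : set C),
     [/\ fixed_centre f, open W & S = gelfand f @^-1` W]].

HB.instance Definition _ := gen_eqMixin spectrum.
HB.instance Definition _ := gen_choiceMixin spectrum.
HB.instance Definition _ := @isSubBaseTopological.Build spectrum
  (set spectrum) weak_star_subbase id.

(* The inverse of the Gelfand transform of C(X^rho): the structure map of A
   as a C(X^rho)-algebra. *)
Definition gelfand_inv (g : spectrum -> C) : A :=
  xget 0 [set f | fixed_centre f /\ gelfand f = g].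

End Spectrum.

Section Crossed.
Variables (A : cstarType R) (rho : A -> A) (d : nat).
Variable E : herm_bundle (spectrum rho) d.
Variables (n : nat) (psi : 'I_n -> bsection E).
Variables (O : cstarType R) (iC : (spectrum rho -> C) -> O).
Variables (iE : bsection E -> O) (G : set (fendo E)).
Local Notation OG := (fixed_algebra iC iE G).

Record dual_action (mu : O -> A) : Prop := DualAction {
  dual_hom : star_hom_on OG mu;
  dual_inj : forall t t', OG t -> OG t' -> mu t = mu t' -> t = t';
  dual_cfun : forall g : spectrum rho -> C, continuous g ->
    mu (iC g) = gelfand_inv g;
  dual_endo : forall t, OG t -> mu (sigma psi iE t) = rho (mu t);
  dual_arrows : forall r s t, equivariant_arrows iC iE G r s t ->
    intertwiners rho r s (mu t)
}.

Variable mu : O -> A.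

Record covariant_pair (B : cstarType R) (iA : A -> B) (j : O -> B) : Prop :=
    CovariantPair {
  cov_homA : star_hom iA;
  cov_injA : injective iA;
  cov_cx : cx_algebra (fun g : spectrum rho -> C => iA (gelfand_inv g));
  cov_homE : star_hom j;
  cov_injE : injective j;
  cov_cfun : forall g : spectrum rho -> C, continuous g ->
    j (iC g) = iA (gelfand_inv g);
  cov_mu : forall t, OG t -> j t = iA (mu t);
  cov_rho : forall (a : A) (phi : bsection E), cont_section phi ->
    iA (rho a) * j (iE phi) = j (iE phi) * iA a
}.

Definition is_crossed_product (B : cstarType R) (iA : A -> B) (j : O -> B) :
    Prop :=
  [/\ covariant_pair iA j, generated_by (range iA `|` range j) &
      forall (B' : cstarType R) (iA' : A -> B') (j' : O -> B'),
        covariant_pair iA' j' ->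
        exists! h : B -> B',
          [/\ star_hom h, forall a, h (iA a) = iA' a &
              forall t, h (j t) = j' t]].

Variables (B : cstarType R) (iA : A -> B) (j : O -> B).

Definition crossed_cx (g : spectrum rho -> C) : B := iA (gelfand_inv g).

Definition centre_image : set B := [set iA z | z in @centre A].

(* alpha is the gauge action of G on B with
   alpha(y, v . j(xi)) = v . j(hat y xi). *)
Definition dual_gauge_action
    (alpha : forall x, (E x -> E x) ->
       fibre crossed_cx setT x -> fibre crossed_cx setT x) : Prop :=
  gauge_action G alpha /\
  forall x (y : E x -> E x), G (epoint y) ->
    forall (a : A) (t t' : O), maps_class (hat (iC := iC) iE y) t t' ->
      maps_class (alpha x y) (iA a * j t) (iA a * j t').

(* Norm-closed subspaces of B that are Hilbert Z-bimodules. Fullness is that the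
   scalar products span Z: they need not exhaust Z themselves, for instance
   when E has no nowhere vanishing section. *)
Definition hilbert_bimodule (M : set B) : Prop :=
  [/\ closed M, M 0, forall (k : C) m m', M m -> M m' -> M (k *: m + m'),
      forall z m, centre_image z -> M m -> M (z * m) /\ M (m * z) &
      clspan [set adj m * m' | m in M & m' in M] = centre_image /\
      forall m m', M m -> M m' -> centre_image (adj m * m')].

Definition cx_bimodule (M : set B) : Prop :=
  forall f m, fixed_centre rho f -> M m -> iA f * m = m * iA f.

Definition finitely_generated (M : set B) : Prop :=
  exists k (m : 'I_k -> B), (forall l, M (m l)) /\
    forall b, M b -> exists z : 'I_k -> B,
      (forall l, centre_image (z l)) /\ b = \sum_l m l * z l.

Definition support_one (M : set B) : Prop :=
  exists k (m : 'I_k -> B),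
    (forall l, M (m l)) /\ \sum_l m l * adj (m l) = 1.

(* The internal tensor product of the sections of E and Z over C(X^rho): its
   elements are represented by formal sums of elementary tensors phi (x) z, with
   the Z-valued scalar product
     <phi (x) z, phi' (x) z'> = z^* <phi, phi'> z',
   and two sums represent the same element when their difference is null. No
   completion is needed, since the module of sections is finitely generated and
   projective. *)
Definition formal_tensor : Type := seq (bsection E * A).

Definition is_tensor (s : formal_tensor) : Prop :=
  forall p, List.In p s -> cont_section p.1 /\ centre p.2.

Definition tensor_act (s : formal_tensor) (z : A) : formal_tensor :=
  [seq (p.1, p.2 * z) | p <- s].

Definition tensor_ip (s t : formal_tensor) : A :=
  \sum_(p <- s) \sum_(q <- t)
    adj p.2 * gelfand_inv (sec_ip p.1 q.1) * q.2.

Definition tensor_eq (s t : formal_tensor) : Prop :=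
  let u := s ++ tensor_act t (-1) in tensor_ip u u = 0.

Definition iso_tensor (M : set B) : Prop :=
  exists W : formal_tensor -> B,
    [/\ forall s t, is_tensor s -> is_tensor t ->
          (W s = W t <-> tensor_eq s t),
        [set W s | s in is_tensor] = M,
        forall s t, is_tensor s -> is_tensor t -> W (s ++ t) = W s + W t,
        forall s z, is_tensor s -> centre z ->
          W (tensor_act s z) = W s * iA z &
        forall s t, is_tensor s -> is_tensor t ->
          adj (W s) * W t = iA (tensor_ip s t)].

(* (M^r, M^s), an operator being identified with the element of B whose left
   multiplication it is. *)
Definition mod_arrows (M : set B) (r s : nat) : set B :=
  clspan [set m' * adj m | m' in mpow centre_image M s &
                           m in mpow centre_image M r].

Definition equivariant_mod_arrows (M : set B)
    (U : forall x, (E x -> E x) ->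
       fibre crossed_cx M x -> fibre crossed_cx M x) (r s : nat) : set B :=
  [set t | mod_arrows M r s t /\
     forall x (y : E x -> E x), G (epoint y) ->
       tpow_equivariant crossed_cx centre_image M x (maps_class (U x y)) r s t].

End Crossed.
End CStar.

(* Main.v *)
Require Import Defs.
From mathcomp Require Import all_boot all_order all_algebra.
From mathcomp Require Import finmap complex ring lra.
From mathcomp Require Import all_classical all_reals all_analysis.

Set Implicit Arguments.
Unset Strict Implicit.
Unset Printing Implicit Defensive.

Import Order.TTheory GRing.Theory Num.Theory.
Import numFieldNormedType.Exports.

Local Open Scope classical_set_scope.
Local Open Scope ring_scope.

(* Write e_w for the image in B of the product of frame sections along a word w,
   and consider the elements b of B with b rho^r(a) = rho^s(a) b for all a in A;
   M consists of those with r = 0 and s = 1. As the sum of e_w e_w^* over the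
   words of length r is 1 and e_v^* b e_w commutes with A, hence is in Z, these
   elements form (M^r, M^s) and are sums of a_vw e_v e_w^* with a_vw in A. The
   gauge action fixes A, so it stabilizes M, and the equivariant operators are
   the fixed points of alpha. There remains to show that a fixed point
   b = sum a_vw e_v e_w^* is in A.
   The e_v e_w^* span a representation of the groups G_x by matrices. An element
   of least Hilbert-Schmidt norm in the closed convex hull of G_x is invariant,
   so elements of nearly least norm are nearly invariant; this replaces the Haar
   measure. The iteration of Michael's selection theorem corrects nearly
   invariant vectors to continuous invariant sections, that is, to elements of
   O_G. So b is approximated by A in each fibre, globally by a partition of unity,
   and A is closed in B since injective *-homomorphisms are isometric. *)

(** * C*-norms and square roots *)

(** Two obstacles shape the development. The first is that order in a C*-algebra enters only through
    algebraic identities: if p and q are commuting self-adjoint elements with p^2 + q^2 = T, then p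
    + iq has squared norm T, which bounds p. Contractivity of morphisms, isometry of injective ones
    and estimates of convex combinations with central weights all rest on this and on square roots
    obtained as limits of an iteration. The second is that [hat] and [tpow] are chosen by their
    properties, so nothing is known of them before a map with these properties is exhibited. A
    unitary y of the single fibre E_x has no evident extension to E. It is lifted instead to a
    unitary u of O_E that agrees with y only modulo the kernel at x, and the Cayley transform is
    used so that S_l |-> u S_l can be inverted. The least-norm argument is carried out on matrices
    because the Hilbert-Schmidt norm satisfies the parallelogram law, which a C*-norm does not.
    Compactness of G makes near invariance an open condition on the base point; this is what allows
    local choices to be glued. *)

Section ComplexNumbers.
Variable R : realType.
Local Notation C := (cplx R).

Definition rc (x : R) : C := (x%:C)%C.
Definition cabs (z : C) : R := complex.Re (`|z| : R[i]).

Lemma rcD : {morph rc : x y / x + y}. Proof. by move=> x y; rewrite /rc rmorphD. Qed.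
Lemma rcB : {morph rc : x y / x - y}. Proof. by move=> x y; rewrite /rc rmorphB. Qed.
Lemma rcM : {morph rc : x y / x * y}. Proof. by move=> x y; rewrite /rc rmorphM. Qed.
Lemma rcN : {morph rc : x / - x}. Proof. by move=> x; rewrite /rc rmorphN. Qed.
Lemma rc0 : rc 0 = 0. Proof. exact: rmorph0. Qed.
Lemma rc1 : rc 1 = 1. Proof. exact: rmorph1. Qed.
Lemma rcX n : {morph rc : x / x ^+ n}. Proof. by move=> x; rewrite /rc rmorphXn. Qed.
Lemma rcV : {morph rc : x / x^-1}. Proof. by move=> x; rewrite /rc fmorphV. Qed.
Lemma rc_le x y : (rc x <= rc y) = (x <= y). Proof. exact: lecR. Qed.
Lemma rc_lt x y : (rc x < rc y) = (x < y). Proof. exact: ltcR. Qed.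
Lemma rc_inj : injective rc. Proof. exact: complexI. Qed.
Lemma rc_conj x : (rc x)^* = rc x.
Proof. by apply/CrealP; rewrite /rc; apply/complex_realP; exists x. Qed.
Lemma rc_sum (I : finType) (P : pred I) (F : I -> R) :
  rc (\sum_(i | P i) F i) = \sum_(i | P i) rc (F i).
Proof. by rewrite /rc rmorph_sum. Qed.

Lemma ge0_rc (z : C) : 0 <= z -> z = rc (complex.Re z).
Proof. by case: z => a b; rewrite lecE /= => /andP[/eqP -> _]. Qed.

Lemma cabsE (z : C) : `|z| = rc (cabs z).
Proof. by rewrite {1}(ge0_rc (normr_ge0 z)). Qed.
Lemma cabs_ge0 z : 0 <= cabs z.
Proof. by rewrite -rc_le -cabsE rc0. Qed.
Lemma cabsM z w : cabs (z * w) = cabs z * cabs w.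
Proof. by apply: rc_inj; rewrite -cabsE rcM -!cabsE normrM. Qed.
Lemma cabsD z w : cabs (z + w) <= cabs z + cabs w.
Proof. by rewrite -rc_le rcD -!cabsE ler_normD. Qed.
Lemma cabsN z : cabs (- z) = cabs z. Proof. by rewrite /cabs normrN. Qed.
Lemma cabs_rc x : cabs (rc x) = `|x|.
Proof.
apply: rc_inj; rewrite -cabsE; case: (lerP 0 x) => hx.
  by rewrite !ger0_norm // -rc0 rc_le.
by rewrite (ler0_norm (ltW hx)) ler0_norm ?rcN // -rc0 rc_le ltW.
Qed.
Lemma cabs0 : cabs 0 = 0. Proof. by rewrite -rc0 cabs_rc normr0. Qed.
Lemma cabs_eq0 z : cabs z = 0 -> z = 0.
Proof. by move=> h; apply/eqP; rewrite -normr_eq0 cabsE h rc0. Qed.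
Lemma cabs_conj z : cabs z^* = cabs z.
Proof. by rewrite /cabs norm_conjC. Qed.
Lemma cabs_i : cabs 'i = 1. Proof. by rewrite /cabs normCi. Qed.
Lemma cabs_sqr z : rc (cabs z ^+ 2) = z * z^*.
Proof. by rewrite rcX -cabsE normCK. Qed.
End ComplexNumbers.

Section CStarNorm.
Variables (R : realType) (A : cstarType R).
Local Notation C := (cplx R).
Implicit Types a b : A.

Lemma rnormE a : `|a| = rc (rnorm a).
Proof. by rewrite {1}(ge0_rc (normr_ge0 a)). Qed.
Lemma rnorm_ge0 a : 0 <= rnorm a.
Proof. by rewrite -rc_le -rnormE rc0. Qed.
Lemma rnormD a b : rnorm (a + b) <= rnorm a + rnorm b.
Proof. by rewrite -rc_le rcD -!rnormE ler_normD. Qed.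
Lemma rnormN a : rnorm (- a) = rnorm a. Proof. by rewrite /rnorm normrN. Qed.
Lemma rnormB a b : rnorm (a - b) <= rnorm a + rnorm b.
Proof. by rewrite -[rnorm b]rnormN rnormD. Qed.
Lemma rnorm_distC a b : rnorm (a - b) = rnorm (b - a).
Proof. by rewrite -rnormN opprB. Qed.
Lemma rnormM a b : rnorm (a * b) <= rnorm a * rnorm b.
Proof. rewrite -rc_le rcM -!rnormE; exact: (@cs_normM R A). Qed.
Lemma rnormZ (k : C) a : rnorm (k *: a) = cabs k * rnorm a.
Proof. by apply: rc_inj; rewrite -rnormE rcM -rnormE -cabsE normrZ. Qed.
Lemma rnorm0 : rnorm (0 : A) = 0.
Proof. by apply: rc_inj; rewrite -rnormE normr0 rc0. Qed.
Lemma rnorm_eq0 a : rnorm a = 0 -> a = 0.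
Proof. by move=> h; apply/eqP; rewrite -normr_eq0 rnormE h rc0. Qed.
Lemma rnorm_adjl a : rnorm (adj a * a) = rnorm a ^+ 2.
Proof. apply: rc_inj; rewrite -rnormE rcX -rnormE; exact: (@cs_normC R A). Qed.

Lemma adjD a b : adj (a + b) = adj a + adj b. Proof. exact: cs_adjD. Qed.
Lemma adjZ (k : C) a : adj (k *: a) = k^* *: adj a. Proof. exact: cs_adjZ. Qed.
Lemma adjM a b : adj (a * b) = adj b * adj a. Proof. exact: cs_adjM. Qed.
Lemma adjK a : adj (adj a) = a. Proof. exact: cs_adjK. Qed.
Lemma adj0 : adj (0 : A) = 0.
Proof. by have := adjZ 0 0; rewrite rmorph0 !scale0r. Qed.
Lemma adjN a : adj (- a) = - adj a.
Proof. by rewrite -scaleN1r adjZ rmorphN1 scaleN1r. Qed.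
Lemma adjB a b : adj (a - b) = adj a - adj b. Proof. by rewrite adjD adjN. Qed.
Lemma adj1 : adj (1 : A) = 1.
Proof. by have := adjM (adj 1) 1; rewrite mulr1 adjK mulr1 => <-. Qed.
Lemma adj_sum (I : Type) (r : seq I) (P : pred I) (F : I -> A) :
  adj (\sum_(i <- r | P i) F i) = \sum_(i <- r | P i) adj (F i).
Proof. exact: (big_morph _ adjD adj0). Qed.

Lemma rnorm1 : rnorm (1 : A) = 1.
Proof.
have := rnorm_adjl 1; rewrite adj1 mul1r => /esym/eqP.
rewrite -subr_eq0 -{2}[rnorm 1]mulr1 expr2 -mulrBr mulf_eq0 subr_eq0.
case/orP => /eqP // /rnorm_eq0 /eqP; by rewrite oner_eq0.
Qed.
Lemma rnorm_adj a : rnorm (adj a) = rnorm a.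
Proof.
have h b : rnorm b <= rnorm (adj b).
  have [/rnorm_eq0 ->|nb] := eqVneq (rnorm b) 0; first by rewrite adj0.
  have pb : 0 < rnorm b by rewrite lt_neqAle eq_sym nb rnorm_ge0.
  by rewrite -(ler_pM2r pb) -expr2 -rnorm_adjl rnormM.
by apply/eqP; rewrite eq_le h andbT -{2}[a]adjK h.
Qed.
Lemma rnorm_sum (I : Type) (r : seq I) (P : pred I) (F : I -> A) :
  rnorm (\sum_(i <- r | P i) F i) <= \sum_(i <- r | P i) rnorm (F i).
Proof.
elim/big_ind2: _ => //; first by rewrite rnorm0.
by move=> x1 x2 y1 y2 h1 h2; rewrite (le_trans (rnormD _ _)) // lerD.
Qed.

Lemma nbhs_rnormP a (V : set A) :
  nbhs a V <-> exists2 e : R, 0 < e & forall b, rnorm (a - b) < e -> V b.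
Proof.
split.
  move=> /nbhs_ballP[e /= e0 h]; have ee := ge0_rc (ltW e0).
  exists (complex.Re e); first by rewrite -rc_lt rc0 -ee.
  by move=> b hb; apply: h; rewrite -ball_normE /ball_ /= rnormE ee rc_lt.
case=> e e0 h; apply/nbhs_ballP; exists (rc e); first by rewrite /= -rc0 rc_lt.
by move=> b; rewrite -ball_normE /ball_ /= rnormE rc_lt; apply: h.
Qed.

Lemma closureRP (S : set A) a :
  closure S a <-> forall e : R, 0 < e -> exists2 b, S b & rnorm (a - b) < e.
Proof.
split=> h.
  move=> e e0; have [|b [Sb hb]] := h [set b | rnorm (a - b) < e].
    by apply/nbhs_rnormP; exists e.
  by exists b.
move=> V /nbhs_rnormP[e e0 hV]; have [b Sb hb] := h e e0.
by exists b; split => //; apply: hV.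
Qed.

Lemma closedRP (S : set A) :
  (forall a, (forall e : R, 0 < e -> exists2 b, S b & rnorm (a - b) < e) -> S a)
  <-> closed S.
Proof. by split=> h a ha; apply: h => //; apply/closureRP. Qed.

Lemma complete_rnorm (u : nat -> A) :
  (forall e : R, 0 < e -> exists N, forall m n, (N <= m)%N -> (N <= n)%N ->
     rnorm (u m - u n) < e) ->
  exists l, forall e : R, 0 < e -> exists N, forall n, (N <= n)%N ->
    rnorm (u n - l) < e.
Proof.
move=> hu; have /cauchy_cvgP : cauchy (u @ \oo).
  apply/cauchy_ballP => e e0; have ee := ge0_rc (ltW e0).
  have [|N hN] := hu (complex.Re e); first by rewrite -rc_lt rc0 -ee.
  pose S := [set u n | n in [set n | (N <= n)%N]].
  exists (S, S) => /=.
    by split; exists N => // n hn; exists n.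
  case=> _ _ /= [[m hm <-] [n hn <-]].
  rewrite -ball_normE /ball_ /= rnormE ee rc_lt; exact: hN.
move=> hl; exists (lim (u @ \oo)) => e e0.
have : nbhs (lim (u @ \oo)) [set b | rnorm (lim (u @ \oo) - b) < e].
  by apply/nbhs_rnormP; exists e.
move=> /hl [N _ hN]; exists N => n hn; rewrite rnorm_distC; exact: (hN n hn).
Qed.
End CStarNorm.

Section StarHom.
Variables (R : realType) (A B : cstarType R) (f : A -> B).
Hypothesis hf : star_hom f.
Lemma star_hom1 : f 1 = 1. Proof. by case: hf. Qed.
Lemma star_homD a b : f (a + b) = f a + f b. Proof. by case: hf => _ h *; apply: h. Qed.
Lemma star_homZ k a : f (k *: a) = k *: f a. Proof. by case: hf => _ _ h *; apply: h. Qed.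
Lemma star_homM a b : f (a * b) = f a * f b. Proof. by case: hf => _ _ _ h *; apply: h. Qed.
Lemma star_hom_adj a : f (adj a) = adj (f a). Proof. by case: hf => _ _ _ _ h *; apply: h. Qed.
Lemma star_hom0 : f 0 = 0.
Proof. by rewrite -(scale0r 0) star_homZ scale0r. Qed.
Lemma star_homN a : f (- a) = - f a.
Proof. by rewrite -scaleN1r star_homZ scaleN1r. Qed.
Lemma star_homB a b : f (a - b) = f a - f b.
Proof. by rewrite star_homD star_homN. Qed.
Lemma star_hom_sum (I : Type) (r : seq I) (P : pred I) (F : I -> A) :
  f (\sum_(i <- r | P i) F i) = \sum_(i <- r | P i) f (F i).
Proof. exact: (big_morph _ star_homD star_hom0). Qed.
End StarHom.

(** * Square roots by iteration, and norm estimates derived from them *)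

Section SquareRoot.
Variables (R : realType).
Local Notation C := (cplx R).

(* Iterates of y |-> (x + y^2) / 2, whose fixed points y satisfy
   (1 - y)^2 = 1 - x. *)
Fixpoint sqrt_iter (A : cstarType R) (x : A) (n : nat) : A :=
  if n is m.+1 then (rc (2^-1)) *: (x + sqrt_iter x m * sqrt_iter x m) else 0.

(* The same iteration for x = 1 in R dominates the one for |x| <= 1. *)
Fixpoint sqrt_bound (n : nat) : R :=
  if n is m.+1 then 2^-1 * (1 + sqrt_bound m ^+ 2) else 0.

Lemma sqrt_boundS n : sqrt_bound n.+1 = 2^-1 * (1 + sqrt_bound n ^+ 2).
Proof. by []. Qed.

Lemma sqrt_bound_ge0 n : 0 <= sqrt_bound n.
Proof. elim: n => [|n IH] //=; nra. Qed.

Lemma sqrt_bound_le1 n : sqrt_bound n <= 1.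
Proof.
elim: n => [|n IH] //=.
have := sqrt_bound_ge0 n; nra.
Qed.

(** The gap g = 1 - s obeys g' = g - g^2/2, hence decays like 2/n. This slow rate still gives
    convergence when x has norm 1, where the iterated map is not a contraction. *)
Lemma sqrt_bound_near1 n : 1 - sqrt_bound n <= 2 / (n%:R + 2).
Proof.
elim: n => [|n IH] /=; first by rewrite add0r divff ?subr0.
have n0 : 0 <= n%:R :> R by exact: ler0n.
set N : R := n%:R in IH n0 *.
rewrite -[n.+1%:R]natr1 -/N; set s := sqrt_bound n in IH *.
have s1 : s <= 1 := sqrt_bound_le1 n.
pose b := 2 / (N + 2).
have bN : b * (N + 2) = 2 by rewrite /b mulfVK //; lra.
have b1 : b <= 1 by rewrite /b ler_pdivrMr; lra.
have h : 1 - 2^-1 * (1 + s ^+ 2) <= b - 2^-1 * b ^+ 2.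
  have : 1 - s <= b by [].
  nra.
apply: (le_trans h); rewrite ler_pdivlMr; last lra.
have b0 : 0 <= b by rewrite divr_ge0 //; lra.
have -> : (b - 2^-1 * b ^+ 2) * (N + 1 + 2) =
  2^-1 * (b * (N + 2) * (2 - b)) + 2^-1 * (b * (2 - b)) by field.
rewrite bN; nra.
Qed.

Section OneAlgebra.
Variable A : cstarType R.
Implicit Types x y a b c p q : A.

Lemma rnorm_half a : rnorm (rc (2^-1) *: a) = 2^-1 * rnorm a.
Proof. by rewrite rnormZ cabs_rc ger0_norm // invr_ge0. Qed.

Lemma rnorm_small a : (forall e : R, 0 < e -> rnorm a <= e) -> a = 0.
Proof.
move=> h; apply: rnorm_eq0; apply/eqP; rewrite eq_le rnorm_ge0 andbT.
by apply/ler_addgt0Pl => e e0; rewrite addr0; apply: h.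
Qed.

Lemma double_half a : rc (2^-1) *: (a + a) = a.
Proof.
rewrite -{1 2}[a]scale1r -scalerDl scalerA -rc1 -rcD -rcM.
have -> : 2^-1 * (1 + 1) = 1 :> R by field.
by rewrite rc1 scale1r.
Qed.

Lemma sqrt_iter_comm x c n : c * x = x * c ->
  c * sqrt_iter x n = sqrt_iter x n * c.
Proof.
move=> cx; elim: n => [|n IH] /=; first by rewrite mulr0 mul0r.
by rewrite -scalerAr -scalerAl mulrDr mulrDl cx mulrA IH -!mulrA IH.
Qed.

Lemma sqrt_iter_adj x n : adj x = x -> adj (sqrt_iter x n) = sqrt_iter x n.
Proof.
move=> hx; elim: n => [|n IH] /=; first exact: adj0.
by rewrite adjZ rc_conj adjD hx adjM IH.
Qed.

Lemma sqrt_iter_le x n : rnorm x <= 1 -> rnorm (sqrt_iter x n) <= sqrt_bound n.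
Proof.
move=> hx; elim: n => [|n IH] /=; first by rewrite rnorm0.
rewrite rnorm_half ler_pM2l ?invr_gt0 // (le_trans (rnormD _ _)) // lerD //.
rewrite (le_trans (rnormM _ _)) // expr2 ler_pM ?rnorm_ge0 //.
Qed.

Lemma comm_diff_sq a b : a * b = b * a -> a * a - b * b = (a - b) * (a + b).
Proof.
by move=> ab; rewrite mulrDr !mulrBl ab addrA subrK.
Qed.

(** Successive iterates commute, so the difference of their squares factors as in the scalar case,
    and the scalar increments dominate; these telescope in [sqrt_iter_dist]. *)
Lemma sqrt_iter_step x n : rnorm x <= 1 ->
  rnorm (sqrt_iter x n.+1 - sqrt_iter x n) <= sqrt_bound n.+1 - sqrt_bound n.
Proof.
move=> hx; elim: n => [|n IH].
  by have := sqrt_iter_le 1 hx; rewrite /= subr0 subr0.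
have -> : sqrt_iter x n.+2 - sqrt_iter x n.+1 = rc (2^-1) *:
   ((sqrt_iter x n.+1 - sqrt_iter x n) * (sqrt_iter x n.+1 + sqrt_iter x n)).
  rewrite -comm_diff_sq; last first.
    by apply: sqrt_iter_comm; apply/esym/sqrt_iter_comm.
  by rewrite {1}/sqrt_iter -/sqrt_iter [X in _ - X]/= -scalerBr opprD addrACA subrr add0r.
rewrite rnorm_half.
have -> : sqrt_bound n.+2 - sqrt_bound n.+1 =
  2^-1 * ((sqrt_bound n.+1 - sqrt_bound n) * (sqrt_bound n.+1 + sqrt_bound n)).
  by rewrite !sqrt_boundS; move: (sqrt_bound n) => t; field.
rewrite ler_pM2l ?invr_gt0 // (le_trans (rnormM _ _)) // ler_pM ?rnorm_ge0 //.
by rewrite (le_trans (rnormD _ _)) // lerD // sqrt_iter_le.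
Qed.

Lemma sqrt_iter_dist x m n : rnorm x <= 1 ->
  rnorm (sqrt_iter x (n + m) - sqrt_iter x n) <= sqrt_bound (n + m) - sqrt_bound n.
Proof.
move=> hx; elim: m => [|m IH]; first by rewrite addn0 !subrr rnorm0.
rewrite addnS -(subrK (sqrt_iter x (n + m)) (sqrt_iter x (n + m).+1)) -addrA.
rewrite (le_trans (rnormD _ _)) //.
by rewrite (le_trans (lerD (sqrt_iter_step (n + m) hx) IH)) // addrA subrK.
Qed.

Lemma small_inv (e : R) : 0 < e -> exists N : nat, 2 / (N%:R + 2) < e.
Proof.
move=> e0; have [N hN] : exists N : nat, 2 / e < N%:R.
  have h := Num.Theory.truncnS_gt (2 / e).
  by exists (Num.trunc (2 / e)).+1.
exists N; move: hN; rewrite ltr_pdivrMr // => hN.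
have N0 : 0 <= N%:R :> R by rewrite ler0n.
rewrite ltr_pdivrMr; nra.
Qed.

Lemma sqrt_iter_cvg x : rnorm x <= 1 -> exists y, forall e : R, 0 < e ->
  exists N, forall n, (N <= n)%N -> rnorm (sqrt_iter x n - y) < e.
Proof.
move=> hx; apply: complete_rnorm => e e0.
have [N hN] := small_inv e0; exists N.
have hmn m n : (N <= n)%N -> (n <= m)%N -> rnorm (sqrt_iter x m - sqrt_iter x n) < e.
  move=> Nn nm; rewrite -(subnKC nm); apply: le_lt_trans (sqrt_iter_dist _ _ hx) _.
  apply: le_lt_trans (lerB (sqrt_bound_le1 _) (lexx _)) _.
  apply: le_lt_trans (sqrt_bound_near1 _) _; apply: le_lt_trans hN.
  have p k : 0 < k%:R + 2 :> R by rewrite ltr_wpDl.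
  by rewrite ler_pM2l // lef_pV2 ?posrE // lerD2r ler_nat.
move=> m n hm hn; have [nm|mn] := leqP n m; first exact: hmn.
by rewrite rnorm_distC; apply: hmn => //; exact: ltnW.
Qed.

Definition sqrt_lim x y := forall e : R, 0 < e ->
  exists N, forall n, (N <= n)%N -> rnorm (sqrt_iter x n - y) < e.

Lemma sqrt_lim_unique x y y' : sqrt_lim x y -> sqrt_lim x y' -> y = y'.
Proof.
move=> h h'; apply/eqP; rewrite -subr_eq0; apply/eqP; apply: rnorm_small => e e0.
have e2 : 0 < e / 2 by rewrite divr_gt0.
have [N hN] := h _ e2; have [N' hN'] := h' _ e2.
have := hN (maxn N N') (leq_maxl _ _); have := hN' (maxn N N') (leq_maxr _ _).
set z := sqrt_iter _ _ => h1 h2.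
have -> : y - y' = (z - y') - (z - y) by rewrite opprB [RHS]addrC addrA subrK.
by rewrite (le_trans (rnormB _ _)) // [e]splitr lerD // ltW.
Qed.

Lemma sqrt_lim_closed x y (P : A -> Prop) : sqrt_lim x y ->
  (forall n, P (sqrt_iter x n)) ->
  (forall a, (forall e : R, 0 < e -> exists2 b, P b & rnorm (b - a) < e) -> P a) ->
  P y.
Proof.
move=> h hP; apply => e e0; have [N hN] := h _ e0.
by exists (sqrt_iter x N); [exact: hP | exact: hN].
Qed.

Lemma sqrt_lim_sq x y : rnorm x <= 1 -> rnorm y <= 1 -> sqrt_lim x y ->
  (1 - y) * (1 - y) = 1 - x.
Proof.
move=> hx hy h.
have ey : y = rc (2^-1) *: (x + y * y).
  apply/eqP; rewrite -subr_eq0; apply/eqP; apply: rnorm_small => e e0.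
  have e2 : 0 < e / 2 by rewrite divr_gt0.
  have [N hN] := h _ e2.
  have h1 := hN N (leqnn _); have h2 := hN N.+1 (leqnSn _).
  set z := sqrt_iter x N in h1.
  have -> : y - rc 2^-1 *: (x + y * y) = rc 2^-1 *: (z * (z - y) + (z - y) * y)
     - (sqrt_iter x N.+1 - y).
    have -> : z * (z - y) + (z - y) * y = (x + z * z) - (x + y * y).
      by rewrite mulrBr mulrBl addrA subrK opprD addrACA subrr add0r.
    by rewrite scalerBr opprB [RHS]addrC addrA subrK.
  rewrite (le_trans (rnormB _ _)) // [e]splitr lerD //; last exact: ltW.
  rewrite rnorm_half (le_trans (ler_wpM2l _ (rnormD _ _))) ?invr_ge0 //.
  have b1 : rnorm (z * (z - y)) <= e / 2.
    rewrite (le_trans (rnormM _ _)) // -[e / 2]mul1r ler_pM ?rnorm_ge0 //; last exact: ltW.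
    exact: le_trans (sqrt_iter_le N hx) (sqrt_bound_le1 N).
  have b2 : rnorm ((z - y) * y) <= e / 2.
    by rewrite (le_trans (rnormM _ _)) // -[e / 2]mulr1 ler_pM ?rnorm_ge0 // ltW.
  by move: b1 b2; lra.
have ey2 : y + y = x + y * y.
  by set w := x + y * y in ey *; rewrite -[RHS]double_half scalerDr -ey.
have -> : x = y + y - y * y by rewrite ey2 addrK.
by rewrite mulrBr mulr1 mulrBl mul1r -[in RHS](addrA y) [in RHS]opprD addrA.
Qed.

Lemma rnorm_sqr_sa p : adj p = p -> rnorm (p * p) = rnorm p ^+ 2.
Proof. by move=> hp; rewrite -rnorm_adjl hp. Qed.

(** The substitute for positivity. As p and q commute, u = p + iq satisfies adj u u = T, so the
    squared norm of u is T, and p is the real part of u. *)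
Lemma rc_sum_squares (p q : A) (T : R) : adj p = p -> adj q = q -> p * q = q * p ->
  0 <= T -> p * p + q * q = rc T *: 1 -> rnorm p ^+ 2 <= T.
Proof.
move=> hp hq pq T0 e; pose u := p + 'i *: q.
have au : adj u = p - 'i *: q by rewrite adjD adjZ hp hq conjCi scaleNr.
have uu : adj u * u = rc T *: 1.
  rewrite au -e mulrDr !mulrBl -!scalerAl -!scalerAr scalerA pq.
  have -> : 'i * 'i = -1 :> C by rewrite -expr2 sqrCi.
  by rewrite scaleN1r opprK addrA subrK.
have nu : rnorm u ^+ 2 = T.
  by rewrite -rnorm_adjl uu rnormZ rnorm1 mulr1 cabs_rc ger0_norm.
have p2 : p = rc 2^-1 *: (u + adj u).
  by rewrite au /u addrACA subrr addr0 double_half.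
have : rnorm p <= rnorm u.
  rewrite {1}p2 rnorm_half; have := rnormD u (adj u); rewrite rnorm_adj; lra.
by rewrite -nu => h; rewrite lerXn2r // nnegrE rnorm_ge0.
Qed.

(** 1 - y plays the role of the positive square root of 1 - x. The iterates are real polynomials in
    x, so self-adjointness and commutation pass to the limit. *)
Lemma sqrt_exists (x : A) : rnorm x <= 1 -> adj x = x -> exists y,
  [/\ sqrt_lim x y, rnorm y <= 1, adj y = y,
      (1 - y) * (1 - y) = 1 - x & forall c, c * x = x * c -> c * y = y * c].
Proof.
move=> hx sx; have [y hy] := sqrt_iter_cvg hx; exists y.
have cl (P : A -> Prop) := sqrt_lim_closed (P := P) hy.
have y1 : rnorm y <= 1.
  apply: (cl (fun z => rnorm z <= 1)) => [n|a h]; first exact: le_trans (sqrt_iter_le n hx) (sqrt_bound_le1 n).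
  apply/ler_addgt0Pr => e e0; have [b hb ba] := h e e0.
  rewrite -(subrK b a) (le_trans (rnormD _ _)) // addrC lerD // ltW //.
  by rewrite rnorm_distC.
split => //; last 2 first.
- exact: sqrt_lim_sq.
- move=> c hc; apply: (cl (fun z => c * z = z * c)) => [n|a h]; first exact: sqrt_iter_comm.
  apply/eqP; rewrite -subr_eq0; apply/eqP; apply: rnorm_small => e e0.
  have c1 : 0 < 2 * (rnorm c + 1) by rewrite mulr_gt0 // ltr_wpDl ?rnorm_ge0.
  have [b hb ba] := h _ (divr_gt0 e0 c1).
  have -> : c * a - a * c = (b - a) * c - c * (b - a).
    by rewrite mulrBl mulrBr hb opprB [RHS]addrC addrA subrK.
  rewrite (le_trans (rnormB _ _)) //.
  have c0 := rnorm_ge0 c; have ba0 := rnorm_ge0 (b - a).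
  move: ba; rewrite ltr_pdivlMr // => ba.
  have := rnormM (b - a) c; have := rnormM c (b - a); nra.
- apply: (cl (fun z => adj z = z)) => [n|a h]; first exact: sqrt_iter_adj.
  apply/eqP; rewrite -subr_eq0; apply/eqP; apply: rnorm_small => e e0.
  have [b hb ba] := h _ (divr_gt0 e0 (ltr0Sn R 1)).
  have -> : adj a - a = (b - a) - adj (b - a).
    by rewrite adjB hb opprB [RHS]addrC addrA subrK.
  rewrite (le_trans (rnormB _ _)) // rnorm_adj; lra.
Qed.

(** Stands for 0 <= 1 - c^2 <= 1: if q is the root of 1 - c^2, then q^2 + c^2 = 1. *)
Lemma sa_compl c : adj c = c -> rnorm c <= 1 -> rnorm (1 - c * c) <= 1.
Proof.
move=> hc c1.
have cc : rnorm (c * c) <= 1 by rewrite rnorm_sqr_sa // expr_le1 // rnorm_ge0.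
have [|y [_ _ sy ey cy]] := sqrt_exists cc; first by rewrite adjM hc.
have sq : adj (1 - y) = 1 - y by rewrite adjB adj1 sy.
rewrite -ey rnorm_sqr_sa //.
apply: (@rc_sum_squares _ c) => //; last by rewrite ey subrK rc1 scale1r.
by rewrite mulrBl mulrBr mul1r mulr1 cy // mulrA.
Qed.

Lemma rnorm_sub_square a : adj a = a ->
  rnorm (rc (rnorm a ^+ 2) *: 1 - a * a) <= rnorm a ^+ 2.
Proof.
move=> ha; have [/rnorm_eq0 ->|n0] := eqVneq (rnorm a) 0.
  by rewrite rnorm0 expr0n /= rc0 scale0r mulr0 subrr rnorm0.
have pa : 0 < rnorm a by rewrite lt_neqAle eq_sym n0 rnorm_ge0.
have n0' : rc (rnorm a) != 0.
  by rewrite -rc0; apply/eqP => /rc_inj /eqP; rewrite (negbTE n0).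
pose c := (rc (rnorm a))^-1 *: a.
have -> : rc (rnorm a ^+ 2) *: 1 - a * a = rc (rnorm a ^+ 2) *: (1 - c * c).
  rewrite scalerBr; congr (_ - _).
  by rewrite /c -scalerAl -scalerAr !scalerA rcX expr2 mulfK // divff // scale1r.
rewrite rnormZ cabs_rc ger0_norm ?exprn_ge0 ?rnorm_ge0 //.
rewrite ler_piMr ?exprn_ge0 ?rnorm_ge0 // sa_compl //.
  by rewrite /c adjZ -rcV rc_conj ha.
by rewrite /c rnormZ -rcV cabs_rc ger0_norm ?invr_ge0 ?rnorm_ge0 // mulVf.
Qed.

(** Replaces the fact that a sum of positive elements is positive. Since T - P is 1 plus a sum of
    terms |s_i|^2 - s_i^2 of norm at most |s_i|^2, P/T is at distance at most 1 from 1 and has a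
    square root. *)
Lemma sum_squares_root (I : finType) (s : I -> A) : (forall i, adj (s i) = s i) ->
  exists p, [/\ adj p = p, p * p = \sum_i s i * s i &
    forall c, c * (\sum_i s i * s i) = (\sum_i s i * s i) * c -> c * p = p * c].
Proof.
move=> hs; set P := \sum_i _.
(* The summand 1 keeps T invertible when every s_i is 0. *)
pose T : R := 1 + \sum_i rnorm (s i) ^+ 2.
have S0 : 0 <= \sum_i rnorm (s i) ^+ 2.
  by apply: sumr_ge0 => i _; rewrite exprn_ge0 // rnorm_ge0.
have T0 : 0 < T by rewrite ltr_wpDr.
have T0' : rc T != 0 by rewrite -rc0; apply/eqP => /rc_inj /eqP; rewrite gt_eqF.
have sP : adj P = P.
  by rewrite adj_sum; apply: eq_bigr => i _; rewrite adjM hs.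
pose x := 1 - (rc T)^-1 *: P.
have x1 : rnorm x <= 1.
  have -> : x = (rc T)^-1 *: (1 + \sum_i (rc (rnorm (s i) ^+ 2) *: 1 - s i * s i)).
    rewrite /x sumrB -scaler_suml -rc_sum addrA scalerBr; congr (_ - _).
    have -> : 1 + rc (\sum_i rnorm (s i) ^+ 2) *: 1 = rc T *: (1 : A).
      by rewrite rcD rc1 scalerDl scale1r.
    by rewrite scalerA mulVf // scale1r.
  rewrite rnormZ -rcV cabs_rc ger0_norm ?invr_ge0 ?(ltW T0) //.
  rewrite ler_pdivrMl // mulr1 (le_trans (rnormD _ _)) // rnorm1 lerD2l.
  by rewrite (le_trans (rnorm_sum _ _ _)) // ler_sum // => i _; exact: rnorm_sub_square.
have sx : adj x = x by rewrite /x adjB adj1 adjZ -rcV rc_conj sP.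
have [y [_ _ sy ey cy]] := sqrt_exists x1 sx.
pose r : R := Num.sqrt T.
have r2 : rc r * rc r = rc T by rewrite -rcM -expr2 sqr_sqrtr // ltW.
exists (rc r *: (1 - y)); split.
- by rewrite adjZ rc_conj adjB adj1 sy.
- rewrite -scalerAl -scalerAr scalerA r2 ey /x opprB addrC subrK scalerA mulfV //.
  by rewrite scale1r.
- move=> c hc; rewrite -scalerAr -scalerAl; congr (_ *: _).
  rewrite mulrBl mulrBr mul1r mulr1 cy // /x mulrBl mulrBr mul1r mulr1.
  by rewrite -scalerAl -scalerAr hc.
Qed.

(** Both 1 - S and 1 + S are sums of squares, of mu_i times a root of 1 - c_i or 1 + c_i, hence
    squares of commuting self-adjoint p and q. Then S^2 + (pq)^2 = 1 bounds S. *)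
Lemma convex_rnorm_sa (I : finType) (mu c : I -> A) :
  (forall i, adj (mu i) = mu i) -> (forall i a, mu i * a = a * mu i) ->
  \sum_i mu i * mu i = 1 -> (forall i, adj (c i) = c i) ->
  (forall i, rnorm (c i) <= 1) -> rnorm (\sum_i mu i * mu i * c i) <= 1.
Proof.
move=> hmu mC mu1 hc c1; set S := \sum_i _.
have root (e : A) : e = 1 \/ e = -1 -> exists p, [/\ adj p = p, p * p = 1 - e * S &
    forall b, b * S = S * b -> b * p = p * b].
  move=> he.
  have eC b : e * b = b * e by case: he => ->; rewrite ?mul1r ?mulr1 ?mulN1r ?mulrN1.
  have ea : adj e = e by case: he => ->; rewrite ?adjN adj1.
  have e1 i : exists y, [/\ adj y = y & y * y = 1 - e * c i].
    have h : rnorm (e * c i) <= 1.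
      by case: he => ->; rewrite ?mulN1r ?rnormN ?mul1r.
    have [|y [_ _ sy ey _]] := sqrt_exists h; first by rewrite adjM ea hc eC.
    by exists (1 - y); rewrite adjB adj1 sy.
  have [d hd] := choice e1.
  have sd i : adj (mu i * d i) = mu i * d i.
    by rewrite adjM hmu mC; case: (hd i) => ->.
  have [p [sp pp cp]] := sum_squares_root sd.
  have eS : \sum_i mu i * d i * (mu i * d i) = 1 - e * S.
    rewrite -mu1 /S mulr_sumr -sumrB; apply: eq_bigr => i _.
    have -> : mu i * d i * (mu i * d i) = mu i * mu i * (d i * d i).
      by rewrite -!mulrA; congr (_ * _); rewrite mulrA -mC -mulrA.
    case: (hd i) => _ ->; rewrite mulrBr mulr1; congr (_ - _).
    by rewrite [LHS]mulrA -eC [RHS]mulrA.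
  exists p; split => //; first by rewrite pp.
  move=> b hb; apply: cp; rewrite eS mulrBr mulrBl mulr1 mul1r.
  by rewrite -mulrA -hb mulrA -eC -mulrA.
have [|p [sp pp cp]] := root 1; first by left.
have [|q [sq qq cq]] := root (-1); first by right.
rewrite mul1r in pp; rewrite mulN1r opprK in qq.
have Sp : S * p = p * S by apply: cp.
have Sq : S * q = q * S by apply: cq.
have pq : p * q = q * p by apply: cq.
have sS : adj S = S.
  rewrite adj_sum; apply: eq_bigr => i _; rewrite !adjM !hmu hc.
  by rewrite -[RHS]mulrA [RHS]mC (mC i (c i)) -mulrA.
have := @rc_sum_squares S (p * q) 1 sS.
rewrite expr_le1 ?rnorm_ge0 //; apply => //.
- by rewrite adjM sp sq pq.
- by rewrite mulrA Sp -mulrA Sq mulrA.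
- have -> : p * q * (p * q) = 1 - S * S.
    rewrite mulrA -(mulrA p) -pq mulrA pp -mulrA qq mulrBl mul1r mulrDr mulr1.
    by rewrite opprD addrA addrK.
  by rewrite addrC subrK rc1 scale1r.
Qed.

Lemma re_im (a : A) : exists u v, [/\ adj u = u, adj v = v, a = u + 'i *: v,
  rnorm u <= rnorm a & rnorm v <= rnorm a].
Proof.
exists (rc 2^-1 *: (a + adj a)), (rc 2^-1 *: ('i *: (adj a - a))); split.
- by rewrite adjZ rc_conj adjD adjK addrC.
- by rewrite adjZ rc_conj adjZ conjCi adjB adjK scaleNr -scalerN opprB.
- rewrite scalerA [_ * rc _]mulrC -scalerA [_ *: (_ *: (_ - _))]scalerA.
  have -> : 'i * 'i = -1 :> C by rewrite -expr2 sqrCi.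
  by rewrite scaleN1r opprB -scalerDr addrACA subrr addr0 double_half.
- by rewrite rnorm_half; have := rnormD a (adj a); rewrite rnorm_adj; lra.
- rewrite rnorm_half rnormZ cabs_i mul1r; have := rnormB (adj a) a.
  by rewrite rnorm_adj; lra.
Qed.

(** The factor 2 comes from bounding the real and the imaginary parts of the c_i separately. *)
Lemma convex_rnorm (I : finType) (mu c : I -> A) (e : R) : 0 < e ->
  (forall i, adj (mu i) = mu i) -> (forall i a, mu i * a = a * mu i) ->
  \sum_i mu i * mu i = 1 ->
  (forall i, rnorm (c i) <= e) -> rnorm (\sum_i mu i * mu i * c i) <= 2 * e.
Proof.
move=> e0 hmu mC mu1 ce.
have e0' : rc e != 0 by rewrite -rc0; apply/eqP => /rc_inj /eqP; rewrite gt_eqF.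
have [u hu] := choice (fun i => re_im (c i)); have [v hv] := choice hu.
have sa (w : I -> A) : (forall i, adj (w i) = w i) -> (forall i, rnorm (w i) <= e) ->
    rnorm (\sum_i mu i * mu i * w i) <= e.
  move=> sw we.
  have -> : \sum_i mu i * mu i * w i =
      rc e *: \sum_i mu i * mu i * ((rc e)^-1 *: w i).
    rewrite scaler_sumr; apply: eq_bigr => i _.
    by rewrite -scalerAr scalerA mulfV // scale1r.
  rewrite rnormZ cabs_rc ger0_norm ?(ltW e0) // ler_piMr ?(ltW e0) //.
  apply: convex_rnorm_sa => // i; first by rewrite adjZ -rcV rc_conj sw.
  rewrite rnormZ -rcV cabs_rc ger0_norm ?invr_ge0 ?(ltW e0) //.
  by rewrite ler_pdivrMl // mulr1.
have -> : \sum_i mu i * mu i * c i =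
    \sum_i mu i * mu i * u i + 'i *: \sum_i mu i * mu i * v i.
  rewrite scaler_sumr -big_split; apply: eq_bigr => i _ /=.
  by rewrite scalerAr -mulrDr; case: (hv i) => _ _ <-.
rewrite (le_trans (rnormD _ _)) // rnormZ cabs_i mul1r mulr_natl mulr2n lerD // sa //.
- by move=> i; case: (hv i).
- by move=> i; case: (hv i) => _ _ _ h _; apply: le_trans (ce i).
- by move=> i; case: (hv i).
- by move=> i; case: (hv i) => _ _ _ _ h; apply: le_trans (ce i).
Qed.

End OneAlgebra.

Section Morphisms.
Variables (A B : cstarType R) (f : A -> B).
Hypothesis hf : star_hom f.

(** For b = adj a a divided by |a|^2, which has norm 1, the identity b^2 + (1 - y)^2 = 1 is
    preserved by f and bounds f b. *)
Lemma star_hom_rnorm a : rnorm (f a) <= rnorm a.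
Proof.
have [/rnorm_eq0 ->|n0] := eqVneq (rnorm a) 0; first by rewrite (star_hom0 hf) !rnorm0.
have pa : 0 < rnorm a by rewrite lt_neqAle eq_sym n0 rnorm_ge0.
pose t : C := (rc (rnorm a ^+ 2))^-1.
have t0 : 0 <= (rnorm a ^+ 2)^-1 by rewrite invr_ge0 exprn_ge0 // rnorm_ge0.
pose b := t *: (adj a * a).
have sb : adj b = b by rewrite /b adjZ /t -rcV rc_conj adjM adjK.
have nt (D : cstarType R) (c : D) : rnorm (t *: (adj c * c)) = rnorm c ^+ 2 / rnorm a ^+ 2.
  by rewrite rnormZ rnorm_adjl /t -rcV cabs_rc ger0_norm // mulrC.
have b1 : rnorm b = 1 by rewrite nt divff // expf_neq0.
have bb1 : rnorm (b * b) <= 1 by rewrite rnorm_sqr_sa // b1 expr1n.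
have [|y [_ _ sy ey cy]] := sqrt_exists bb1; first by rewrite adjM sb.
have h : rnorm (f b) ^+ 2 <= 1.
  apply: (@rc_sum_squares _ _ (f (1 - y))) => //.
  - by rewrite -(star_hom_adj hf) sb.
  - by rewrite -(star_hom_adj hf) adjB adj1 sy.
  - rewrite -!(star_homM hf); congr f.
    by rewrite mulrBl mulrBr mul1r mulr1 cy // mulrA.
  - by rewrite -!(star_homM hf) ey -(star_homD hf) addrC subrK (star_hom1 hf) rc1 scale1r.
move: h; rewrite expr_le1 ?rnorm_ge0 //.
rewrite /b (star_homZ hf) (star_homM hf) (star_hom_adj hf) nt.
rewrite ler_pdivrMr ?exprn_gt0 // mul1r.
by rewrite ler_sqr ?nnegrE ?rnorm_ge0.
Qed.

Lemma star_hom_sqrt_iter x n : f (sqrt_iter x n) = sqrt_iter (f x) n.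
Proof.
elim: n => [|n IH] /=; first exact: star_hom0.
by rewrite (star_homZ hf) (star_homD hf) (star_homM hf) IH.
Qed.

Lemma star_hom_sqrt_lim x y : sqrt_lim x y -> sqrt_lim (f x) (f y).
Proof.
move=> h e e0; have [N hN] := h e e0; exists N => n /hN.
by rewrite -star_hom_sqrt_iter -(star_homB hf); apply: le_lt_trans (star_hom_rnorm _).
Qed.

End Morphisms.

(* [w] is the fixed point reached by the iteration started at 0. *)
Lemma sqrt_lim_contr (A : cstarType R) (x w : A) : rnorm x <= 1 -> rnorm w < 1 ->
  (1 - w) * (1 - w) = 1 - x -> sqrt_lim x w.
Proof.
move=> hx hw e.
have ew : w = rc 2^-1 *: (x + w * w).
  have -> : x = w + w - w * w.
    have -> : x = 1 - (1 - w) * (1 - w) by rewrite e opprB addrC subrK.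
    by rewrite mulrBr mulr1 mulrBl mul1r !opprB [LHS]addrC -addrA subrK addrAC.
  by rewrite subrK double_half.
have cw n : w * sqrt_iter x n = sqrt_iter x n * w.
  apply: sqrt_iter_comm; clear ew hx; have -> : x = 1 - (1 - w) * (1 - w) by rewrite e opprB addrC subrK.
  have cc : w * (1 - w) = (1 - w) * w by rewrite mulrBr mulrBl mulr1 mul1r.
  move: (1 - w) cc => v cc.
  rewrite mulrBr mulrBl mulr1 mul1r; congr (_ - _).
  by rewrite [LHS]mulrA cc -[LHS]mulrA cc mulrA.
(* The error satisfies |z' - w| <= |z - w| |z + w| / 2 with |z| <= 1, so each iteration shrinks it
   by this factor. *)
pose q : R := (1 + rnorm w) / 2.
have q0 : 0 <= q by rewrite divr_ge0 // addr_ge0 ?rnorm_ge0.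
have q1 : q < 1 by rewrite /q; lra.
have step n : rnorm (sqrt_iter x n - w) <= q ^+ n.
  elim: n => [|n IH]; first by rewrite /= sub0r rnormN expr0 ltW.
  have -> : sqrt_iter x n.+1 - w =
     rc 2^-1 *: ((sqrt_iter x n - w) * (sqrt_iter x n + w)).
    by rewrite {1}ew /= -scalerBr opprD addrACA subrr add0r comm_diff_sq.
  rewrite rnorm_half exprSr.
  have := rnormM (sqrt_iter x n - w) (sqrt_iter x n + w).
  have := rnormD (sqrt_iter x n) w.
  have := le_trans (sqrt_iter_le n hx) (sqrt_bound_le1 n).
  have := rnorm_ge0 (sqrt_iter x n - w); have := rnorm_ge0 (sqrt_iter x n + w).
  move: IH; rewrite /q; set Q := (_ / 2) ^+ n.
  move: (rnorm (_ - w)) (rnorm (_ + w)) (rnorm (sqrt_iter _ _)) (rnorm w) (rnorm (_ * _)).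
  move=> a b c d m h1 h2 h3 h4 h5 h6.
  have hb : b <= 1 + d by lra.
  have : a * b <= Q * (1 + d) by apply: ler_pM.
  by move=> h7; rewrite mulrA [leRHS]mulrC ler_pM2l ?invr_gt0 //; lra.
move=> d d0.
have : (fun n => q ^+ n) @ \oo --> (0 : R).
  by apply: cvg_expr; rewrite ger0_norm.
move=> /cvgrPdist_lt /(_ _ d0) [N _ hN]; exists N => n /hN /=.
rewrite sub0r normrN ger0_norm ?exprn_ge0 //; exact: le_lt_trans (step n).
Qed.

End SquareRoot.

(** * Injective morphisms are isometric and have closed range *)

Section Isometry.
Variables (R : realType) (A B : cstarType R) (f : A -> B).
Local Notation C := (cplx R).
Hypothesis hf : star_hom f.
Hypothesis injf : injective f.

(* With h = b^2 positive and |f h| < s < |h|, the element (h - s) + |h - s| is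
   killed by f, hence zero, hence h <= s. *)
Lemma star_hom_isometry a : rnorm (f a) = rnorm a.
Proof.
apply/eqP; rewrite eq_le (star_hom_rnorm hf) leNgt; apply/negP => lt.
have fa0 := rnorm_ge0 (f a).
have pa : 0 < rnorm a by apply: le_lt_trans lt.
(* This scaling gives b norm 1/2, so that b^2 - s has norm at most 1, as [sa_compl] requires. *)
pose k : R := (2 * rnorm a ^+ 2)^-1.
have k0 : 0 <= k by rewrite invr_ge0 mulr_ge0 // exprn_ge0 // ltW.
pose b := rc k *: (adj a * a).
have nk (D : cstarType R) (e : D) : rnorm (rc k *: (adj e * e)) = k * rnorm e ^+ 2.
  by rewrite rnormZ rnorm_adjl cabs_rc ger0_norm.
have ka : k * rnorm a ^+ 2 = 2^-1.
  by rewrite /k invfM -mulrA mulVf ?mulr1 // expf_neq0 // gt_eqF.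
have b1 : rnorm b = 2^-1 by rewrite nk ka.
have fbE : f b = rc k *: (adj (f a) * f a).
  by rewrite (star_homZ hf) (star_homM hf) (star_hom_adj hf).
have sb : adj b = b by rewrite /b adjZ rc_conj adjM adjK.
have sfb : adj (f b) = f b by rewrite -(star_hom_adj hf) sb.
pose g := rnorm (f b).
have g0 : 0 <= g by exact: rnorm_ge0.
have k0' : 0 < k by rewrite invr_gt0 mulr_gt0 // exprn_gt0.
have g1 : g < 2^-1.
  rewrite /g fbE nk -ka ltr_pM2l // ltr_sqr ?nnegrE ?rnorm_ge0 //.
clearbody b.
(* Midpoint of the squared norms of f b and of b. *)
pose s : R := (g ^+ 2 + 4^-1) / 2.
have s1 : g ^+ 2 < s by rewrite /s; nra.
have s2 : s < 4^-1 by rewrite /s; nra.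
have s0 : 0 <= s by rewrite /s; nra.
pose c := b * b - rc s *: 1.
have sc : adj c = c by rewrite /c adjB adjM sb adjZ rc_conj adj1.
have c1 : rnorm c <= 1.
  rewrite (le_trans (rnormB _ _)) // rnorm_sqr_sa // b1 rnormZ rnorm1 cabs_rc mulr1.
  by rewrite ger0_norm //; nra.
have hx := sa_compl sc c1.
have [|y [yl y1 sy _ _]] := sqrt_exists hx; first by rewrite adjB adj1 adjM sc.
(* w = 1 + f c. Since f b has squared norm below s, w has norm below 1 and is the limit 1 - |f c| of
   the iteration; f maps y = 1 - |c| to that limit. *)
pose w := rc (1 - s) *: 1 + f b * f b.
have w1 : rnorm w < 1.
  rewrite (le_lt_trans (rnormD _ _)) // rnorm_sqr_sa // rnormZ rnorm1 cabs_rc mulr1 -/g.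
  by rewrite ger0_norm; nra.
have ew : 1 - w = - f c.
  rewrite /w /c (star_homB hf) (star_homM hf) (star_homZ hf) (star_hom1 hf).
  by rewrite rcB rc1 scalerBl scale1r [RHS]opprB opprD addrA opprB subrKC.
clearbody c.
have fy : f y = w.
  apply: (sqrt_lim_unique (star_hom_sqrt_lim hf yl)); apply: sqrt_lim_contr => //.
    by rewrite (le_trans (star_hom_rnorm hf _)).
  rewrite ew mulrNN (star_homB hf) (star_hom1 hf) (star_homM hf).
  by rewrite opprB addrC subrK.
have ey : y = rc (1 - s) *: 1 + b * b.
  by apply: injf; rewrite fy (star_homD hf) (star_homZ hf) (star_hom1 hf) (star_homM hf).
have [z [_ _ sz ez cz]] := sqrt_exists y1 sy.
have : rnorm b ^+ 2 <= s.
  apply: (@rc_sum_squares _ _ b (1 - z)) => //.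
  - by rewrite adjB adj1 sz.
  - rewrite mulrBl mulrBr mul1r mulr1 cz // ey mulrDr mulrDl mulrA.
    by rewrite -scalerAl -scalerAr mul1r mulr1.
  - rewrite ez ey rcB rc1 scalerBl scale1r opprD [1 + _]addrA opprB subrKC.
    by rewrite addrC subrK.
by rewrite b1; move: s2; rewrite leNgt; nra.
Qed.

Lemma closed_range : closed (range f).
Proof.
apply/closedRP => b hb.
have near n : exists a, rnorm (b - f a) < 2 / (n%:R + 2).
  have [|_ [a _ <-] ha] := hb (2 / (n%:R + 2)); last by exists a.
  by rewrite divr_gt0 // ltr_wpDl.
have [u hu] := choice near.
have small e : 0 < e -> exists N, forall n, (N <= n)%N -> rnorm (b - f (u n)) < e.
  move=> e0; have [N hN] := small_inv e0; exists N => n Nn.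
  apply: lt_le_trans (hu n) _; apply: le_trans (ltW hN).
  have p k : 0 < k%:R + 2 :> R by rewrite ltr_wpDl.
  by rewrite ler_pM2l // lef_pV2 ?posrE // lerD2r ler_nat.
have [l hl] : exists l, forall e : R, 0 < e -> exists N, forall n, (N <= n)%N ->
    rnorm (u n - l) < e.
  apply: complete_rnorm => e e0.
  have [N hN] := small _ (divr_gt0 e0 (ltr0Sn R 1)); exists N => m n hm hn.
  rewrite -star_hom_isometry (star_homB hf).
  have -> : f (u m) - f (u n) = (b - f (u n)) - (b - f (u m)).
    by rewrite opprB [RHS]addrC addrA subrK.
  by rewrite (le_lt_trans (rnormB _ _)) // [e]splitr ltrD // hN.
exists l => //; apply/eqP; rewrite eq_sym -subr_eq0; apply/eqP.
apply: rnorm_small => e e0; have e2 := divr_gt0 e0 (ltr0Sn R 1).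
have [N hN] := hl _ e2; have [N' hN'] := small _ e2.
pose n := maxn N N'.
have -> : b - f l = (b - f (u n)) + f (u n - l).
  by rewrite (star_homB hf) addrA subrK.
rewrite (le_trans (rnormD _ _)) // [e]splitr lerD //.
  by rewrite ltW // hN' // leq_maxr.
by rewrite star_hom_isometry ltW // hN // leq_maxl.
Qed.
End Isometry.

(** * Partitions of unity *)

Section Continuity.
Variables (R : realType) (X : topologicalType).
Local Notation C := (cplx R).

Lemma nbhs_cabsP (z : C) (V : set C) :
  nbhs z V <-> exists2 e : R, 0 < e & forall w, cabs (w - z) < e -> V w.
Proof.
split.
  move=> /nbhs_ballP[e /= e0 h]; have ee := ge0_rc (ltW e0).
  exists (complex.Re e); first by rewrite -rc_lt rc0 -ee.
  move=> w hw; apply: h; rewrite -ball_normE /ball_ /= cabsE ee rc_lt.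
  by rewrite -cabsN opprB.
case=> e e0 h; apply/nbhs_ballP; exists (rc e); first by rewrite /= -rc0 rc_lt.
move=> w; rewrite -ball_normE /ball_ /= cabsE rc_lt -cabsN opprB; exact: h.
Qed.

Lemma continuous_atP (g : X -> C) x :
  {for x, continuous g} <->
  forall e : R, 0 < e -> \forall y \near x, cabs (g y - g x) < e.
Proof.
split=> [h e e0|h V /nbhs_cabsP[e e0 hV]].
  by apply: (h [set w | cabs (w - g x) < e]); apply/nbhs_cabsP; exists e.
by apply: filterS (h e e0) => y; apply: hV.
Qed.

Lemma continuous_atRP (g : X -> R) x :
  {for x, continuous g} <->
  forall e : R, 0 < e -> \forall y \near x, `|g y - g x| < e.
Proof.
split=> [h e e0|h].
  have /cvgrPdist_lt /(_ _ e0) := h; apply: filterS => y.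
  by rewrite distrC.
apply/cvgrPdist_lt => e /h; apply: filterS => y; by rewrite distrC.
Qed.

Lemma continuous_rc (g : X -> R) : continuous g -> continuous (fun x => rc (g x)).
Proof.
move=> h x; apply/continuous_atP => e e0.
have /continuous_atRP /(_ _ e0) := h x; apply: filterS => y.
by rewrite -rcB cabs_rc.
Qed.

Lemma ler_dist_cabs (z w : C) : `|cabs z - cabs w| <= cabs (z - w).
Proof.
rewrite ler_distlC; apply/andP; split.
  by rewrite lerBlDr; have := cabsD w (z - w); rewrite [w + _]addrC subrK.
by have := cabsD z (w - z); rewrite [z + _]addrC subrK -opprB cabsN.
Qed.

Lemma continuous_cabs (g : X -> C) x :
  {for x, continuous g} -> {for x, continuous (fun x => cabs (g x))}.
Proof.
move/continuous_atP => h; apply/continuous_atRP => e e0.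
by apply: filterS (h e e0) => y; apply: le_lt_trans (ler_dist_cabs _ _).
Qed.

Lemma continuous_conj (g : X -> C) x :
  {for x, continuous g} -> {for x, continuous (fun x => (g x)^*)}.
Proof.
move/continuous_atP => h; apply/continuous_atP => e e0.
by apply: filterS (h e e0) => y; rewrite -rmorphB cabs_conj.
Qed.

Lemma continuous_sum (K : numFieldType) (I : Type) (r : seq I) (P : pred I) (F : I -> X -> K) (x : X) :
  (forall i, {for x, continuous (F i)}) ->
  {for x, continuous (fun y => \sum_(i <- r | P i) F i y)}.
Proof.
move=> h; elim: r => [|i r IH].
  rewrite (_ : (fun y => _) = fun=> 0); first exact: cst_continuous.
  by apply/funext => y; rewrite big_nil.
have [pi|/negbTE pi] := boolP (P i).
  rewrite (_ : (fun y => _) = fun y => F i y + \sum_(i <- r | P i) F i y).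
    exact: (continuousD (h i) IH).
  by apply/funext => y; rewrite big_cons pi.
rewrite (_ : (fun y => _) = fun y => \sum_(i <- r | P i) F i y) //.
by apply/funext => y; rewrite big_cons pi.
Qed.
Lemma continuous_scale (k : C) (g : X -> C) : continuous g ->
  continuous (fun x => k * g x).
Proof. by move=> cg x; apply: continuousM; [exact: cst_continuous | exact: cg]. Qed.
Lemma continuous_mul (f g : X -> C) : continuous f -> continuous g ->
  continuous (fun x => f x * g x).
Proof. by move=> cf cg x; apply: continuousM; [exact: cf | exact: cg]. Qed.
Lemma continuous_const (k : C) : continuous (fun _ : X => k).
Proof. by move=> x; exact: cst_continuous. Qed.
End Continuity.
Arguments continuous_scale {R X} k {g}.
Arguments continuous_const {R} X k.

(** Compactness is used as a statement on filters; the filter of finite lists ordered by inclusion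
    turns it into a finite subcover. *)
Lemma compact_finite_cover (T : topologicalType) (K : set T) (V : T -> set T) :
  compact K -> (forall x, K x -> nbhs x (V x)) ->
  exists s : seq T, forall y, K y -> exists2 x, x \in s & V x y.
Proof.
move=> /compact_near_coveringP cK hV.
pose F := filter_from [set: seq T] (fun s0 => [set s : seq T | {subset s0 <= s}]).
have FF : Filter F.
  apply: filter_from_filter; first by exists [::].
  move=> s t _ _; exists (s ++ t) => // u /= h; split => x xs; apply: h.
    by rewrite mem_cat xs.
  by rewrite mem_cat xs orbT.
have [|s _ hs] := cK _ F (fun s y => exists2 x, x \in s & V x y) FF.
  move=> x Kx; exists (V x, [set s : seq T | {subset [:: x] <= s}]).
    by split => /=; [exact: hV | exists [:: x]].
  by case=> y s /= [Vy hs]; exists x => //; apply: hs; rewrite mem_head.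
by exists s => y Ky; apply: (hs s) => //=.
Qed.

Section CompactHausdorff.
Variables (R : realType) (X : topologicalType).
Hypotheses (hX : hausdorff_space X) (cX : compact [set: X]).

Lemma bump_function (x : X) (U : set X) : nbhs x U -> exists b : X -> R,
  [/\ continuous b, forall y, 0 <= b y <= 1, \forall y \near x, b y = 1 &
      forall y, ~ U y -> b y = 0].
Proof.
move=> xU.
have /normal_separatorP sep := compact_normal hX cX.
have h1 : closed (~` U°) by apply: open_closedC; exact: open_interior.
have h2 : closed [set x] by apply: accessible_closed_set1; exact: hausdorff_accessible.
have h3 : ~` U° `&` [set x] = set0.
  by apply/seteqP; split => // y [hy /= eyx]; apply: hy; rewrite eyx; exact: xU.
have /(@uniform_separatorP _ R)[f [cf f01 f0 f1]] := sep R _ _ h1 h2 h3.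
have f01' y : 0 <= f y <= 1 by have := f01 (f y); rewrite /= in_itv /=; apply; exists y.
have fx : f x = 1 by apply: (f1 (f x)); exists x.
(* Truncating 2 f makes the function equal to 1 on a neighbourhood of x and not only at x. *)
exists (fun y => Num.min 1 (2 * f y)); split.
- move=> y; have c1 : {for y, continuous (fun _ : X => 1 : R^o)} by exact: cst_continuous.
  have c2 : {for y, continuous (fun z => 2 * f z : R^o)}.
    by apply: continuousM; [exact: cst_continuous | exact: cf].
  exact: continuous_min c1 c2.
- move=> y; have /andP[a0 a1] := f01' y.
  by rewrite le_min ler01 mulr_ge0 //= ge_min lexx.
- have /continuous_atRP /(_ 2^-1) := cf x; rewrite invr_gt0 ltr0n => /(_ isT).
  apply: filterS => y; rewrite fx => h; apply/min_idPl.
  by move: h; rewrite ltr_norml => /andP[]; lra.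
- move=> y nU; have -> : f y = 0.
    by apply: (f0 (f y)); exists y => // h; apply: nU; exact: interior_subset h.
  by rewrite mulr0; apply/min_idPr.
Qed.

(** It is the squares that sum to 1, because [convex_rnorm] takes its weights as squares of central
    elements. *)
Lemma partition_of_unity (V : X -> set X) : (forall x, nbhs x (V x)) ->
  exists (I : finType) (p : I -> X) (mu : I -> X -> R),
    [/\ forall i, continuous (mu i), forall y, \sum_i mu i y * mu i y = 1 &
        forall i y, mu i y != 0 -> V (p i) y].
Proof.
move=> hV; have [b hb] := choice (fun x => bump_function (hV x)).
have b0 x y : 0 <= b x y by have [_ /(_ y)/andP[]] := hb x.
have [|s hs] := @compact_finite_cover X setT (fun x => [set y | 0 < b x y]) cX.
  move=> x _; have [_ _ h _] := hb x.
  by apply: filterS h => y /= ->; exact: ltr01.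
pose D := seq_sub s.
pose S y := \sum_(i : D) b (val i) y.
have S0 y : 0 < S y.
  have [x xs /= xy] := hs y I.
  rewrite /S (bigD1 (SeqSub xs)) //= ltr_pwDl // sumr_ge0 // => i _; exact: b0.
exists D, (fun i => val i), (fun i y => Num.sqrt (b (val i) y / S y)); split.
- move=> i y.
  have cS : {for y, continuous S}.
    by apply: continuous_sum => k; have [h _ _ _] := hb (val k); exact: h.
  have cb : {for y, continuous (b (val i))} by have [h _ _ _] := hb (val i); exact: h.
  have cq : {for y, continuous (fun z => b (val i) z / S z)}.
    apply: continuousM => //; apply: continuousV => //; by rewrite gt_eqF // S0.
  exact: (continuous_comp cq (@sqrt_continuous R _)).
- move=> y; under eq_bigr do rewrite -expr2 sqr_sqrtr ?divr_ge0 ?b0 ?(ltW (S0 y)) //.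
  by rewrite -mulr_suml -/(S y) divff // gt_eqF // S0.
- move=> i y nz; apply: contrapT => nV; have [_ _ _ h] := hb (val i).
  by move: nz; rewrite h // mul0r sqrtr0 eqxx.
Qed.
End CompactHausdorff.

(** * Fibres of C(X)-algebras *)

Section Spans.
Variables (R : realType).
Local Notation C := (cplx R).

Definition subspace (A : cstarType R) (N : set A) : Prop :=
  N 0 /\ forall (k : C) a b, N a -> N b -> N (k *: a + b).

Section OneAlgebra.
Variable A : cstarType R.
Implicit Types (S N : set A) (a b : A).

Lemma subspaceD N a b : subspace N -> N a -> N b -> N (a + b).
Proof. by case=> _ h Na Nb; rewrite -(scale1r a); apply: h. Qed.
Lemma subspaceZ N (k : C) a : subspace N -> N a -> N (k *: a).
Proof. by case=> h0 h Na; rewrite -(addr0 (k *: a)); apply: h. Qed.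
Lemma subspaceN N a : subspace N -> N a -> N (- a).
Proof. by move=> h Na; rewrite -scaleN1r; apply: subspaceZ. Qed.
Lemma subspaceB N a b : subspace N -> N a -> N b -> N (a - b).
Proof. by move=> h Na Nb; apply: subspaceD => //; apply: subspaceN. Qed.
Lemma subspace_sum N (I : Type) (r : seq I) (F : I -> A) :
  subspace N -> (forall i, N (F i)) -> N (\sum_(i <- r) F i).
Proof.
move=> h hF; elim/big_ind: _ => //; first by case: h.
by move=> a b; apply: subspaceD.
Qed.

Lemma lspan_subspace S : subspace (lspan S).
Proof.
split; first by exists 0%N, (fun=> 0), (fun=> 0); split; [case | rewrite big_ord0].
move=> k _ _ [n [c [s [hs ->]]]] [m [d [t [ht ->]]]].
exists (n + m)%N, (fun i : 'I_(n + m) => match fintype.split i with inl j => k * c j | inr j => d j end),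
  (fun i : 'I_(n + m) => match fintype.split i with inl j => s j | inr j => t j end).
split; first by move=> i; case: (fintype.split i).
rewrite big_split_ord /=; congr (_ + _); last first.
  by apply: eq_bigr => i _; rewrite (unsplitK (inr i : 'I_n + 'I_m)).
rewrite scaler_sumr; apply: eq_bigr => i _.
by rewrite (unsplitK (inl i : 'I_n + 'I_m)) scalerA.
Qed.

Lemma lspan_sub S : S `<=` lspan S.
Proof.
move=> a Sa; exists 1%N, (fun=> 1), (fun=> a); split => //.
by rewrite big_ord1 scale1r.
Qed.

Lemma lspan_min S N : subspace N -> S `<=` N -> lspan S `<=` N.
Proof.
move=> hN h _ [n [k [s [hs ->]]]]; apply: subspace_sum => // i.
by apply: subspaceZ => //; apply: h.
Qed.

Lemma clspanP S a : clspan S a <->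
  forall e : R, 0 < e -> exists2 b, lspan S b & rnorm (a - b) < e.
Proof. exact: closureRP. Qed.

Lemma lspan_clspan S : lspan S `<=` clspan S.
Proof. exact: subset_closure. Qed.

Lemma clspan_sub S : S `<=` clspan S.
Proof. by move=> a /lspan_sub /lspan_clspan. Qed.

Lemma clspan_closed S : closed (clspan S).
Proof. exact: closed_closure. Qed.

Lemma closed_approx N a : closed N ->
  (forall e : R, 0 < e -> exists2 b, N b & rnorm (a - b) < e) -> N a.
Proof. by move=> /closedRP h; apply: h. Qed.

Lemma clspan_subspace S : subspace (clspan S).
Proof.
have hS := lspan_subspace S.
split; first by apply: lspan_clspan; case: hS.
move=> k a b /clspanP ha /clspanP hb; apply/clspanP => e e0.
have k0 : 0 < 2 * (cabs k + 1) by rewrite mulr_gt0 // ltr_wpDl ?cabs_ge0.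
have [a' Sa aa] := ha _ (divr_gt0 e0 k0).
have [b' Sb bb] := hb _ (divr_gt0 e0 (ltr0Sn R 1)).
exists (k *: a' + b'); first by case: hS => _; apply.
have -> : k *: a + b - (k *: a' + b') = k *: (a - a') + (b - b').
  by rewrite opprD addrACA scalerBr.
rewrite (le_lt_trans (rnormD _ _)) // rnormZ.
have := rnorm_ge0 (a - a'); have := cabs_ge0 k; move: aa.
rewrite ltr_pdivlMr //; nra.
Qed.

Lemma clspan_min S N : subspace N -> closed N -> S `<=` N -> clspan S `<=` N.
Proof.
move=> hN cN h a /clspanP ha; apply: closed_approx => // e /ha[b Sb ab].
by exists b => //; apply: lspan_min Sb.
Qed.
End OneAlgebra.

(** Homogeneity is asked only as stability of N under scaling of the argument, so that f may be
    conjugate linear, as [adj] is. *)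
Lemma clspan_map (A B : cstarType R) (S : set A) (N : set B) (f : A -> B) (K : R) :
  subspace N -> closed N -> f 0 = 0 -> (forall a b, f (a + b) = f a + f b) ->
  (forall (k : C) a, N (f a) -> N (f (k *: a))) ->
  (forall a, rnorm (f a) <= K * rnorm a) ->
  (forall a, S a -> N (f a)) -> forall a, clspan S a -> N (f a).
Proof.
move=> hN cN f0 fD fZ fK fS a /clspanP ha; apply: closed_approx => // e e0.
have K1 : 0 < `|K| + 1 by rewrite ltr_wpDl.
have [b [n [k [s [hs ->]]]] ab] := ha _ (divr_gt0 e0 K1).
exists (f (\sum_i k i *: s i)).
  rewrite (big_morph _ fD f0); apply: subspace_sum => // i.
  by apply: fZ; apply: fS.
have fB u v : f (u - v) = f u - f v.
  by apply/eqP; rewrite eq_sym subr_eq -fD subrK.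
rewrite -fB (le_lt_trans (fK _)) //; move: ab; rewrite ltr_pdivlMr //.
have := rnorm_ge0 (a - \sum_i k i *: s i); have := ler_norm K; nra.
Qed.
End Spans.

Section CxAlgebra.
Variables (R : realType) (X : topologicalType) (A : cstarType R).
Local Notation C := (cplx R).
Variable iota : (X -> C) -> A.
Hypotheses (hX : hausdorff_space X) (cX : compact [set: X]).
Hypotheses (hi : cfun_hom iota) (iota_centre : forall f : X -> C, continuous f -> centre (iota f)).

Lemma iotaC (f : X -> C) a : continuous f -> iota f * a = a * iota f.
Proof. by move=> /iota_centre; apply. Qed.
Lemma iotaD (f g : X -> C) : continuous f -> continuous g ->
  iota (fun x => f x + g x) = iota f + iota g.
Proof. by have [_ h _ _ _] := hi; exact: (h f g). Qed.
Lemma iotaZ (k : C) (f : X -> C) : continuous f -> iota (fun x => k * f x) = k *: iota f.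
Proof. by have [_ _ h _ _] := hi; exact: (h k f). Qed.
Lemma iotaM (f g : X -> C) : continuous f -> continuous g ->
  iota (fun x => f x * g x) = iota f * iota g.
Proof. by have [_ _ _ h _] := hi; exact: (h f g). Qed.
Lemma iota_adj (f : X -> C) : continuous f -> iota (fun x => (f x)^*) = adj (iota f).
Proof. by have [_ _ _ _ h] := hi; exact: (h f). Qed.
Lemma iota_cst (k : C) : iota (fun=> k) = k *: 1.
Proof.
have [h _ _ _ _] := hi; rewrite -h -(iotaZ k (continuous_const X (1 : C))).
by congr iota; apply/funext => x; rewrite mulr1.
Qed.
Lemma iotaB (f g : X -> C) : continuous f -> continuous g ->
  iota (fun x => f x - g x) = iota f - iota g.
Proof.
move=> cf cg; rewrite -scaleN1r -(iotaZ (-1) cg) -(iotaD cf (continuous_scale _ cg)).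
by congr iota; apply/funext => x; rewrite mulN1r.
Qed.
Lemma iota_sum (I : Type) (r : seq I) (F : I -> X -> C) : (forall i, continuous (F i)) ->
  iota (fun x => \sum_(i <- r) F i x) = \sum_(i <- r) iota (F i).
Proof.
move=> cF; elim: r => [|i s IH].
  rewrite big_nil (_ : (fun x => _) = fun=> 0); last by apply/funext => x; rewrite big_nil.
  by rewrite iota_cst scale0r.
have cs : continuous (fun x => \sum_(k <- s) F k x).
  by move=> x; apply: continuous_sum => k; exact: cF.
rewrite big_cons -IH -(iotaD (cF i) cs).
by congr iota; apply/funext => x; rewrite big_cons.
Qed.

(** For g = |f| and h the root of t^2 - |f|^2 one has g^2 + h^2 = t^2, so [rc_sum_squares] bounds
    the image of g, whose norm is that of the image of f. *)
Lemma iota_le (f : X -> C) (t : R) : continuous f -> 0 <= t -> (forall x, cabs (f x) <= t) ->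
  rnorm (iota f) <= t.
Proof.
move=> cf t0 ft.
pose h x := rc (Num.sqrt (t ^+ 2 - cabs (f x) ^+ 2)).
pose g x := rc (cabs (f x)).
have cc : continuous (fun x => cabs (f x)) by move=> x; apply: continuous_cabs; exact: cf.
have cg : continuous g by apply: continuous_rc.
have ch : continuous h.
  apply: continuous_rc => x.
  have c1 : {for x, continuous (fun x => t ^+ 2 - cabs (f x) ^+ 2)}.
    apply: continuousB; first exact: cst_continuous.
    exact: (continuousM (cc x) (cc x)).
  exact: (continuous_comp c1 (@sqrt_continuous R _)).
have ra (u : X -> R) : continuous (fun x => rc (u x)) ->
    adj (iota (fun x => rc (u x))) = iota (fun x => rc (u x)).
  by move=> cu; rewrite -(iota_adj cu); congr iota; apply/funext => x; rewrite rc_conj.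
have ag : adj (iota g) = iota g by exact: (ra (fun x => cabs (f x)) cg).
have ah : adj (iota h) = iota h.
  exact: (ra (fun x => Num.sqrt (t ^+ 2 - cabs (f x) ^+ 2)) ch).
have : rnorm (iota g) ^+ 2 <= t ^+ 2.
  apply: (@rc_sum_squares _ _ _ (iota h)).
  - exact: ag.
  - exact: ah.
  - exact: iotaC cg.
  - by rewrite exprn_ge0.
  rewrite -(iotaM cg cg) -(iotaM ch ch) -(iotaD (continuous_mul cg cg) (continuous_mul ch ch)).
  rewrite -iota_cst; congr iota; apply/funext => x.
  rewrite -!rcM -rcD -!expr2 sqr_sqrtr ?subrKC //.
  by rewrite subr_ge0 ler_sqr ?nnegrE ?cabs_ge0.
have -> : rnorm (iota g) ^+ 2 = rnorm (iota f) ^+ 2.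
  have cj : continuous (fun x => (f x)^*) by move=> x; apply: continuous_conj; exact: cf.
  rewrite -!rnorm_adjl ag -(iota_adj cf) -(iotaM cg cg) -(iotaM cj cf).
  congr (rnorm (iota _)); apply/funext => x.
  by rewrite [RHS]mulrC -cabs_sqr /g -rcM -expr2.
by rewrite ler_sqr ?nnegrE ?rnorm_ge0.
Qed.

Definition cut (b : X -> R) : A := iota (fun x => rc (b x)).

Lemma cut_le1 (b : X -> R) : continuous b -> (forall x, 0 <= b x <= 1) -> rnorm (cut b) <= 1.
Proof.
move=> cb b1; apply: (iota_le (continuous_rc cb) ler01) => x.
by rewrite cabs_rc; case/andP: (b1 x) => h0 h1; rewrite ger0_norm.
Qed.
Lemma cutC (b : X -> R) a : continuous b -> cut b * a = a * cut b.
Proof. by move=> cb; exact: iotaC (continuous_rc cb). Qed.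
Lemma cut_adj (b : X -> R) : continuous b -> adj (cut b) = cut b.
Proof.
move=> cb; rewrite -(iota_adj (continuous_rc cb)).
by congr iota; apply/funext => x; rewrite rc_conj.
Qed.

Definition cx_module (N : set A) : Prop :=
  [/\ closed N, subspace N & forall (f : X -> C) a, continuous f -> N a -> N (iota f * a)].

Lemma fib_ker_subspace N x : subspace (fib_ker iota N x).
Proof. exact: clspan_subspace. Qed.
Lemma fib_ker_closed N x : closed (fib_ker iota N x).
Proof. exact: clspan_closed. Qed.
Lemma fib_ker_gen (N : set A) x (f : X -> C) a : continuous f -> f x = 0 -> N a ->
  fib_ker iota N x (iota f * a).
Proof. by move=> cf fx Na; apply: clspan_sub; exists f, a. Qed.

Lemma fib_kerS (N N' : set A) x : N `<=` N' -> fib_ker iota N x `<=` fib_ker iota N' x.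
Proof.
move=> NN; apply: clspan_min; [exact: fib_ker_subspace | exact: fib_ker_closed |].
by move=> _ [f [a [cf fx Na ->]]]; exact: (fib_ker_gen cf fx (NN _ Na)).
Qed.

Lemma fib_ker_sub (N : set A) x : cx_module N -> fib_ker iota N x `<=` N.
Proof.
case=> cN sN mN; apply: clspan_min => // _ [f [a [cf fx Na ->]]].
exact: mN.
Qed.

Lemma fib_ker_mull (N : set A) x m c : (forall a, N a -> N (m * a)) ->
  fib_ker iota N x c -> fib_ker iota N x (m * c).
Proof.
move=> mN; apply: (clspan_map (N := fib_ker iota N x) (f := fun c => m * c) (K := rnorm m)).
- exact: fib_ker_subspace.
- exact: fib_ker_closed.
- exact: mulr0.
- by move=> a b; rewrite mulrDr.
- by move=> k a h; rewrite -scalerAr; exact: (subspaceZ k (fib_ker_subspace N x) h).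
- by move=> a; exact: rnormM.
- move=> _ [f [a [cf fx Na ->]]]; rewrite mulrA -(iotaC _ cf) -mulrA.
  exact: (fib_ker_gen cf fx (mN _ Na)).
Qed.

Lemma fib_ker_mulr (N : set A) x m c : (forall a, N a -> N (a * m)) ->
  fib_ker iota N x c -> fib_ker iota N x (c * m).
Proof.
move=> mN; apply: (clspan_map (N := fib_ker iota N x) (f := fun c => c * m) (K := rnorm m)).
- exact: fib_ker_subspace.
- exact: fib_ker_closed.
- exact: mul0r.
- by move=> a b; rewrite mulrDl.
- by move=> k a h; rewrite -scalerAl; exact: (subspaceZ k (fib_ker_subspace N x) h).
- by move=> a; rewrite [leRHS]mulrC; exact: rnormM.
- move=> _ [f [a [cf fx Na ->]]]; rewrite -mulrA.
  exact: (fib_ker_gen cf fx (mN _ Na)).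
Qed.

(** An element of the kernel at x is small near x: it is close to a finite sum of f_i m_i with
    f_i(x) = 0, and b is supported where these terms are small. Statements about quotient norms are
    reduced to this one. *)
Lemma fib_ker_cut (N : set A) x c (e : R) : fib_ker iota N x c -> 0 < e ->
  exists b : X -> R, [/\ continuous b, forall y, 0 <= b y <= 1,
    \forall y \near x, b y = 1 & rnorm (cut b * c) < e].
Proof.
move=> /clspanP hc e0.
have [_ [n [k [s [hs ->]]]] cs] := hc _ (divr_gt0 e0 (ltr0Sn R 1)).
have [fm hfm] := choice hs; have [m hm] := choice hfm.
(* Half of e is left for the approximation and half for its n terms; n + 1 avoids a division by
   0. *)
pose d := e / 2 / (n%:R + 1).
have n1 : 0 < n%:R + 1 :> R by rewrite ltr_wpDl.
have d0 : 0 < d by rewrite !divr_gt0.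
have : \forall y \near x, forall i, cabs (k i * fm i y) * rnorm (m i) < d.
  apply: filter_forall => i; have [cf fx _ _] := hm i.
  have cg : {for x, continuous (fun y => k i * fm i y)} by exact: continuous_scale cf x.
  have m1 : 0 < rnorm (m i) + 1 by rewrite ltr_wpDl ?rnorm_ge0.
  have /continuous_atP /(_ _ (divr_gt0 d0 m1)) := cg.
  apply: filterS => y; rewrite fx mulr0 subr0 ltr_pdivlMr //.
  have := cabs_ge0 (k i * fm i y); nra.
move=> /(bump_function R hX cX)[b [cb b01 b1 b0]].
exists b; split => //.
have -> : c = (c - \sum_i k i *: s i) + \sum_i k i *: s i by rewrite subrK.
rewrite mulrDr (le_lt_trans (rnormD _ _)) // [e]splitr ltr_leD //.
  apply: le_lt_trans cs; rewrite (le_trans (rnormM _ _)) //.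
  by rewrite -[leRHS]mul1r ler_pM ?rnorm_ge0 // cut_le1.
rewrite mulr_sumr (le_trans (rnorm_sum _ _ _)) //.
have -> : e / 2 = d * (n%:R + 1) by rewrite /d mulfVK // gt_eqF.
apply: (@le_trans _ _ (\sum_(i < n) d)); last first.
  by rewrite sumr_const card_ord -[d *+ n]mulr_natr ler_pM2l ?lerDl ?ler01.
apply: ler_sum => i _; have [cf fx _ ->] := hm i.
have cg := continuous_scale (k i) cf.
have cbr := continuous_rc cb.
rewrite scalerAl -(iotaZ _ cf) mulrA -(iotaM cbr cg).
have [m0|m0] := eqVneq (rnorm (m i)) 0.
  by rewrite (le_trans (rnormM _ _)) // m0 mulr0 ltW.
have mp : 0 < rnorm (m i) by rewrite lt_neqAle eq_sym m0 rnorm_ge0.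
rewrite (le_trans (rnormM _ _)) // -ler_pdivlMr //.
have dm0 : 0 <= d / rnorm (m i) by rewrite divr_ge0 // ltW.
apply: (iota_le (continuous_mul cbr cg) dm0) => y; rewrite ler_pdivlMr // cabsM cabs_rc.
have /andP[by0 by1] := b01 y; rewrite ger0_norm //.
have [hU|nU] := pselect (forall i, cabs (k i * fm i y) * rnorm (m i) < d).
  rewrite -mulrA; apply: le_trans (ltW (hU i)).
  by rewrite ler_piMl // mulr_ge0 ?cabs_ge0 ?rnorm_ge0.
by rewrite b0 // !mul0r ltW.
Qed.

Lemma fib_ker_cut_compl (N : set A) x (b : X -> R) a : continuous b -> b x = 1 -> N a ->
  fib_ker iota N x (a - cut b * a).
Proof.
move=> cb bx Na; rewrite -{1}[a]mul1r -mulrBl.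
have cbr := continuous_rc cb.
have -> : 1 - cut b = iota (fun y => 1 - rc (b y)).
  by rewrite (iotaB (continuous_const X (1 : C)) cbr) iota_cst scale1r.
have c1 : continuous (fun y => 1 - rc (b y)).
  by move=> y; exact: (continuousB (continuous_const X (1 : C) y) (cbr y)).
by apply: (fib_ker_gen c1) => //; rewrite bx rc1 subrr.
Qed.

(** The fibre of N at x embeds in that of A: with b equal to 1 at x, a - b a lies in the kernel
    computed in N, and b a is small. *)
Lemma fib_ker_restrict (N : set A) x a : N a -> fib_ker iota setT x a ->
  fib_ker iota N x a.
Proof.
move=> Na ka; apply: closed_approx => [|e e0]; first exact: fib_ker_closed.
have [b [cb _ /nbhs_singleton bx ba]] := fib_ker_cut ka e0.
exists (a - cut b * a); first exact: fib_ker_cut_compl.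
by rewrite opprB addrC subrK.
Qed.

(** Upper semicontinuity of the quotient norm. The single element c - b c lies in the kernel at
    every y where b = 1, and differs little from c. *)
Lemma fib_ker_near x a c (d : R) : fib_ker iota setT x c -> rnorm (a - c) < d ->
  \forall y \near x, exists2 c', fib_ker iota setT y c' & rnorm (a - c') < d.
Proof.
move=> kc ad; have d0 : 0 < d - rnorm (a - c) by rewrite subr_gt0.
have [b [cb _ bx ba]] := fib_ker_cut kc d0.
apply: filterS bx => y bx; exists (c - cut b * c); first exact: fib_ker_cut_compl.
rewrite opprB addrCA (le_lt_trans (rnormD _ _)) //.
by move: ba; rewrite ltrBrDr addrC.
Qed.

End CxAlgebra.

(** * Cosets, maps between them and the tube topology *)

Lemma inf_ge0_lt (R : realType) (S : set R) (d : R) : S !=set0 -> (forall a, S a -> 0 <= a) ->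
  inf S < d <-> exists2 a, S a & a < d.
Proof.
move=> S0 hS; have hi : has_inf S by split => //; exists 0 => a; exact: hS.
split=> [|[a Sa ad]]; last by apply: le_lt_trans ad; apply: ge_inf => //; case: hi.
by move=> h; have [a Sa ad] := inf_lt S0 h; exists a.
Qed.

Section FibreApi.
Variables (R : realType) (X : topologicalType) (A : cstarType R).
Local Notation C := (cplx R).
Variable iota : (X -> C) -> A.
Local Notation ker := (fib_ker iota).

Section OneModule.
Variables (N : set A) (x : X).
Implicit Types (u v : fibre iota N x) (T : fibre iota N x -> fibre iota N x).

Definition fib_pt (a : A) (Na : N a) : fibre iota N x :=
  exist _ (fib_class iota N x a) (ex_intro2 _ _ a Na erefl).

Lemma ker0 : ker N x 0. Proof. by case: (fib_ker_subspace iota N x). Qed.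
Lemma kerD a b : ker N x a -> ker N x b -> ker N x (a + b).
Proof. exact: subspaceD (fib_ker_subspace _ _ _). Qed.
Lemma kerB a b : ker N x a -> ker N x b -> ker N x (a - b).
Proof. exact: subspaceB (fib_ker_subspace _ _ _). Qed.
Lemma kerN a : ker N x a -> ker N x (- a).
Proof. exact: subspaceN (fib_ker_subspace _ _ _). Qed.
Lemma ker_dist a b : ker N x (a - b) -> ker N x (b - a).
Proof. by move/kerN; rewrite opprB. Qed.
Lemma ker_trans b a c : ker N x (a - b) -> ker N x (b - c) -> ker N x (a - c).
Proof. by move=> h1 h2; have := kerD h1 h2; rewrite addrA subrK. Qed.

Lemma fibre_eq u v : sval u = sval v -> u = v.
Proof.
case: u v => [u hu] [v hv] /= e; subst v; congr exist; exact: Prop_irrelevance.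
Qed.

Lemma fib_pt_mem a (Na : N a) : sval (fib_pt Na) a.
Proof. by rewrite /= /fib_class /= subrr; exact: ker0. Qed.

Lemma fib_mem_eq u a : sval u a -> sval u = fib_class iota N x a.
Proof.
case: u => _ /= [b Nb ->]; rewrite /fib_class /= => ab.
apply/seteqP; split => c /= h; [apply: ker_trans h _; exact: ker_dist | exact: ker_trans h ab].
Qed.

Lemma fib_mem_ker u a b : sval u a -> sval u b <-> ker N x (b - a).
Proof. by move=> /fib_mem_eq ->. Qed.

Lemma fib_mem_inj u v a : sval u a -> sval v a -> u = v.
Proof. by move=> /fib_mem_eq hu /fib_mem_eq hv; apply: fibre_eq; rewrite hu hv. Qed.

Lemma fib_mem_ex u : exists2 a, N a & sval u a.
Proof.
case: u => u [a Na e]; exists a => //=; rewrite e /fib_class /= subrr; exact: ker0.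
Qed.

Lemma maps_classP T u a a' : sval u a -> maps_class T a a' <-> sval (T u) a'.
Proof.
move=> ua; split=> [[v [va Tva]]|h]; last by exists u.
by rewrite (fib_mem_inj ua va).
Qed.

Lemma maps_class_ex T a : N a -> exists2 a', N a' & maps_class T a a'.
Proof.
move=> Na; have [a' Na' ha'] := fib_mem_ex (T (fib_pt Na)).
by exists a' => //; exists (fib_pt Na); split => //; exact: fib_pt_mem.
Qed.

Lemma maps_class_congr T a a' b b' : maps_class T a a' -> ker N x (b - a) ->
  ker N x (b' - a') -> maps_class T b b'.
Proof.
move=> [u [ua Tua]] hb hb'; exists u; split; first exact/(fib_mem_ker _ ua).
exact/(fib_mem_ker _ Tua).
Qed.

Lemma maps_class_fun T a a' b' : maps_class T a a' -> maps_class T a b' ->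
  ker N x (b' - a').
Proof.
move=> [u [ua Tua]] [v [va Tva]]; move: Tva; rewrite (fib_mem_inj va ua).
exact: (fib_mem_ker _ Tua).1.
Qed.

Lemma maps_class_sum T (I : Type) (r : seq I) (F F' : I -> A) : fib_linear T -> N 0 ->
  (forall i, maps_class T (F i) (F' i)) ->
  maps_class T (\sum_(i <- r) F i) (\sum_(i <- r) F' i).
Proof.
move=> [hD hZ] N0 h; elim: r => [|i r IH]; last by rewrite !big_cons; apply: hD.
(* [fib_linear] has no clause for 0, so the empty sum is treated as the multiple by 0 of some
   class. *)
rewrite !big_nil; have [a _ ha] := maps_class_ex T N0.
by have := hZ 0 _ _ ha; rewrite !scale0r.
Qed.
End OneModule.

Section Automorphism.
Variables (x : X) (T : fibre iota setT x -> fibre iota setT x).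
Hypothesis hT : fib_automorphism T.

Lemma autoZ (k : C) a a' : maps_class T a a' -> maps_class T (k *: a) (k *: a').
Proof. by case: hT => _ [_ h] _ _; exact: h. Qed.
Lemma autoM a b a' b' : maps_class T a a' -> maps_class T b b' ->
  maps_class T (a * b) (a' * b').
Proof. by case: hT => _ _ h _; exact: h. Qed.
Lemma auto_adj a a' : maps_class T a a' -> maps_class T (adj a) (adj a').
Proof. by case: hT => _ _ _; apply. Qed.
Lemma auto_sum (I : Type) (r : seq I) (F F' : I -> A) :
  (forall i, maps_class T (F i) (F' i)) ->
  maps_class T (\sum_(i <- r) F i) (\sum_(i <- r) F' i).
Proof. by case: hT => _ h _ _; exact: maps_class_sum. Qed.
(** Unitality follows from surjectivity: if f is sent to 1 and 1 to e, then f = 1 f is sent to e as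
    well. *)
Lemma auto_one : maps_class T 1 1.
Proof.
have [[T' TK T'K] _ _ _] := hT.
pose one := fib_pt x (I : [set: A] 1).
have [f _ hf] := fib_mem_ex (T' one).
have [e _ he] := maps_class_ex T (I : [set: A] 1).
have h1 : maps_class T f 1 by exists (T' one); rewrite T'K; split => //; exact: fib_pt_mem.
have h2 := autoM he h1; rewrite mul1r mulr1 in h2.
have k := maps_class_fun h2 h1.
by apply: (maps_class_congr he) => //; rewrite subrr; exact: ker0.
Qed.
End Automorphism.

(** Tubes form only a subbase; since F is stable under finite intersections, membership in F may
    still be checked on tubes. *)
Lemma nbhs_tubes (N : set A) (p : fbundle iota N) (F : set_system (fbundle iota N)) :
  Filter F -> (forall S, tubes S -> S p -> F S) -> forall W, nbhs p W -> F W.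
Proof.
move=> FF h W; rewrite nbhsE => -[_ [[B sB <-] [D BD Dp]] sW].
apply: filterS sW _; apply: (@filterS _ _ _ D); first by move=> ? ?; exists D.
have /sB [E sE IE] := BD; rewrite -IE; apply: filter_bigI => S SE.
have /sE := SE; rewrite inE => tS; apply: h => //.
by move: Dp; rewrite -IE => /(_ _ SE).
Qed.

Lemma open_tube (N : set A) (S : set (fbundle iota N)) : tubes S -> open S.
Proof.
move=> tS; exists [set S]; last first.
  by rewrite predeqE => ?; split=> [[_ ->]|] //; exists S.
move=> _ ->; exists [fset S]%fset.
  by move=> ?; rewrite inE inE => /eqP->.
by rewrite predeqE=> ?; split=> [h|h i]; [by apply: h; rewrite /= inE | by rewrite /= inE => /eqP->].
Qed.

Lemma tubeP (N : set A) (U : set X) a d (v : fbundle iota N) :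
  tube U a d v <-> U (projT1 v) /\ exists2 b, sval (projT2 v) b & rnorm (b - a) < d.
Proof.
have [c _ hc] := fib_mem_ex (projT2 v).
have e : inf [set rnorm (b - a) | b in sval (projT2 v)] < d <->
    exists2 b, sval (projT2 v) b & rnorm (b - a) < d.
  rewrite inf_ge0_lt.
  - split=> [[_ [b hb <-] h]|[b hb h]]; first by exists b.
    by exists (rnorm (b - a)) => //; exists b.
  - by exists (rnorm (c - a)), c.
  - by move=> _ [b _ <-]; exact: rnorm_ge0.
by rewrite /tube /=; split=> -[h1 h2]; split => //; apply/e.
Qed.

Lemma fib_norm_lt (N : set A) x (v : fibre iota N x) d :
  fib_norm v < d <-> exists2 b, sval v b & rnorm b < d.
Proof.
have [c _ hc] := fib_mem_ex v.
rewrite /fib_norm inf_ge0_lt.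
- split=> [[_ [b hb <-] h]|[b hb h]]; first by exists b.
  by exists (rnorm b) => //; exists b.
- by exists (rnorm c), c.
- by move=> _ [b _ <-]; exact: rnorm_ge0.
Qed.

End FibreApi.

(** * Embedding of the fibres of a submodule and restriction of maps to them *)

Section Restriction.
Variables (R : realType) (X : topologicalType) (A : cstarType R).
Local Notation C := (cplx R).
Variable iota : (X -> C) -> A.
Hypotheses (hX : hausdorff_space X) (cX : compact [set: X]).
Hypotheses (hi : cfun_hom iota) (iota_centre : forall f : X -> C, continuous f -> centre (iota f)).
Local Notation ker := (fib_ker iota).
Variable N : set A.
Hypothesis mN : cx_module iota N.

Definition fib_incl x (u : fibre iota N x) : fibre iota setT x :=
  fib_pt iota x (I : [set: A] (sval (cid2 (fib_mem_ex u)))).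

Lemma fib_inclP x (u : fibre iota N x) a : N a -> sval (fib_incl u) a <-> sval u a.
Proof.
rewrite /fib_incl; case: cid2 => b Nb ub /= Na.
have [cN sN _] := mN.
rewrite /fib_class /= (fib_mem_ker _ ub); split=> h; last exact: fib_kerS h.
by apply: fib_ker_restrict => //; apply: subspaceB.
Qed.

Lemma fib_mem_mod x (u : fibre iota N x) a : sval u a -> N a.
Proof.
have [b Nb ub] := fib_mem_ex u; rewrite (fib_mem_ker _ ub) => h.
rewrite -(subrK b a); have [_ sN _] := mN.
by apply: subspaceD => //; apply: fib_ker_sub h.
Qed.

Lemma maps_class_mod x (T : fibre iota N x -> fibre iota N x) a a' :
  maps_class T a a' -> N a /\ N a'.
Proof. by case=> u [/fib_mem_mod ? /fib_mem_mod]. Qed.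

(** The embedding of the fibres is isometric: a representative near a found in A is replaced by a +
    h (c - a), with c a representative in N and h a cutoff at x under which b and c nearly agree. *)
Lemma fib_mem_shrink x (u : fibre iota N x) a b (d : R) : N a ->
  sval (fib_incl u) b -> rnorm (b - a) < d -> exists2 c, sval u c & rnorm (c - a) < d.
Proof.
move=> Na ub bd; have [c Nc uc] := fib_mem_ex u.
have ic : sval (fib_incl u) c by apply/fib_inclP.
have kc := (fib_mem_ker _ ic).1 ub; have [cN sN iN] := mN.
have d0 : 0 < d - rnorm (b - a) by rewrite subr_gt0.
have [h [ch h01 /nbhs_singleton hx hb]] := fib_ker_cut hX cX hi iota_centre kc d0.
have Nca : N (c - a) by apply: subspaceB.
exists (a + cut iota h * (c - a)).
  apply/(fib_mem_ker _ uc).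
  have -> : a + cut iota h * (c - a) - c = - ((c - a) - cut iota h * (c - a)).
    by rewrite [LHS]addrAC !opprB [RHS]addrC.
  by apply: kerN; exact: fib_ker_cut_compl.
rewrite addrAC subrr add0r.
have -> : c - a = (b - a) - (b - c) by rewrite opprB [RHS]addrC addrA subrK.
rewrite mulrBr (le_lt_trans (rnormB _ _)) //.
have := rnormM (cut iota h) (b - a); have := cut_le1 hi iota_centre ch h01.
move: hb; have := rnorm_ge0 (b - a); have := rnorm_ge0 (cut iota h); nra.
Qed.

Section Restrict.
Variables (x : X) (T : fibre iota setT x -> fibre iota setT x).

(** The default u is returned only if the image of u has no representative in N, which the
    hypothesis [stab] excludes. *)
Definition fib_restrict (u : fibre iota N x) : fibre iota N x :=
  xget u [set v | exists a, sval (T (fib_incl u)) a /\ sval v a].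

Hypothesis stab : forall a, N a -> exists2 a', N a' & maps_class T a a'.

Lemma fib_incl_restrict u : fib_incl (fib_restrict u) = T (fib_incl u).
Proof.
have [a Na ua] := fib_mem_ex u.
have ia : sval (fib_incl u) a by apply/fib_inclP.
have [a' Na' aa'] := stab Na.
have Ta : sval (T (fib_incl u)) a' by apply/(maps_classP _ _ ia).
have [b [Tb vb]] : [set v | exists a, sval (T (fib_incl u)) a /\ sval v a] (fib_restrict u).
  apply: (@xgetI _ _ _ (fib_pt iota x Na')); exists a'; split => //.
  exact: fib_pt_mem.
have Nb := fib_mem_mod vb.
by apply: (fib_mem_inj (a := b)) => //; apply/fib_inclP.
Qed.

Lemma maps_fib_restrict a a' :
  maps_class fib_restrict a a' <-> [/\ N a, N a' & maps_class T a a'].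
Proof.
split=> [h|[Na Na' h]].
  have [Na Na'] := maps_class_mod h; split => //.
  case: h => u [ua Ua]; exists (fib_incl u); rewrite -fib_incl_restrict.
  by split; apply/fib_inclP.
exists (fib_pt iota x Na); have ua := fib_pt_mem iota x Na; split => //.
apply/fib_inclP => //; rewrite fib_incl_restrict; apply/maps_classP; last exact: h.
exact/fib_inclP.
Qed.

Lemma fib_restrict_linear : fib_linear T -> fib_linear fib_restrict.
Proof.
have [_ sN _] := mN.
case=> hD hZ; split=> [a b a' b' /maps_fib_restrict[? ? ?] /maps_fib_restrict[? ? ?]|
  k a a' /maps_fib_restrict[? ? ?]]; apply/maps_fib_restrict; split.
- exact: subspaceD.
- exact: subspaceD.
- exact: hD.
- exact: subspaceZ.
- exact: subspaceZ.
- exact: hZ.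
Qed.
End Restrict.
End Restriction.

(** * Hermitian bundles *)

Section MatrixContinuity.
Variables (R : realType) (X : topologicalType).
Local Notation C := (cplx R).

Lemma continuous_near_eq (Y : topologicalType) (f g : X -> Y) x :
  (\forall y \near x, f y = g y) -> {for x, continuous f} -> {for x, continuous g}.
Proof.
move=> fg cf V; rewrite -(nbhs_singleton fg) => /cf h.
by apply: filterS2 fg h => y /= ->.
Qed.

Lemma continuous_coord m n (M : X -> 'M[C]_(m, n)) x i j :
  {for x, continuous M} -> {for x, continuous (fun y => M y i j)}.
Proof.
move=> cM V hV; apply: (cM [set N : 'M[C]_(m, n) | V (N i j)]).
exists (fun i' j' => [set z | i' = i -> j' = j -> V z]).
  move=> i' j'; have [->|/eqP ni] := eqVneq i' i; last by apply: filterS filterT => z _ /ni.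
  have [->|/eqP nj] := eqVneq j' j; last by apply: filterS filterT => z _ _ /nj.
  by apply: filterS hV => z /= Vz _ _.
by move=> N /(_ i j) /=; apply.
Qed.

Lemma continuous_mx m n (M : X -> 'M[C]_(m, n)) x :
  (forall i j, {for x, continuous (fun y => M y i j)}) -> {for x, continuous M}.
Proof.
move=> cM V [P hP sV].
have : \forall y \near x, forall i j, P i j (M y i j).
  apply: filter_forall => i; apply: filter_forall => j.
  exact: (cM i j) (hP i j).
by apply: filterS => y h; apply: sV.
Qed.
End MatrixContinuity.

Section Bundle.
Variables (R : realType) (X : topologicalType) (d : nat) (E : herm_bundle R X d).
Local Notation C := (cplx R).
Hypotheses (hX : hausdorff_space X) (cX : compact [set: X]).

Lemma ip_sumr x (u : E x) (I : finType) (k : I -> C) (v : I -> E x) :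
  vb_ip u (\sum_i k i *: v i) = \sum_i k i * vb_ip u (v i).
Proof.
have z : vb_ip u 0 = 0 by have := vb_ipZr 0 u (0 : E x); rewrite scale0r mul0r.
rewrite (big_morph _ (vb_ipDr u) z); apply: eq_bigr => i _; exact: vb_ipZr.
Qed.

Lemma ipZl x (k : C) (u v : E x) : vb_ip (k *: u) v = k^* * vb_ip u v.
Proof. by rewrite vb_ipC vb_ipZr rmorphM /= -vb_ipC. Qed.
Lemma ipDl x (u v w : E x) : vb_ip (u + v) w = vb_ip u w + vb_ip v w.
Proof. by rewrite vb_ipC vb_ipDr rmorphD /= -!vb_ipC. Qed.
Lemma ipNr x (u v : E x) : vb_ip u (- v) = - vb_ip u v.
Proof. by rewrite -scaleN1r vb_ipZr mulN1r. Qed.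
Lemma ipNl x (u v : E x) : vb_ip (- u) v = - vb_ip u v.
Proof. by rewrite vb_ipC ipNr rmorphN /= -vb_ipC. Qed.

Lemma triv_sum i x (I : finType) (k : I -> C) (v : I -> E x) : vb_dom (h := E) i x ->
  vb_triv i (\sum_l k l *: v l) = \sum_l k l *: vb_triv i (v l).
Proof.
move=> ix; have [h _] := vb_trivP ix.
have z : vb_triv i (0 : E x) = 0.
  by have := h (-1) 0 0; rewrite scaler0 addr0 scaleN1r addNr.
have hD (u w : E x) : vb_triv i (u + w) = vb_triv i u + vb_triv i w.
  by rewrite -[u]scale1r h !scale1r.
rewrite (big_morph _ hD z); apply: eq_bigr => l _.
by rewrite -[_ *: v l]addr0 h z addr0.
Qed.

Lemma chart_matrix i x (f : E x -> E x) : vb_dom (h := E) i x ->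
  (forall (k : C) (v w : E x), f (k *: v + w) = k *: f v + f w) ->
  exists m : 'M[C]_d, forall v, vb_triv i (f v) = m *m vb_triv i v.
Proof.
move=> ix lf; have [h [g gK Kg]] := vb_trivP ix.
pose u (b : 'I_d) := g (delta_mx b 0).
exists (\matrix_(a, b) vb_triv i (f (u b)) a 0) => v.
have f0 : f 0 = 0 by have := lf (-1) 0 0; rewrite scaler0 addr0 scaleN1r addNr.
have fD v' w' : f (v' + w') = f v' + f w' by rewrite -[v']scale1r lf !scale1r.
have -> : v = \sum_b vb_triv i v b 0 *: u b.
  apply: (can_inj gK); rewrite triv_sum //; apply/matrixP => a b.
  rewrite !ord1 summxE (bigD1 a) //= mxE Kg mxE !eqxx mulr1 big1 ?addr0 // => c ca.
  by rewrite mxE Kg mxE eq_sym (negbTE ca) mulr0.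
rewrite (big_morph _ fD f0).
have -> : \sum_b f (vb_triv i v b 0 *: u b) = \sum_b vb_triv i v b 0 *: f (u b).
  by apply: eq_bigr => b _; rewrite -[_ *: u b]addr0 lf f0 addr0.
rewrite !triv_sum //; apply/matrixP => a b; rewrite !ord1 summxE mxE.
apply: eq_bigr => c _; rewrite !mxE mulrC; congr (_ * _).
rewrite summxE (bigD1 c) //= mxE Kg mxE !eqxx mulr1 big1 ?addr0 // => e ec.
by rewrite mxE Kg mxE eq_sym (negbTE ec) mulr0.
Qed.

Lemma ip_chart i x : vb_dom (h := E) i x -> exists h : X -> 'M[C]_d,
  {for x, continuous h} /\ \forall y \near x, forall u v : E y,
    vb_ip u v = \sum_a (\sum_b (vb_triv i u b 0)^* * h y b a) * vb_triv i v a 0.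
Proof.
move=> ix; have [h hh] := vb_gram i; exists h; split; first by case: (hh x ix).
have /open_nbhs_nbhs := conj (vb_dom_open i) ix.
apply: filterS => y iy u v; have [_ ->] := hh y iy.
rewrite mxE; apply: eq_bigr => a _; rewrite mxE; congr (_ * _).
by apply: eq_bigr => b _; rewrite !mxE.
Qed.

Lemma sec_ip_cont (phi psi : bsection E) : cont_section phi -> cont_section psi ->
  continuous (sec_ip phi psi).
Proof.
move=> cphi cpsi x; have [i ix] := vb_dom_cover E x.
have [h [ch hh]] := ip_chart ix.
apply: (@continuous_near_eq _ _ (fun y => \sum_a (\sum_b
   (vb_triv i (phi y) b 0)^* * h y b a) * vb_triv i (psi y) a 0)).
  by apply: filterS hh => y hy; rewrite /sec_ip hy.
apply: continuous_sum => a; apply: continuousM; last exact: continuous_coord (cpsi i x ix).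
apply: continuous_sum => b; apply: continuousM; last exact: continuous_coord ch.
by apply: continuous_conj; exact: continuous_coord (cphi i x ix).
Qed.

Lemma section_through x (v : E x) : exists2 phi : bsection E,
  cont_section phi & phi x = v.
Proof.
have [i ix] := vb_dom_cover E x; pose w := vb_triv i v.
have hs y : exists u : E y, vb_dom (h := E) i y -> vb_triv i u = w.
  have [iy|niy] := pselect (vb_dom (h := E) i y); last by exists 0.
  by have [_ [g gK Kg]] := vb_trivP iy; exists (g w).
pose s y := projT1 (cid (hs y)).
have sP y : vb_dom (h := E) i y -> vb_triv i (s y) = w := projT2 (cid (hs y)).
have ni : nbhs x (vb_dom (h := E) i) by apply: open_nbhs_nbhs; split => //; exact: vb_dom_open.
(* Two cutoffs are used: b vanishes wherever b1 <= 1/2, hence on a neighbourhood of every point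
   outside the chart, where s is arbitrary. *)
have [b1 [cb1 _ b1x b10]] := bump_function R hX cX ni.
have nb : \forall y \near x, 2^-1 < b1 y.
  by apply: filterS b1x => y ->; rewrite invf_lt1 // ltr1n.
have [b [cb _ /nbhs_singleton bx b0]] := bump_function R hX cX nb.
exists (fun y => rc (b y) *: s y); last first.
  rewrite bx rc1 scale1r; have [_ [g gK Kg]] := vb_trivP ix.
  by apply: (can_inj gK); rewrite sP.
have cbr := continuous_rc cb.
move=> j y jy.
have nj : nbhs y (vb_dom (h := E) j) by apply: open_nbhs_nbhs; split => //; exact: vb_dom_open.
have trZ y' (k : C) (u : E y') : vb_dom (h := E) j y' -> vb_triv j (k *: u) = k *: vb_triv j u.
  move=> h; have := triv_sum (fun _ : 'I_1 => k) (fun _ => u) h.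
  by rewrite !big_ord1.
have [iy|niy] := pselect (vb_dom (h := E) i y); last first.
  apply: (@continuous_near_eq _ _ (fun _ : X => 0 : 'cV[C]_d)); last exact: cst_continuous.
  have : \forall y' \near y, b1 y' < 2^-1.
    have /continuous_atRP /(_ 2^-1) := cb1 y; rewrite invr_gt0 ltr0n => /(_ isT).
    apply: filterS => y'; rewrite (b10 y niy) subr0; exact: le_lt_trans (ler_norm _).
  move=> h; apply: filterS2 h nj => y' h jy'; rewrite b0; last first.
    by move=> /= h'; have := lt_trans h h'; rewrite ltxx.
  by rewrite rc0 trZ // scale0r.
have niy : nbhs y (vb_dom (h := E) i) by apply: open_nbhs_nbhs; split => //; exact: vb_dom_open.
have [g hg] := vb_transition i j.
apply: (@continuous_near_eq _ _ (fun y' => rc (b y') *: (g y' *m w))).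
  apply: filterS2 niy nj => y' iy' jy'; rewrite trZ //.
  by have [_ ->] := hg y' iy' jy'; rewrite sP.
apply: continuous_mx => a c.
apply: (@continuous_near_eq _ _ (fun y' => rc (b y') * \sum_k g y' a k * w k c)).
  by apply: filterS filterT => y' _; rewrite !mxE.
apply: continuousM; first exact: cbr.
apply: continuous_sum => k; apply: continuousM; last exact: cst_continuous.
by apply: continuous_coord; have [] := hg y iy jy.
Qed.

Lemma open_fendo_subbase (S : set (fendo E)) : fendo_subbase S -> open S.
Proof.
move=> tS; exists [set S]; last first.
  by rewrite predeqE => ?; split=> [[_ ->]|] //; exists S.
move=> _ ->; exists [fset S]%fset.
  by move=> ?; rewrite inE inE => /eqP->.
by rewrite predeqE=> ?; split=> [h|h i]; [by apply: h; rewrite /= inE | by rewrite /= inE => /eqP->].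
Qed.

Lemma fendo_nbhs x (y : E x -> E x) i (V : set X) (W : set 'M[C]_d) (m : 'M[C]_d) :
  vb_dom (h := E) i x -> nbhs x V -> nbhs m W ->
  (forall v, vb_triv i (y v) = m *m vb_triv i v) ->
  nbhs (epoint y) [set u | let: existT x y := u in V x /\ exists2 m, W m &
               forall v : E x, vb_triv i (y v) = m *m vb_triv i v].
Proof.
move=> ix xV mW hm.
pose V' := V° `&` vb_dom (h := E) i.
pose S := [set u : fendo E | let: existT x y := u in V' x /\ exists2 m, W° m &
               forall v : E x, vb_triv i (y v) = m *m vb_triv i v].
have oS : open S.
  apply: open_fendo_subbase; exists i, V', W°; split => //.
  - by apply: openI; [exact: open_interior | exact: vb_dom_open].
  - by move=> ? [].
  - exact: open_interior.
have yS : nbhs (epoint y) S by apply: open_nbhs_nbhs; split => //; split => //; exists m.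
have FF := nbhs_filter (epoint y : fendo E).
apply: filterS yS => -[x' y'] /= [[/interior_subset Vx _] [m' /interior_subset Wm' h]].
by split => //; exists m'.
Qed.

Variable G : set (fendo E).
Hypothesis hG : compact_group_bundle G.

Lemma group_linear x (y : E x -> E x) : G (epoint y) ->
  forall (k : C) (v w : E x), y (k *: v + w) = k *: y v + y w.
Proof. by case: hG => hU _ _ _ _ /hU[]. Qed.
Lemma group_ip x (y : E x -> E x) : G (epoint y) ->
  forall v w, vb_ip (y v) (y w) = vb_ip v w.
Proof. by case: hG => hU _ _ _ _ /hU[]. Qed.

(** The subbasic sets of [fendo] contain only maps that have a matrix in a chart; linearity of y
    puts it in one of them, and this gives continuity of the projection at y. *)
Lemma group_proj_nbhs x (y : E x -> E x) (V : set X) : G (epoint y) -> nbhs x V ->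
  nbhs (epoint y) [set u | V (projT1 u)].
Proof.
move=> Gy xV; have [i ix] := vb_dom_cover E x.
have [m hm] := chart_matrix ix (group_linear Gy).
have FF := nbhs_filter (epoint y : fendo E).
have mT : nbhs m setT by exact: filterT.
have H := fendo_nbhs ix xV mT hm.
by apply: filterS H => -[x' y'] /= [Vx _].
Qed.

Lemma group_ip_near (phi psi : bsection E) x (y : E x -> E x) (e : R) :
  cont_section phi -> cont_section psi -> G (epoint y) -> 0 < e ->
  nbhs (epoint y) [set u | let: existT x' y' := u in
    cabs (vb_ip (phi x') (y' (psi x')) - vb_ip (phi x) (y (psi x))) < e].
Proof.
move=> cphi cpsi Gy e0; have [i ix] := vb_dom_cover E x.
have [m hm] := chart_matrix ix (group_linear Gy).
have [h [ch hh]] := ip_chart ix.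
pose F (p : X * 'M[C]_d) : C := \sum_a (\sum_b
   (vb_triv i (phi p.1) b 0)^* * h p.1 b a) *
   \sum_c p.2 a c * vb_triv i (psi p.1) c 0.
have fstc (Y : topologicalType) (f : X -> Y) : {for x, continuous f} ->
    {for (x, m), continuous (fun p : X * 'M[C]_d => f p.1)}.
  move=> cf; have c0 : {for (x, m), continuous (@fst X 'M[C]_d)} by exact: cvg_fst.
  exact: (continuous_comp c0 cf).
have c1 b : {for x, continuous (fun z => vb_triv i (phi z) b 0)}.
  exact: continuous_coord (cphi i x ix).
have c2 b a : {for x, continuous (fun z => h z b a)} by exact: continuous_coord ch.
have c3 b : {for x, continuous (fun z => vb_triv i (psi z) b 0)}.
  exact: continuous_coord (cpsi i x ix).
have c4 a c : {for (x, m), continuous (fun p : X * 'M[C]_d => p.2 a c)}.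
  have c5 : {for (x, m), continuous (fun p : X * 'M[C]_d => p.2)} by exact: cvg_snd.
  exact: continuous_coord c5.
have cF : {for (x, m), continuous F}.
  apply: continuous_sum => a; apply: continuousM.
    apply: continuous_sum => b; apply: continuousM; last exact: (fstc _ _ (c2 b a)).
    exact: (continuous_conj (fstc _ _ (c1 b))).
  apply: continuous_sum => c; apply: continuousM; first exact: c4.
  exact: (fstc _ _ (c3 c)).
have Fe x' (y' : E x' -> E x') m' : (forall u v : E x',
    vb_ip u v = \sum_a (\sum_b (vb_triv i u b 0)^* * h x' b a) * vb_triv i v a 0) ->
    (forall v, vb_triv i (y' v) = m' *m vb_triv i v) ->
    vb_ip (phi x') (y' (psi x')) = F (x', m').
  move=> -> h'; apply: eq_bigr => a _; congr (_ * _).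
  by rewrite h' mxE.
have /continuous_atP /(_ _ e0) [[V W] /= [xV mW] VW] := cF.
have FF := nbhs_filter (epoint y : fendo E).
have xVh := @filterI _ _ (nbhs_filter x) _ _ xV hh.
have H := fendo_nbhs ix xVh mW hm; apply: filterS H => -[x' y'] /=.
case=> -[Vx hx'] [m' Wm' hm'].
rewrite (Fe _ _ _ hx' hm') (Fe _ _ _ (nbhs_singleton hh) hm).
by apply: (VW (x', m')).
Qed.

Section Frame.
Variables (n : nat) (psi : 'I_n -> bsection E).
Hypothesis hpsi : section_frame psi.

Lemma frame_cont l : cont_section (psi l). Proof. by case: hpsi. Qed.

Lemma frame_id x (v : E x) : \sum_l vb_ip (psi l x) v *: psi l x = v.
Proof.
have [phi cphi <-] := section_through v; have [_ h] := hpsi; exact: h.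
Qed.

Lemma frame_ip x (v w : E x) : \sum_l vb_ip v (psi l x) * vb_ip (psi l x) w = vb_ip v w.
Proof.
rewrite -{2}(frame_id w) ip_sumr; by apply: eq_bigr => l _; rewrite mulrC.
Qed.
End Frame.
End Bundle.
Arguments frame_cont {R X d E n psi} hpsi l.

(** * Automorphisms of the fibres of the Cuntz-Pimsner algebra *)

Section Base.
Variable R : realType.
Local Notation C := (cplx R).

(** X is the continuous image of the compact G, every group G_x containing the identity. *)
Lemma compact_base (X : topologicalType) (d : nat) (E : herm_bundle R X d)
  (G : set (fendo E)) : compact_group_bundle G -> compact [set: X].
Proof.
move=> hG; have [_ cG idG _ _] := hG.
apply/compact_near_coveringP => J F P FF hP.
have /compact_near_coveringP /(_ J F (fun i u => P i (projT1 u)) FF) h := cG.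
apply: filterS (h _) => [i hi x _|[x y] Gy]; first exact: (hi _ (idG x)).
have [[V W] /= [xV FW] VW] := hP x I.
exists ([set u : fendo E | V (projT1 u)], W).
  by split => //; exact: (group_proj_nbhs hG).
by move=> [u i] /= [Vu Wi]; exact: (VW (projT1 u, i)).
Qed.

Lemma spectrum_hausdorff (A : cstarType R) (rho : A -> A) :
  hausdorff_space (spectrum rho).
Proof.
have op (S : set (spectrum rho)) : weak_star_subbase S -> open S.
  move=> tS; exists [set S]; last first.
    by rewrite predeqE => ?; split=> [[_ ->]|] //; exists S.
  move=> _ ->; exists [fset S]%fset.
    by move=> ?; rewrite inE inE => /eqP->.
  by rewrite predeqE=> ?; split=> [h|h i]; [by apply: h; rewrite /= inE | by rewrite /= inE => /eqP->].
move=> p q pq; apply: contrapT => npq.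
(* Characters are extended by 0, so two that agree on C(X^rho) are equal. *)
have [f [ff nf]] : exists f, fixed_centre rho f /\ sval p f <> sval q f.
  apply: contrapT => h; apply: npq; case: p q pq h => p hp [q hq] /= _ h.
  have e : p = q.
    apply/funext => f; have [hf|hf] := pselect (fixed_centre rho f).
      by apply: contrapT => n; apply: h; exists f.
    by have [_ _ _ _ ->] := hp => //; have [_ _ _ _ ->] := hq.
  by subst q; congr exist; exact: Prop_irrelevance.
pose a : C := sval p f; pose b : C := sval q f; pose e := cabs (a - b) / 2.
have e0 : 0 < e.
  rewrite divr_gt0 // lt_neqAle cabs_ge0 andbT eq_sym; apply/eqP => /cabs_eq0 /eqP.
  by rewrite subr_eq0 => /eqP.
pose ball c := [set w : C | cabs (w - c) < e]°.
have nb (r : spectrum rho) : nbhs r (gelfand f @^-1` ball (sval r f)).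
  apply: open_nbhs_nbhs; split.
    by apply: op; exists f, (ball (sval r f)); split => //; exact: open_interior.
  by apply/nbhs_cabsP; exists e.
have [r [/= /interior_subset Ur /interior_subset Vr]] := pq _ _ (nb p) (nb q).
have : cabs (a - b) < e + e.
  have -> : a - b = (gelfand f r - b) - (gelfand f r - a) by rewrite opprB [RHS]addrC addrA subrK.
  by rewrite (le_lt_trans (cabsD _ _)) // cabsN ltrD.
by rewrite /e -splitr ltxx.
Qed.

(** The g n are the partial sums of the geometric series, written by Horner's rule. *)
Lemma neumann (A : cstarType R) (x : A) : rnorm x < 1 ->
  exists g, (1 - x) * g = 1 /\ g * (1 - x) = 1.
Proof.
move=> x1; pose c := rnorm x; have c0 : 0 <= c := rnorm_ge0 x.
pose g n := iter n (fun a => 1 + x * a) 0.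
have gS n : g n.+1 = 1 + x * g n by [].
have gx n : x * g n = g n * x.
  elim: n => [|n IH]; first by rewrite /g /= mulr0 mul0r.
  by rewrite gS mulrDr mulrDl mulr1 mul1r {1}IH mulrA.
have step n : rnorm (g n.+1 - g n) <= c ^+ n.
  elim: n => [|n IH]; first by rewrite gS /g /= mulr0 addr0 subr0 rnorm1.
  rewrite gS [in X in _ - X]gS opprD addrACA subrr add0r -mulrBr exprS.
  by rewrite (le_trans (rnormM _ _)) // ler_wpM2l.
have c1 : 0 < 1 - c by rewrite subr_gt0.
have dist m n : rnorm (g (n + m)%N - g n) <= (c ^+ n - c ^+ (n + m)) / (1 - c).
  elim: m => [|m IH]; first by rewrite addn0 !subrr mul0r rnorm0.
  rewrite addnS -(subrK (g (n + m)%N) (g (n + m).+1)) -addrA.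
  rewrite (le_trans (rnormD _ _)) // (le_trans (lerD (step _) IH)) //.
  rewrite ler_pdivlMr // mulrDl mulfVK ?gt_eqF // exprS.
  by move: (c ^+ n) (c ^+ _) => a b; lra.
have pow e : 0 < e -> exists N, forall n, (N <= n)%N -> c ^+ n / (1 - c) < e.
  move=> e0; have : (fun n => c ^+ n) @ \oo --> (0 : R).
    by apply: cvg_expr; rewrite ger0_norm.
  move=> /cvgrPdist_lt /(_ _ (mulr_gt0 e0 c1)) [N _ hN]; exists N => n /hN /=.
  by rewrite sub0r normrN ger0_norm ?exprn_ge0 // ltr_pdivrMr.
have [l hl] : exists l, forall e : R, 0 < e -> exists N, forall n, (N <= n)%N ->
    rnorm (g n - l) < e.
  apply: complete_rnorm => e /pow [N hN]; exists N.
  have hmn m n : (N <= n)%N -> (n <= m)%N -> rnorm (g m - g n) < e.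
    move=> Nn nm; rewrite -(subnKC nm); apply: le_lt_trans (dist _ _) _.
    apply: le_lt_trans (hN n Nn); rewrite ler_pM2r ?invr_gt0 //.
    by rewrite gerBl exprn_ge0.
  move=> m n hm hn; have [nm|mn] := leqP n m; first exact: hmn.
  by rewrite rnorm_distC; apply: hmn => //; exact: ltnW.
have lim_eq (a : A) : (forall e : R, 0 < e -> exists N, forall n, (N <= n)%N ->
    rnorm a <= rnorm (g n.+1 - l) + rnorm (g n - l)) -> a = 0.
  move=> h; apply: rnorm_small => e e0; have [N hN] := h _ e0.
  have [M hM] := hl _ (divr_gt0 e0 (ltr0Sn R 1)).
  apply: le_trans (hN (maxn N M) (leq_maxl _ _)) _.
  rewrite [e]splitr lerD // ltW // hM ?leq_maxr //.
  exact: leq_trans (leq_maxr N M) (leqnSn _).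
have zmod (b q o p : A) : b - q - o = p - q - (o + p - b).
  rewrite [RHS]addrAC -(addrA o) opprD (addrCA p) opprB subrKC.
  by rewrite [- o + b]addrC addrAC.
exists l; split; apply/eqP; rewrite -subr_eq0; apply/eqP; apply: lim_eq => e e0;
  exists 0%N => n _.
- have -> : (1 - x) * l - 1 = x * (g n - l) - (g n.+1 - l).
    by rewrite mulrBl mul1r mulrBr gS; exact: zmod.
  rewrite (le_trans (rnormB _ _)) // addrC lerD2l (le_trans (rnormM _ _)) //.
  by rewrite ler_piMl ?rnorm_ge0 // ltW.
- have -> : l * (1 - x) - 1 = (g n - l) * x - (g n.+1 - l).
    by rewrite mulrBr mulr1 mulrBl -gx gS; exact: zmod.
  rewrite (le_trans (rnormB _ _)) // addrC lerD2l (le_trans (rnormM _ _)) //.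
  by rewrite ler_piMr ?rnorm_ge0 // ltW.
Qed.

Lemma one_sub_add (A : cstarType R) (K : A) : (1 - K) * (1 + K) = 1 - K * K.
Proof. by rewrite mulrDr mulr1 mulrBl mul1r addrA subrK. Qed.
Lemma one_add_sub (A : cstarType R) (K : A) : (1 + K) * (1 - K) = 1 - K * K.
Proof. by rewrite mulrBr mulr1 mulrDl mul1r opprD addrA addrK. Qed.

(** With h = iK self-adjoint, (1 - K)(1 + K) = 1 + h^2 = t (1 - x), where [rnorm_sub_square] bounds
    the norm of x by |h|^2 / t < 1. *)
Lemma skew_inverse (A : cstarType R) (K : A) : adj K = - K ->
  exists W, (1 - K) * W = 1 /\ W * (1 - K) = 1.
Proof.
move=> aK; pose h := 'i *: K.
have sh : adj h = h by rewrite /h adjZ conjCi aK scaleNr scalerN opprK.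
pose t : R := 1 + rnorm h ^+ 2.
have t0 : 0 < t by rewrite ltr_pwDl // exprn_ge0 // rnorm_ge0.
have t0' : rc t != 0 by rewrite -rc0; apply/eqP => /rc_inj /eqP; rewrite gt_eqF.
pose x := (rc t)^-1 *: (rc (rnorm h ^+ 2) *: 1 - h * h).
have x1 : rnorm x < 1.
  rewrite rnormZ -rcV cabs_rc ger0_norm ?invr_ge0 ?(ltW t0) //.
  rewrite ltr_pdivrMl // mulr1 (le_lt_trans (rnorm_sub_square sh)) //.
  by rewrite /t ltrDr ltr01.
have [g [xg gx]] := neumann x1.
have KK : (1 - K) * (1 + K) = rc t *: (1 - x).
  have hh : h * h = - (K * K).
    rewrite /h -scalerAl -scalerAr scalerA.
    have -> : 'i * 'i = -1 :> C by rewrite -expr2 sqrCi.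
    by rewrite scaleN1r.
  rewrite scalerBr /x scalerA mulfV // scale1r hh opprK rcD rc1 scalerDl scale1r.
  by rewrite opprD addrA addrK one_sub_add.
have KK' : (1 + K) * (1 - K) = rc t *: (1 - x) by rewrite -KK one_sub_add one_add_sub.
pose W := (1 + K) * ((rc t)^-1 *: g).
have r : (1 - K) * W = 1.
  by rewrite /W mulrA KK -scalerAl -scalerAr scalerA mulfV // scale1r.
have l : ((rc t)^-1 *: g * (1 + K)) * (1 - K) = 1.
  by rewrite -mulrA KK' -scalerAl -scalerAr scalerA mulVf // scale1r.
exists W; split => //.
by rewrite -[W]mul1r -{1}l -(mulrA _ (1 - K)) r mulr1.
Qed.

(** The adjoint exchanges 1 - K and 1 + K, which commute, as do their inverses W and adj W; both
    unitarity relations follow. *)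
Lemma cayley_unitary (A : cstarType R) (K : A) : adj K = - K ->
  exists u W, [/\ adj u * u = 1, u * adj u = 1, u = (1 + K) * W,
    (1 - K) * W = 1 & W * (1 - K) = 1].
Proof.
move=> aK; have [W [r l]] := skew_inverse aK.
have a1 : adj (1 - K) = 1 + K by rewrite adjB adj1 aK opprK.
have a2 : adj (1 + K) = 1 - K by rewrite adjD adj1 aK.
have r' : adj W * (1 + K) = 1 by rewrite -a1 -adjM r adj1.
have l' : (1 + K) * adj W = 1 by rewrite -a1 -adjM l adj1.
have KK : (1 - K) * (1 + K) = (1 + K) * (1 - K).
  by rewrite one_sub_add one_add_sub.
have WW : W * adj W = adj W * W.
  have q1 : W * adj W * ((1 + K) * (1 - K)) = 1.
    by rewrite mulrA -[_ * (1 + K)]mulrA r' mulr1 l.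
  have q2 : (1 + K) * (1 - K) * (adj W * W) = 1.
    by rewrite -KK mulrA -[_ * adj W]mulrA l' mulr1 r.
  by rewrite -[LHS]mulr1 -q2 [LHS]mulrA q1 mul1r.
exists ((1 + K) * W), W; split => //.
- by rewrite adjM a2 -mulrA (mulrA (1 - K)) KK -mulrA r mulr1.
- by rewrite adjM a2 -mulrA (mulrA W) WW !mulrA l' mul1r l.
Qed.
End Base.

Section Phase.
Variable R : realType.
Local Notation C := (cplx R).

Lemma cayley_cancel (F : numFieldType) (x y : F) :
  (1 + x) * (1 - y) = (1 + y) * (1 - x) -> x = y.
Proof.
move=> h; have e : (x - y) * 2 = (1 + x) * (1 - y) - (1 + y) * (1 - x) by ring.
move/eqP: e; rewrite h subrr.
by rewrite mulf_eq0 pnatr_eq0 orbF subr_eq0 => /eqP.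
Qed.

(* Finitely many eigenvalues cannot exhaust the unit circle, which contains the
   points (1 + ik) / (1 - ik). *)
Lemma avoid_eigenvalues (d : nat) (m : 'M[C]_d) :
  exists l : C, l * l^* = 1 /\ 1%:M + l *: m \in unitmx.
Proof.
pose q (k : nat) : C := 1 + 'i * rc k%:R.
have qc k : (q k)^* = 1 - 'i * rc k%:R.
  by rewrite /q rmorphD rmorph1 rmorphM /= conjCi rc_conj mulNr.
have q0 k : q k != 0.
  apply/eqP => h; have := qc k; rewrite h rmorph0 => /eqP.
  rewrite eq_sym subr_eq0 => /eqP h1; have : q k = 1 + 1 by rewrite /q -h1.
  by rewrite h => /eqP; rewrite eq_sym -[1 + 1]/(2%:R) pnatr_eq0.
have qc0 k : (q k)^* != 0 by rewrite fmorph_eq0.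
pose mu k := q k / (q k)^*.
have mu_inj : injective mu.
  move=> a b; rewrite /mu => /eqP.
  rewrite eqr_div // !qc /q => /eqP h.
  have : 'i * rc a%:R = 'i * rc b%:R :> C.
    exact: cayley_cancel h.
  move/(mulfI (neq0Ci _)) /rc_inj /eqP; rewrite eqr_nat => /eqP //.
have [k hk] : exists k, ~~ root (char_poly m) (mu k).
  apply: contrapT => h.
  have hr : all (root (char_poly m)) [seq mu k | k <- iota 0 d.+1].
    apply/allP => _ /mapP[k _ ->]; apply/negPn/negP => n; apply: h; by exists k.
  have := max_poly_roots (monic_neq0 (char_poly_monic m)) hr.
  rewrite map_inj_uniq // iota_uniq => /(_ isT).
  by rewrite size_map size_iota size_char_poly ltnn.
have mu0 : mu k != 0 by rewrite mulf_neq0 // invr_eq0.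
have mumu : mu k * (mu k)^* = 1.
  by rewrite /mu rmorphM fmorphV /= conjCK mulrA mulfVK // divff.
(* For this l, 1 + l m = l (m - mu), which is invertible because mu is not an eigenvalue. *)
exists (- (mu k)^-1); split.
  by rewrite rmorphN fmorphV /= mulrNN -invfM mumu invr1.
have u : m - (mu k)%:M \in unitmx.
  rewrite -row_free_unit -kermx_eq0 -/(eigenspace m (mu k)).
  by move: hk; rewrite -eigenvalue_root_char /eigenvalue negbK.
have -> : 1%:M + - (mu k)^-1 *: m = (- (mu k)^-1) *: (m - (mu k)%:M).
  rewrite scalerBr scaleNr addrC scaleNr opprK; congr (_ + _).
  by rewrite scale_scalar_mx mulVf.
by rewrite unitmxZ // unitfE oppr_eq0 invr_eq0.
Qed.
End Phase.

(** * Lifting a unitary of one fibre of E to the Cuntz-Pimsner algebra *)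

Section HatExists.
Variables (R : realType) (X : topologicalType) (d : nat) (E : herm_bundle R X d).
Local Notation C := (cplx R).
Variables (n : nat) (psi : 'I_n -> bsection E).
Hypothesis hpsi : section_frame psi.
Hypotheses (hX : hausdorff_space X) (cX : compact [set: X]).
Variables (O : cstarType R) (iC : (X -> C) -> O) (iE : bsection E -> O).
Hypothesis OE : is_cuntz_pimsner psi iC iE.
Local Notation ker := (fib_ker iC setT).
Local Notation S l := (iE (psi l)).

Let rel : cp_relations psi iC iE. Proof. by case: OE. Qed.
Let hC : cfun_hom iC. Proof. by case: rel. Qed.

(** The relations give commutation with the sections but not with their adjoints. The set D of
    elements commuting with all [iC f] at once is stable under [adj], as C(X) is stable under
    conjugation, so D is a closed star-subalgebra containing the generators. *)
Lemma iC_central (f : X -> C) : continuous f -> centre (iC f).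
Proof.
move=> cf; pose D := [set a : O | forall f : X -> C, continuous f -> iC f * a = a * iC f].
suff hD : D = setT by move=> a; have : D a by [rewrite hD]; apply.
have [_ gen _] := OE; apply: gen.
- split.
  + by move=> g _; rewrite mulr1 mul1r.
  + by move=> a b Da Db g cg; rewrite mulrDr mulrDl Da // Db.
  + by move=> k a Da g cg; rewrite -scalerAr -scalerAl Da.
  + by move=> a b Da Db g cg; rewrite mulrA Da // -mulrA Db // mulrA.
  + move=> a Da g cg.
    have cj : continuous (fun x => (g x)^*) by move=> x; apply: continuous_conj; exact: cg.
    have gj : adj (iC (fun x => (g x)^*)) = iC g by rewrite (iota_adj hC cg) adjK.
    by rewrite -gj -!adjM (Da _ cj).
- apply/closedRP => a ha g cg; apply/eqP; rewrite -subr_eq0; apply/eqP.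
  apply: rnorm_small => e e0.
  have g1 : 0 < 2 * (rnorm (iC g) + 1) by rewrite mulr_gt0 // ltr_wpDl ?rnorm_ge0.
  have [b Db ab] := ha _ (divr_gt0 e0 g1).
  have -> : iC g * a - a * iC g = iC g * (a - b) - (a - b) * iC g.
    by rewrite mulrBl mulrBr (Db g cg) opprB addrA subrK.
  rewrite (le_trans (rnormB _ _)) //.
  have c0 := rnorm_ge0 (iC g); have ba0 := rnorm_ge0 (a - b).
  move: ab; rewrite ltr_pdivlMr // => ab.
  have := rnormM (a - b) (iC g); have := rnormM (iC g) (a - b); nra.
- move=> _ [[g cg <-]|[phi cphi <-]] f' cf'.
    rewrite -(iotaM hC cf' cg) -(iotaM hC cg cf').
    by congr iC; apply/funext => x; rewrite mulrC.
  exact: (cp_central rel).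
Qed.

Let kerM a b x : ker x b -> ker x (a * b).
Proof. by apply: (fib_ker_mull iC_central). Qed.
Let kerMr a b x : ker x b -> ker x (b * a).
Proof. by apply: (fib_ker_mulr (iota := iC)). Qed.
Let kerZ (k : C) b x : ker x b -> ker x (k *: b).
Proof. exact: subspaceZ (fib_ker_subspace _ _ _). Qed.
Let ker_sum x (I : finType) (F : I -> O) : (forall i, ker x (F i)) -> ker x (\sum_i F i).
Proof. exact: subspace_sum (fib_ker_subspace _ _ _). Qed.

Lemma iC_ker (f : X -> C) x : continuous f -> ker x (iC f - f x *: 1).
Proof.
move=> cf; rewrite -(iota_cst hC) -(iotaB hC cf (continuous_const X (f x))) -[iC _]mulr1.
have cg : continuous (fun y => f y - f x).
  by move=> y; exact: (continuousB (cf y) (continuous_const X (f x) y)).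
exact: (fib_ker_gen cg (subrr (f x)) (I : [set: O] 1)).
Qed.

(* Represents v modulo the kernel of the fibre at x, without a section through v. *)
Definition const_rep x (v : E x) : O := \sum_l vb_ip (psi l x) v *: S l.

Lemma iE_expand phi : cont_section phi -> iE phi = \sum_l S l * iC (sec_ip (psi l) phi).
Proof.
move=> cphi; rewrite -[LHS]mul1r -(cp_sum rel) mulr_suml; apply: eq_bigr => l _.
by rewrite -mulrA (cp_ip rel (frame_cont hpsi l) cphi).
Qed.

Lemma iE_const_rep phi x : cont_section phi -> ker x (iE phi - const_rep (phi x)).
Proof.
move=> cphi; rewrite (iE_expand cphi) /const_rep -sumrB; apply: ker_sum => l.
have := @iC_ker _ x (sec_ip_cont (frame_cont hpsi l) cphi); move/(@kerM (S l) _ _).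
by rewrite mulrBr -scalerAr mulr1.
Qed.

Lemma adj_const_rep l x (v : E x) : ker x (adj (S l) * const_rep v - vb_ip (psi l x) v *: 1).
Proof.
have -> : vb_ip (psi l x) v *: (1 : O) =
    \sum_m vb_ip (psi m x) v *: (sec_ip (psi l) (psi m) x *: 1).
  rewrite -(frame_ip hX cX hpsi) scaler_suml; apply: eq_bigr => m _.
  by rewrite scalerA mulrC.
rewrite mulr_sumr -sumrB; apply: ker_sum => m.
rewrite -scalerAr -scalerBr; apply: kerZ.
rewrite (cp_ip rel (frame_cont hpsi l) (frame_cont hpsi m)).
exact: (@iC_ker _ x (sec_ip_cont (frame_cont hpsi l) (frame_cont hpsi m))).
Qed.

Arguments adj_const_rep l {x} v.

Lemma const_repD x (v w : E x) : const_rep (v + w) = const_rep v + const_rep w.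
Proof.
by rewrite -big_split; apply: eq_bigr => l _ /=; rewrite vb_ipDr scalerDl.
Qed.
Lemma const_repZ x (k : C) (v : E x) : const_rep (k *: v) = k *: const_rep v.
Proof.
by rewrite scaler_sumr; apply: eq_bigr => l _; rewrite vb_ipZr scalerA.
Qed.

(* The Cayley transform of y, after a phase, as an operator on the fibre. *)
Lemma fibre_cayley x (y : E x -> E x) :
  (forall (k : C) (v w : E x), y (k *: v + w) = k *: y v + y w) ->
  (forall v w, vb_ip (y v) (y w) = vb_ip v w) ->
  exists (l : C) (h : E x -> E x), [/\ l * l^* = 1,
    forall (k : C) v w, h (k *: v + w) = k *: h v + h w,
    forall v, h (v + l *: y v) = l *: y v - v &
    forall v w, vb_ip (h v) w = - vb_ip v (h w)].
Proof.
move=> ly yip; have [i ix] := vb_dom_cover E x.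
have [m hm] := chart_matrix ix ly.
have [l [ll ul]] := avoid_eigenvalues m.
have [lt [g gK Kg]] := vb_trivP ix.
(* f inverts 1 + l y in the chart, and h = (l y - 1) f is the operator whose Cayley transform is l
   y. *)
pose f (v : E x) : E x := g (invmx (1%:M + l *: m) *m vb_triv i v).
have f_lin (k : C) (v w : E x) : f (k *: v + w) = k *: f v + f w.
  by apply: (can_inj gK); rewrite lt; rewrite /f !Kg lt mulmxDr -scalemxAr.
have tr (v : E x) : vb_triv i (v + l *: y v) = (1%:M + l *: m) *m vb_triv i v.
  by rewrite addrC lt hm mulmxDl mul1mx -scalemxAl addrC.
have fK v : f (v + l *: y v) = v by rewrite /f tr mulKmx.
have Kf v : f v + l *: y (f v) = v.
  by apply: (can_inj gK); rewrite tr Kg mulKVmx.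
exists l, (fun v => l *: y (f v) - f v); split => //.
- move=> k v w; rewrite f_lin ly scalerDr opprD addrACA scalerBr; congr (_ - _ + _).
  by rewrite !scalerA mulrC.
- by move=> v; rewrite fK.
- move=> v' w'.
  (* Skewness of h is checked on the vectors v + l y v, which exhaust the fibre. *)
  have sk v w : vb_ip (l *: y v - v) (w + l *: y w) = - vb_ip (v + l *: y v) (l *: y w - w).
    have yy : vb_ip (l *: y v) (l *: y w) = vb_ip v w.
      by rewrite ipZl vb_ipZr yip mulrA [l^* * l]mulrC ll mul1r.
    rewrite !ipDl !ipNl !vb_ipDr !ipNr yy.
    move: (vb_ip v w) (vb_ip v _) (vb_ip (l *: y v) _) => r q p.
    by rewrite opprD addrA addrK opprD !opprB [RHS]addrC addrA subrK.
  by have := sk (f v') (f w'); rewrite !Kf.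
Qed.

(* u is the Cayley transform of the skew K = sum <psi_a, h psi_b> S_a S_b^*, times
   a phase. The automorphism S_l |-> u S_l fixes K, hence u, so its inverse is
   S_l |-> u^* S_l. *)
Lemma lift_unitary x (y : E x -> E x) :
  (forall (k : C) (v w : E x), y (k *: v + w) = k *: y v + y w) ->
  (forall v w, vb_ip (y v) (y w) = vb_ip v w) ->
  exists u K : O, [/\ adj u * u = 1, u * adj u = 1, u * K = K * u,
    forall v : E x, ker x (u * const_rep v - const_rep (y v)) &
    forall (w : O) (eta : O -> O), star_hom eta -> w * adj w = 1 -> w * K = K * w ->
      (forall phi, cont_section phi -> eta (iE phi) = w * iE phi) -> eta u = u].
Proof.
move=> ly yip; have [l [h [ll h_lin hcay hskew]]] := fibre_cayley ly yip.
have h0 : h 0 = 0 by have := h_lin (-1) 0 0; rewrite scaler0 addr0 scaleN1r addNr.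
have hD (v w : E x) : h (v + w) = h v + h w by rewrite -[v]scale1r h_lin !scale1r.
have hZ (k : C) (v : E x) : h (k *: v) = k *: h v by rewrite -[k *: v]addr0 h_lin h0 addr0.
(* The coefficients are frozen at x, so K represents h only modulo the kernel there. The frame may
   be linearly dependent; the frame identity is what makes K act as h. *)
pose kk a b : C := vb_ip (psi a x) (h (psi b x)).
pose K : O := \sum_a \sum_b kk a b *: (S a * adj (S b)).
have aK : adj K = - K.
  rewrite /K [in RHS]exchange_big adj_sum -sumrN; apply: eq_bigr => a _.
  rewrite adj_sum -sumrN; apply: eq_bigr => b _.
  rewrite adjZ adjM adjK -scaleNr; congr (_ *: _).
  by rewrite /kk -vb_ipC hskew.
have Kv (v : E x) : ker x (K * const_rep v - const_rep (h v)).
  have -> : const_rep (h v) = \sum_a \sum_b kk a b *: (S a * (vb_ip (psi b x) v *: 1)).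
    rewrite -{1}(frame_id hX cX hpsi v) (big_morph _ hD h0) /const_rep.
    apply: eq_bigr => a _.
    under [X in vb_ip _ X]eq_bigr do rewrite hZ.
    rewrite ip_sumr scaler_suml; apply: eq_bigr => b _.
    by rewrite -scalerAr mulr1 scalerA mulrC.
  rewrite /K mulr_suml -sumrB; apply: ker_sum => a.
  rewrite mulr_suml -sumrB; apply: ker_sum => b.
  rewrite -scalerAl -scalerBr; apply: kerZ; rewrite -[_ * const_rep v]mulrA -mulrBr.
  exact: (@kerM (S a) _ _ (adj_const_rep b v)).
have [u0 [W [uu uu' uE rW lW]]] := cayley_unitary aK.
have two (p : O) : 2 *: p = p + p by rewrite scaler_nat mulr2n.
have uv (v : E x) : ker x (u0 * const_rep v - const_rep (l *: y v)).
  (* In the fibre, (1 - K) z = 2 v and (1 + K) z = 2 l y v; eliminating z shows that u0 sends v to l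
     y v. *)
  pose z := v + l *: y v.
  have hz : const_rep (h z) = const_rep (l *: y v) - const_rep v.
    by rewrite hcay const_repD -[- v]scaleN1r (const_repZ (-1)) scaleN1r.
  have cz : const_rep z = const_rep v + const_rep (l *: y v) by exact: const_repD.
  have h1 : ker x ((1 - K) * const_rep z - 2 *: const_rep v).
    have := kerN (Kv z); rewrite opprB hz mulrBl mul1r cz two.
    congr (ker x).
    by rewrite [RHS]addrAC opprD addrACA subrr add0r.
  have h2 : ker x ((1 + K) * const_rep z - 2 *: const_rep (l *: y v)).
    have := Kv z; rewrite hz mulrDl mul1r cz two.
    congr (ker x).
    by rewrite [RHS]addrAC [in RHS]opprD [in RHS]addrACA subrr addr0 opprB addrC.
  have h3 := @kerM W _ _ h1; rewrite mulrBr mulrA lW mul1r -scalerAr in h3.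
  have h4 := @kerM (1 + K) _ _ h3; rewrite mulrBr -scalerAr mulrA -uE in h4.
  have := @kerZ 2^-1 _ _ (kerB h2 h4); congr (ker x).
  rewrite opprB addrC addrA subrK -scalerBr scalerA mulVf ?scale1r //.
have uK : u0 * K = K * u0.
  have WK : W * K = K * W.
    have : W * (1 - K) = (1 - K) * W by rewrite rW lW.
    by rewrite mulrBr mulrBl mulr1 mul1r => /addrI /oppr_inj.
  rewrite uE -mulrA WK !mulrA; congr (_ * _).
  by rewrite mulrDl mulrDr mul1r mulr1.
(* u0 lifts l y; the conjugate phase cancels l. *)
exists (l^* *: u0), K; split.
- by rewrite adjZ -scalerAl -scalerAr conjCK scalerA ll uu scale1r.
- by rewrite adjZ -scalerAl -scalerAr conjCK scalerA mulrC ll uu' scale1r.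
- by rewrite -scalerAl -scalerAr uK.
- move=> v; have := @kerZ l^* _ _ (uv v); congr (ker x).
  by rewrite scalerBr const_repZ scalerA [l^* * l]mulrC ll scale1r scalerAl.
- move=> w eta he ww wK hw.
  have eS a : eta (S a) = w * S a by apply: hw; exact: frame_cont hpsi a.
  (* Each term of K has one generator and one adjoint, so eta conjugates K by w, with which K
     commutes. *)
  have eK : eta K = K.
    transitivity (w * K * adj w); last by rewrite wK -mulrA ww mulr1.
    rewrite /K (star_hom_sum he) mulr_sumr mulr_suml; apply: eq_bigr => a _.
    rewrite (star_hom_sum he) mulr_sumr mulr_suml; apply: eq_bigr => b _.
    rewrite (star_homZ he) (star_homM he) (star_hom_adj he) !eS adjM.
    by rewrite -scalerAr -scalerAl !mulrA.
  have e1 : eta (1 - K) = 1 - K by rewrite (star_homB he) (star_hom1 he) eK.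
  have eW : eta W = W.
    by rewrite -[LHS]mulr1 -rW mulrA -e1 -(star_homM he) lW (star_hom1 he) mul1r.
  by rewrite (star_homZ he) uE (star_homM he) (star_homD he) (star_hom1 he) eK eW.
Qed.

Lemma rotation_hom (w : O) : adj w * w = 1 -> w * adj w = 1 -> exists eta : O -> O,
  [/\ star_hom eta, forall f : X -> C, continuous f -> eta (iC f) = iC f &
      forall phi, cont_section phi -> eta (iE phi) = w * iE phi].
Proof.
move=> w1 w2; have [_ _ univ] := OE.
have [|eta [h _]] := univ O iC (fun phi => w * iE phi); last by exists eta.
split.
- exact: hC.
- by move=> phi phi' c c'; rewrite (cp_add rel c c') mulrDr.
- by move=> f phi cf c; rewrite (cp_scale rel cf c) mulrA.
- move=> f phi cf c; rewrite mulrA (iC_central cf) -mulrA (iC_central cf) mulrA.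
  by [].
- move=> phi phi' c c'.
  by rewrite adjM -mulrA (mulrA (adj w)) w1 mul1r (cp_ip rel c c').
- transitivity (w * (\sum_a S a * adj (S a)) * adj w); last by rewrite (cp_sum rel) mulr1.
  by rewrite mulr_sumr mulr_suml; apply: eq_bigr => a _; rewrite adjM !mulrA.
Qed.

Lemma star_hom_fixing_gens (eta : O -> O) : star_hom eta ->
  (forall f : X -> C, continuous f -> eta (iC f) = iC f) ->
  (forall phi, cont_section phi -> eta (iE phi) = iE phi) -> eta = id.
Proof.
move=> h1 h2 h3; have [_ _ univ] := OE.
have [g [_ hg]] := univ O iC iE rel.
have -> : id = g by apply/esym/hg; split.
by apply/esym/hg; split.
Qed.

Section FibreMap.
Variables (eta : O -> O).
Hypothesis he : star_hom eta.
Hypothesis hf : forall f : X -> C, continuous f -> eta (iC f) = iC f.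

Lemma star_hom_ker x a : ker x a -> ker x (eta a).
Proof.
apply: (clspan_map (N := ker x) (f := eta) (K := 1)).
- exact: fib_ker_subspace.
- exact: fib_ker_closed.
- exact: star_hom0.
- exact: star_homD.
- by move=> k b hb; rewrite (star_homZ he); exact: kerZ.
- by move=> b; rewrite mul1r; exact: star_hom_rnorm.
- move=> _ [f [b [cf fx _ ->]]]; rewrite (star_homM he) (hf cf).
  exact: (fib_ker_gen cf fx).
Qed.

Definition fibre_map x (v : fibre iC setT x) : fibre iC setT x :=
  fib_pt iC x (I : [set: O] (eta (sval (cid2 (fib_mem_ex v))))).

Lemma maps_fibre_map x a a' : maps_class (@fibre_map x) a a' <-> ker x (a' - eta a).
Proof.
pose v := fib_pt iC x (I : [set: O] a).
have va : sval v a by exact: fib_pt_mem.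
rewrite (maps_classP _ _ va) /fibre_map; case: cid2 => b _ vb /=.
have := star_hom_ker ((fib_mem_ker _ va).1 vb); rewrite (star_homB he) => k.
rewrite /fib_class /=; split => h; first exact: ker_trans h k.
exact: ker_trans h (ker_dist k).
Qed.
End FibreMap.

Lemma fibre_map_auto x (eta eta' : O -> O) : star_hom eta -> star_hom eta' ->
  (forall f : X -> C, continuous f -> eta (iC f) = iC f) ->
  (forall f : X -> C, continuous f -> eta' (iC f) = iC f) ->
  cancel eta eta' -> cancel eta' eta -> fib_automorphism (@fibre_map eta x).
Proof.
move=> h h' hf hf' K K'.
have can g g' : star_hom g -> star_hom g' ->
    (forall f : X -> C, continuous f -> g (iC f) = iC f) ->
    (forall f : X -> C, continuous f -> g' (iC f) = iC f) ->
    cancel g g' -> cancel (@fibre_map g x) (@fibre_map g' x).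
  move=> s s' sf sf' gK v; have [a _ va] := fib_mem_ex v.
  have m1 : sval (fibre_map g v) (g a).
    by apply/(maps_classP _ _ va)/(maps_fibre_map s sf); rewrite subrr; exact: ker0.
  have m2 : sval (fibre_map g' (fibre_map g v)) a.
    apply/(maps_classP _ _ m1)/(maps_fibre_map s' sf'); rewrite gK subrr; exact: ker0.
  exact: fib_mem_inj m2 va.
have M a a' : maps_class (@fibre_map eta x) a a' <-> ker x (a' - eta a).
  exact: maps_fibre_map.
split.
- by exists (@fibre_map eta' x); exact: can.
- split=> [a b a' b'|k a a'].
    move=> /M ha /M hb; apply/M; rewrite (star_homD h) opprD addrACA; exact: kerD.
  by move=> /M ha; apply/M; rewrite (star_homZ h) -scalerBr; exact: kerZ.
- move=> a b a' b' /M ha /M hb; apply/M; rewrite (star_homM h).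
  have -> : a' * b' - eta a * eta b = a' * (b' - eta b) + (a' - eta a) * eta b.
    by rewrite mulrBr mulrBl addrA subrK.
  by apply: kerD; [exact: kerM | exact: kerMr].
- move=> a a' /M ha; apply/M; rewrite (star_hom_adj h) -adjB.
  have cj (f : X -> C) : continuous f -> continuous (fun y => (f y)^*).
    by move=> cf y; apply: continuous_conj; exact: cf.
  apply: (clspan_map (N := ker x) (f := fun a => adj a) (K := 1)) ha.
  + exact: fib_ker_subspace.
  + exact: fib_ker_closed.
  + exact: adj0.
  + exact: adjD.
  + by move=> k b hb; rewrite adjZ; exact: kerZ.
  + by move=> b; rewrite mul1r rnorm_adj.
  + move=> _ [f [b [cf fx _ ->]]]; rewrite adjM -(iota_adj hC cf).
    apply: kerM; rewrite -[iC _]mulr1; apply: (fib_ker_gen (cj _ cf)) => //.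
    by rewrite fx rmorph0.
Qed.

(** [hat] is selected by [xget], so its properties hold as soon as one map has them; the map induced
    on the fibre by the rotation eta does. *)
Lemma hatP x (y : E x -> E x) :
  (forall (k : C) (v w : E x), y (k *: v + w) = k *: y v + y w) ->
  (forall v w, vb_ip (y v) (y w) = vb_ip v w) ->
  fib_automorphism (hat (iC := iC) iE y) /\
  forall a a', moves iE y a a' -> maps_class (hat (iC := iC) iE y) a a'.
Proof.
move=> ly yip; have [u [K [u1 u2 uK uv hu]]] := lift_unitary ly yip.
have [eta [h hf hE]] := rotation_hom u1 u2.
have v1 : adj (adj u) * adj u = 1 by rewrite adjK.
have v2 : adj u * adj (adj u) = 1 by rewrite adjK.
have [eta' [h' hf' hE']] := rotation_hom v1 v2.
have auK : adj u * K = K * adj u.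
  by rewrite -[LHS]mulr1 -u2 !mulrA -[_ * K * u]mulrA -uK mulrA u1 mul1r.
have eu : eta u = u by exact: hu hE.
have eu' : eta' u = u by exact: hu hE'.
have comp_hom (g g' : O -> O) : star_hom g -> star_hom g' -> star_hom (g' \o g).
  move=> s s'; split => /=.
  - by rewrite (star_hom1 s) (star_hom1 s').
  - by move=> a b _ _; rewrite (star_homD s) (star_homD s').
  - by move=> k a _; rewrite (star_homZ s) (star_homZ s').
  - by move=> a b _ _; rewrite (star_homM s) (star_homM s').
  - by move=> a _; rewrite (star_hom_adj s) (star_hom_adj s').
have K1 : eta' \o eta = id.
  apply: star_hom_fixing_gens; first exact: comp_hom.
    by move=> f cf /=; rewrite hf // hf'.
  move=> phi c /=; rewrite (hE _ c) (star_homM h') eu' (hE' _ c).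
  by rewrite mulrA u2 mul1r.
have K2 : eta \o eta' = id.
  apply: star_hom_fixing_gens; first exact: comp_hom.
    by move=> f cf /=; rewrite hf' // hf.
  move=> phi c /=; rewrite (hE' _ c) (star_homM h) (star_hom_adj h) eu (hE _ c).
  by rewrite mulrA u1 mul1r.
have c1 : cancel eta eta' by move=> a; have := congr1 (@^~ a) K1.
have c2 : cancel eta' eta by move=> a; have := congr1 (@^~ a) K2.
pose P := [set T : fibre iC setT x -> fibre iC setT x | fib_automorphism T /\
          forall a a', moves iE y a a' -> maps_class T a a'].
have : P (@fibre_map eta x).
  split; first exact: (fibre_map_auto x h h' hf hf' c1 c2).
  move=> _ _ [phi [phi' [c c' e -> ->]]]; apply/(maps_fibre_map h hf).
  have h1 := @iE_const_rep _ x c'; rewrite e in h1.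
  have h2 := @kerM u _ _ (@iE_const_rep _ x c); rewrite mulrBr in h2.
  by rewrite (hE _ c); exact: ker_trans h1 (ker_dist (ker_trans h2 (uv (phi x)))).
move=> hP; suff : P (hat (iC := iC) iE y) by [].
exact: (@xgetI _ _ _ _ hP).
Qed.
End HatExists.

(** * Invariant sections *)

Section ComplexComplete.
Variable R : realType.
Local Notation C := (cplx R).

Lemma Re_le_cabs (z : C) : `|complex.Re z| <= cabs z.
Proof.
rewrite /cabs normc_def /=; case: z => a b /=.
by rewrite -sqrtr_sqr ler_wsqrtr // lerDl sqr_ge0.
Qed.
Lemma Im_le_cabs (z : C) : `|complex.Im z| <= cabs z.
Proof.
rewrite /cabs normc_def /=; case: z => a b /=.
by rewrite -sqrtr_sqr ler_wsqrtr // lerDr sqr_ge0.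
Qed.
Lemma cabs_le_ReIm (z : C) : cabs z <= `|complex.Re z| + `|complex.Im z|.
Proof.
rewrite /cabs normc_def /=; case: z => a b /=.
rewrite -[leRHS]ger0_norm ?addr_ge0 // -sqrtr_sqr ler_wsqrtr //.
have -> : (`|a| + `|b|) ^+ 2 = a ^+ 2 + b ^+ 2 + 2 * (`|a| * `|b|).
  by rewrite -(real_normK (num_real a)) -(real_normK (num_real b)); ring.
by rewrite lerDl mulr_ge0 // mulr_ge0.
Qed.

Lemma real_complete (u : nat -> R) :
  (forall e : R, 0 < e -> exists N, forall m n, (N <= m)%N -> (N <= n)%N ->
     `|u m - u n| < e) ->
  exists l, forall e : R, 0 < e -> exists N, forall n, (N <= n)%N -> `|u n - l| < e.
Proof.
move=> hu; have /cauchy_cvgP : cauchy (u @ \oo).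
  apply/cauchy_ballP => e e0; have [N hN] := hu _ e0.
  pose S := [set u n | n in [set n | (N <= n)%N]].
  exists (S, S) => /=.
    by split; exists N => // n hn; exists n.
  case=> _ _ /= [[m hm <-] [n hn <-]].
  rewrite -ball_normE /ball_ /=; exact: hN.
move=> hl; exists (lim (u @ \oo)) => e e0.
have /cvgrPdist_lt /(_ _ e0) [N _ hN] := hl.
by exists N => n /hN /=; rewrite distrC.
Qed.

Lemma cplx_complete (u : nat -> C) :
  (forall e : R, 0 < e -> exists N, forall m n, (N <= m)%N -> (N <= n)%N ->
     cabs (u m - u n) < e) ->
  exists l, forall e : R, 0 < e -> exists N, forall n, (N <= n)%N -> cabs (u n - l) < e.
Proof.
move=> hu.
have [a ha] : exists a, forall e : R, 0 < e ->
    exists N, forall n, (N <= n)%N -> `|complex.Re (u n) - a| < e.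
  apply: real_complete => e /hu [N hN]; exists N => m n hm hn.
  apply: le_lt_trans (hN m n hm hn); have := Re_le_cabs (u m - u n).
  by case: (u m) => ? ?; case: (u n).
have [b hb] : exists b, forall e : R, 0 < e ->
    exists N, forall n, (N <= n)%N -> `|complex.Im (u n) - b| < e.
  apply: real_complete => e /hu [N hN]; exists N => m n hm hn.
  apply: le_lt_trans (hN m n hm hn); have := Im_le_cabs (u m - u n).
  by case: (u m) => ? ?; case: (u n).
exists (Complex a b) => e e0; have e2 : 0 < e / 2 by rewrite divr_gt0.
have [N hN] := ha _ e2; have [M hM] := hb _ e2.
exists (maxn N M) => n hn.
have h1 := hN n (leq_trans (leq_maxl _ _) hn).
have h2 := hM n (leq_trans (leq_maxr _ _) hn).
apply: le_lt_trans (cabs_le_ReIm _) _; rewrite [e]splitr.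
by move: h1 h2; case: (u n) => c d /= h1 h2; apply: ltrD.
Qed.
End ComplexComplete.

(** * Approximate averaging over the groups and continuous selection *)

Section Averaging.
Variables (R : realType) (X : topologicalType) (rk : nat) (E : herm_bundle R X rk).
Local Notation C := (cplx R).
Hypotheses (hX : hausdorff_space X) (cX : compact [set: X]).
Variables (G : set (fendo E)) (hG : compact_group_bundle G).

Lemma telescope3 (V : zmodType) (a b c f : V) : a - b = (c - b) + ((f - c) - (f - a)).
Proof. by rewrite opprB [f - c + _]addrC [a - f + _]addrA subrK [RHS]addrC addrA subrK. Qed.
Lemma telescope4 (V : zmodType) (a b c f : V) :
  a - b = ((c - f) - (c - a)) + (f - b).
Proof. by rewrite opprB [c - f + _]addrC [a - c + _]addrA subrK addrA subrK. Qed.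

Lemma parallelogram_ring (F : comPzRingType) (a b a' b' : F) :
  (a - b) * (a' - b') = 2 * (a * a') + 2 * (b * b') - (a + b) * (a' + b').
Proof. by ring. Qed.

Definition ctmx m n (v : 'M[C]_(m, n)) : 'M[C]_(n, m) := map_mx Num.conj v^T.

Lemma ctmx_mul m n p (v : 'M[C]_(m, n)) (w : 'M[C]_(n, p)) :
  ctmx (v *m w) = ctmx w *m ctmx v.
Proof. by rewrite /ctmx trmx_mul map_mxM. Qed.

(** The square of the Hilbert-Schmidt norm. *)
Definition nsq m n (v : 'M[C]_(m, n)) : R := \sum_i \sum_j cabs (v i j) ^+ 2.

Lemma nsqE m n (v : 'M[C]_(m, n)) : rc (nsq v) = \tr (ctmx v *m v).
Proof.
rewrite /nsq exchange_big rc_sum; apply: eq_bigr => j _.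
rewrite rc_sum mxE; apply: eq_bigr => i _.
by rewrite cabs_sqr !mxE mulrC.
Qed.

Lemma nsq_ge0 m n (v : 'M[C]_(m, n)) : 0 <= nsq v.
Proof. by apply: sumr_ge0 => i _; apply: sumr_ge0 => j _; rewrite exprn_ge0 // cabs_ge0. Qed.

Lemma cabs_le_nsq m n (v : 'M[C]_(m, n)) i j (e : R) : 0 <= e -> nsq v <= e ^+ 2 ->
  cabs (v i j) <= e.
Proof.
move=> e0 h; rewrite -ler_sqr ?nnegrE ?cabs_ge0 //; apply: le_trans h.
rewrite /nsq (bigD1 i) //= (bigD1 j) //= -addrA lerDl addr_ge0 // sumr_ge0 // => k _.
  by rewrite exprn_ge0 // cabs_ge0.
by apply: sumr_ge0 => l _; rewrite exprn_ge0 // cabs_ge0.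
Qed.

Lemma nsq_parallelogram m n (v w : 'M[C]_(m, n)) :
  nsq (v - w) = 2 * nsq v + 2 * nsq w - nsq (v + w).
Proof.
have pl (a b : C) : cabs (a - b) ^+ 2 =
    2 * cabs a ^+ 2 + 2 * cabs b ^+ 2 - cabs (a + b) ^+ 2.
  apply: rc_inj; rewrite rcB rcD !(rcM 2) !cabs_sqr rmorphB rmorphD.
  have -> : rc 2 = 2 :> C by rewrite /rc rmorph_nat.
  exact: parallelogram_ring.
rewrite /nsq 2!mulr_sumr -big_split -sumrB; apply: eq_bigr => i _.
rewrite 2!mulr_sumr -big_split -sumrB; apply: eq_bigr => j _ /=.
by rewrite !mxE pl.
Qed.

Lemma nsqZ m n (k : R) (v : 'M[C]_(m, n)) : nsq (rc k *: v) = k ^+ 2 * nsq v.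
Proof.
rewrite /nsq mulr_sumr; apply: eq_bigr => i _; rewrite mulr_sumr; apply: eq_bigr => j _.
by rewrite mxE cabsM cabs_rc exprMn real_normK // num_real.
Qed.

Variables (N : nat) (Y : fendo E -> 'M[C]_N).
Hypothesis Ymul : forall x (y y' : E x -> E x), G (epoint y) -> G (epoint y') ->
  Y (epoint (y \o y')) = Y (epoint y) *m Y (epoint y').
Hypothesis Yinv : forall x (y y' : E x -> E x), G (epoint y) -> G (epoint y') ->
  cancel y y' -> cancel y' y -> Y (epoint y') = ctmx (Y (epoint y)).
Hypothesis Ycont : forall u, G u -> forall i j, {for u, continuous (fun u => Y u i j)}.

Definition convex_set (K : set 'M[C]_N) : Prop := forall a b (t : R),
  K a -> K b -> 0 <= t <= 1 -> K (rc t *: a + rc (1 - t) *: b).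

(** As an intersection of convex sets, so that a property stable under convex combinations is proved
    on it by taking that property for K. No closure is taken: matrices of nearly least norm are
    enough. *)
Definition hull (x : X) : set 'M[C]_N := [set a | forall K : set 'M[C]_N,
  (forall y : E x -> E x, G (epoint y) -> K (Y (epoint y))) -> convex_set K -> K a].

Lemma hull_gen x (y : E x -> E x) : G (epoint y) -> hull x (Y (epoint y)).
Proof. by move=> Gy K h _; exact: h. Qed.
Lemma hull_convex x : convex_set (hull x).
Proof. by move=> a b t ha hb t01 K h cK; apply: (cK) => //; [exact: ha | exact: hb]. Qed.

Lemma group_id x : G (epoint (@id (E x))). Proof. by case: hG => _ _ h _ _; exact: h. Qed.

(** The frame need not be linearly independent, so the identity of E_x is represented by a
    projection only; the hull lies where this projection acts as 1. *)
Lemma hull_id x a : hull x a -> Y (epoint (@id (E x))) *m a = a.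
Proof.
move=> ha; apply: (ha [set a | Y (epoint (@id (E x))) *m a = a]) => [y Gy|b c t /= hb hc _].
  by rewrite /= -(Ymul (group_id x) Gy).
by rewrite mulmxDr -!scalemxAr hb hc.
Qed.

Lemma hull_mul x (y : E x -> E x) a : G (epoint y) -> hull x a ->
  hull x (Y (epoint y) *m a).
Proof.
move=> Gy ha; apply: (ha [set a | hull x (Y (epoint y) *m a)]) => [y' Gy'|b c t /= hb hc t01].
  rewrite /= -(Ymul Gy Gy'); apply: hull_gen.
  by case: hG => _ _ _ h _; exact: h.
by rewrite mulmxDr -!scalemxAr; exact: hull_convex.
Qed.

Lemma nsq_isometry x (y : E x -> E x) p (v : 'M[C]_(N, p)) : G (epoint y) ->
  Y (epoint (@id (E x))) *m v = v -> nsq (Y (epoint y) *m v) = nsq v.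
Proof.
move=> Gy hv; apply: rc_inj; rewrite !nsqE ctmx_mul.
have [_ _ _ _ /(_ _ _ Gy) [y' [Gy' K K']]] := hG.
rewrite -(Yinv Gy Gy' K K') -mulmxA [Y (epoint y') *m _]mulmxA -(Ymul Gy' Gy).
have -> : y' \o y = id by apply/funext => z /=; rewrite K.
by rewrite hv.
Qed.

(** Let m be the infimum of the squared norms. If aW and its translate by y have squared norm below
    m + e^2/4, their midpoint still has at least m, and the parallelogram law bounds the squared
    distance by 4 (m + e^2/4) - 4 m = e^2. *)
Lemma approx_fixed x p (W : 'M[C]_(N, p)) (e : R) : 0 < e -> exists2 a, hull x a &
  forall y : E x -> E x, G (epoint y) -> forall i j,
    cabs ((Y (epoint y) *m (a *m W) - a *m W) i j) <= e.
Proof.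
move=> e0; pose S := [set nsq (a *m W) | a in hull x].
have S0 : S !=set0.
  exists (nsq (Y (epoint (@id (E x))) *m W)), (Y (epoint (@id (E x)))) => //.
  exact: hull_gen (group_id x).
have hS : has_inf S by split => //; exists 0 => _ [a _ <-]; exact: nsq_ge0.
have d0 : 0 < e ^+ 2 / 4 by rewrite divr_gt0 // exprn_gt0.
have [_ [a ha <-] am] := inf_adherent d0 hS.
exists a => // y Gy i j; apply: cabs_le_nsq; first exact: ltW.
have hid : Y (epoint (@id (E x))) *m (a *m W) = a *m W by rewrite mulmxA hull_id.
rewrite nsq_parallelogram (nsq_isometry Gy hid).
have : inf S <= nsq (rc 2^-1 *: (Y (epoint y) *m (a *m W) + a *m W)).
  apply: ge_inf; first by case: hS.
  exists (rc 2^-1 *: (Y (epoint y) *m a) + rc (1 - 2^-1) *: a).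
    apply: hull_convex => //; first exact: hull_mul.
    by rewrite invr_ge0 ler0n invf_le1 // ler1n.
  have -> : 1 - 2^-1 = 2^-1 :> R by field.
  by rewrite -scalerDr -scalemxAl mulmxDl mulmxA.
rewrite nsqZ; move: am; set m := inf S; set q := nsq (_ + _); set r := nsq _.
move=> am h; have h4 : 4 * m <= q by move: h; rewrite (expr2 2^-1); lra.
by move: am h4; move: (e ^+ 2) => ee; lra.
Qed.

Lemma hull_near x p (W : 'M[C]_(N, p)) (e : R) a : hull x a ->
  (forall y : E x -> E x, G (epoint y) -> forall i j, cabs ((Y (epoint y) *m W - W) i j) <= e) ->
  forall i j, cabs ((a *m W - W) i j) <= e.
Proof.
move=> ha h; apply: (ha [set a | forall i j, cabs ((a *m W - W) i j) <= e]).
  by move=> y Gy i j; exact: h.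
move=> b c t /= hb hc /andP[t0 t1] i j.
have -> : (rc t *: b + rc (1 - t) *: c) *m W - W =
    rc t *: (b *m W - W) + rc (1 - t) *: (c *m W - W).
  rewrite mulmxDl -!scalemxAl !scalerBr addrACA -opprD -scalerDl -rcD subrKC.
  by rewrite rc1 scale1r.
rewrite mxE [X in cabs (X + _)]mxE [X in cabs (_ + X)]mxE.
rewrite (le_trans (cabsD _ _)) // !cabsM !cabs_rc !ger0_norm ?subr_ge0 //.
have := hb i j; have := hc i j.
move: (cabs _) (cabs _) => q r; nra.
Qed.

Definition defect_lt (x : X) (w : 'cV[C]_N) (e : R) : Prop :=
  forall y : E x -> E x, G (epoint y) -> forall i, cabs ((Y (epoint y) *m w - w) i 0) < e.

(** The defect is a maximum over the fibre of the compact G, hence upper semicontinuous. The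
    near-covering form of compactness is applied to all of G, with the condition restricted to those
    u that lie over x'. *)
Lemma defect_near x w e : defect_lt x w e -> \forall x' \near x, defect_lt x' w e.
Proof.
move=> h; have [_ /compact_near_coveringP cG _ _ _] := hG.
pose P (x' : X) (u : fendo E) := projT1 u = x' -> forall i,
  cabs ((Y u *m w - w) i 0) < e.
suff hP u : G u -> \forall u' \near u & x' \near x, P x' u'.
  apply: filterS (cG X (nbhs x) P (nbhs_filter x) hP) => x' hx' y Gy.
  exact: (hx' _ Gy erefl).
move=> Gu; have FF := nbhs_filter u; have [ux|ux] := pselect (projT1 u = x).
  have cu i : {for u, continuous (fun u => (Y u *m w - w) i 0)}.
    apply: (@continuous_near_eq _ _ (fun u => \sum_k Y u i k * w k 0 - w i 0)).
      by apply: filterS filterT => z _; rewrite !mxE.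
    apply: continuousB; last exact: cst_continuous.
    apply: continuous_sum => k; apply: continuousM; last exact: cst_continuous.
    exact: Ycont.
  have hu i : cabs ((Y u *m w - w) i 0) < e.
    clear cu FF; case: u Gu ux => x' y Gu /= e'; subst x'; exact: h.
  have nu1 i : nbhs u [set u' : fendo E | cabs ((Y u' *m w - w) i 0) < e].
    have hp : 0 < e - cabs ((Y u *m w - w) i 0) by rewrite subr_gt0; exact: hu.
    have /continuous_atP /(_ _ hp) hc := cu i; apply: filterS hc => u' hu'.
    rewrite /= -(subrK ((Y u *m w - w) i 0) ((Y u' *m w - w) i 0)).
    by rewrite (le_lt_trans (cabsD _ _)) // -ltrBrDr.
  have nu := @filter_forall (fendo E) 'I_N _ (nbhs u) FF nu1.
  exists ([set u' | forall i, cabs ((Y u' *m w - w) i 0) < e], setT).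
    by split => //=; exact: filterT.
  by case=> u' x' /= [hu' _] _.
(* If u lies over another point, disjoint neighbourhoods make the condition void near u and x. *)
have nux : projT1 u != x by apply/eqP.
have := hX; rewrite open_hausdorff => /(_ _ _ nux) [[U V] /= [uU xV] [oU oV /eqP UV]].
exists ([set u' : fendo E | U (projT1 u')], V).
  split => /=.
    clear FF; case: u Gu {ux nux} uU => x' y Gu uU; apply: (group_proj_nbhs hG Gu).
    by apply: open_nbhs_nbhs; split => //; apply: set_mem.
  by apply: open_nbhs_nbhs; split => //; apply: set_mem.
case=> u' x' /= [Uu' Vx'] e'; rewrite e' in Uu'.
by have : (U `&` V) x' by []; rewrite UV.
Qed.

Definition defect_le (x : X) (w : 'cV[C]_N) (e : R) : Prop :=
  forall y : E x -> E x, G (epoint y) -> forall i, cabs ((Y (epoint y) *m w - w) i 0) <= e.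

Lemma convex_cabs (I : finType) (mu : I -> R) (z : I -> C) (e : R) :
  \sum_i mu i * mu i = 1 -> (forall i, mu i != 0 -> cabs (z i) <= e) ->
  cabs (\sum_i rc (mu i * mu i) * z i) <= e.
Proof.
move=> mu1 h; have tri : cabs (\sum_i rc (mu i * mu i) * z i) <= \sum_i mu i * mu i * cabs (z i).
  elim/big_ind2: _ => [|a b c f hab hcf|i _]; first by rewrite cabs0.
    by rewrite (le_trans (cabsD _ _)) // lerD.
  by rewrite cabsM cabs_rc ger0_norm // -expr2 sqr_ge0.
apply: (le_trans tri); rewrite -[leRHS]mul1r -mu1 mulr_suml; apply: ler_sum => i _.
have [->|n0] := eqVneq (mu i) 0; first by rewrite !mul0r.
by rewrite ler_wpM2l ?h // -expr2 sqr_ge0.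
Qed.

(** The constant vector f x = a v(x), with a in the hull, is within e of v(x) and has defect at most
    e/4, so below e/2 strictly and therefore near x too. Continuity of v costs another e, whence 2
    e. Both conditions are convex and survive gluing by the partition of unity. *)
Lemma michael_step (v : X -> 'cV[C]_N) (e : R) : 0 < e ->
  (forall i, continuous (fun x => v x i 0)) -> (forall x, defect_le x (v x) e) ->
  exists v' : X -> 'cV[C]_N, [/\ forall i, continuous (fun x => v' x i 0),
    forall x, defect_le x (v' x) (e / 2) &
    forall x i, cabs (v' x i 0 - v x i 0) <= 2 * e].
Proof.
move=> e0 cv hv; have e4 : 0 < e / 4 by rewrite divr_gt0.
have hf x : exists f : 'cV[C]_N, defect_lt x f (e / 2) /\
    forall i, cabs (f i 0 - v x i 0) <= e.
  have [a ha h] := approx_fixed x (v x) e4; exists (a *m v x); split.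
    move=> y Gy i; apply: le_lt_trans (h y Gy i 0) _.
    by rewrite ltr_pM2l // ltf_pV2 ?posrE // ltr_nat.
  move=> i; have := hull_near (W := v x) ha (e := e); rewrite /= => hn.
  have := hn _ i 0; rewrite !mxE; apply => y Gy k l.
  by rewrite !ord1; exact: hv.
have [f {}hf] := choice hf.
pose U x := [set x' | defect_lt x' (f x) (e / 2) /\ forall i, cabs (f x i 0 - v x' i 0) <= 2 * e].
have hU x : nbhs x (U x).
  have [h1 h2] := hf x.
  have n2 : nbhs x [set x' | forall i, cabs (f x i 0 - v x' i 0) <= 2 * e].
    apply: (@filter_forall X 'I_N (fun i x' => cabs (f x i 0 - v x' i 0) <= 2 * e) (nbhs x) (nbhs_filter x)) => i.
    have /continuous_atP /(_ _ e0) hc := cv i x; apply: filterS hc => x' hx'.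
    have -> : f x i 0 - v x' i 0 = (f x i 0 - v x i 0) - (v x' i 0 - v x i 0).
      by rewrite opprB addrA subrK.
    rewrite (le_trans (cabsD _ _)) // cabsN.
    by have := h2 i; move: hx'; lra.
  by apply: filterS2 (defect_near h1) n2 => x' a b.
have [I [p [mu [cmu mu1 muU]]]] := partition_of_unity R hX cX hU.
pose m i x : C := rc (mu i x * mu i x).
have cm i : continuous (m i).
  by apply: continuous_rc => x; exact: (continuousM (cmu i x) (cmu i x)).
exists (fun x => \col_k \sum_i m i x * f (p i) k 0); split.
- move=> k; rewrite (_ : (fun x => _) = fun x => \sum_i m i x * f (p i) k 0).
    move=> x; apply: continuous_sum => i.
    exact: (continuousM (cm i x) (continuous_const X (f (p i) k 0) x)).
  by apply/funext => x; rewrite mxE.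
- move=> x y Gy k.
  have -> : (Y (epoint y) *m (\col_k \sum_i m i x * f (p i) k 0)
             - (\col_k \sum_i m i x * f (p i) k 0)) k 0 =
      \sum_i m i x * (Y (epoint y) *m f (p i) - f (p i)) k 0.
    rewrite !mxE.
    under eq_bigr do rewrite mxE mulr_sumr.
    rewrite exchange_big -sumrB; apply: eq_bigr => i _ /=.
    by rewrite !mxE mulrBr mulr_sumr; congr (_ - _); apply: eq_bigr => l _; rewrite mulrCA.
  by apply: convex_cabs => // i /muU [h _]; apply: ltW; exact: h.
- move=> x k; rewrite mxE.
  have -> : \sum_i m i x * f (p i) k 0 - v x k 0 = \sum_i m i x * (f (p i) k 0 - v x k 0).
    under [RHS]eq_bigr do rewrite mulrBr.
    by rewrite sumrB -mulr_suml -rc_sum mu1 rc1 mul1r.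
  by apply: convex_cabs => // i /muU [_ h].
Qed.

Lemma geometric_small (k e : R) : 0 < e -> exists n, k * 2^-1 ^+ n < e.
Proof.
move=> e0; have k0 : 0 < `|k| + 1 by rewrite ltr_wpDl.
have : (fun n => 2^-1 ^+ n) @ \oo --> (0 : R).
  by apply: cvg_expr; rewrite ger0_norm ?invr_ge0 // invf_lt1 // ltr1n.
move=> /cvgrPdist_lt /(_ _ (divr_gt0 e0 k0)) [n _ hn]; exists n.
have := hn n (leqnn n); rewrite /= sub0r normrN ger0_norm ?exprn_ge0 ?invr_ge0 //.
have p0 : 0 <= 2^-1 ^+ n :> R by rewrite exprn_ge0 // invr_ge0.
rewrite ltr_pdivlMr //; have := ler_norm k; move: (2^-1 ^+ n) p0 => t; nra.
Qed.

(** The n-th correction is at most 2 e / 2^n. The corrections sum to 4 e, convergence is uniform,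
    and the defects tend to 0. *)
Lemma michael_limit (v0 : X -> 'cV[C]_N) (e : R) : 0 < e ->
  (forall i, continuous (fun x => v0 x i 0)) -> (forall x, defect_le x (v0 x) e) ->
  exists v : X -> 'cV[C]_N, [/\ forall i, continuous (fun x => v x i 0),
    forall x (y : E x -> E x), G (epoint y) -> Y (epoint y) *m v x = v x &
    forall x i, cabs (v x i 0 - v0 x i 0) <= 4 * e].
Proof.
move=> e0 cv0 hv0.
pose good (r : R) (v : X -> 'cV[C]_N) := (forall i, continuous (fun x => v x i 0)) /\
  (forall x, defect_le x (v x) r).
(* Stated for every pair, with the hypotheses under the existential, so that [choice] gives a total
   function to iterate. *)
have step (q : R * (X -> 'cV[C]_N)) : exists v' : X -> 'cV[C]_N, 0 < q.1 -> good q.1 q.2 ->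
    good (q.1 / 2) v' /\ forall x i, cabs (v' x i 0 - q.2 x i 0) <= 2 * q.1.
  have [[q0 [c h]]|n] := pselect (0 < q.1 /\ good q.1 q.2); last first.
    by exists q.2 => q0 g; case: n.
  by have [v' [a b c']] := michael_step q0 c h; exists v'.
have [F hF] := choice step.
pose r n : R := e * 2^-1 ^+ n.
have r0 n : 0 < r n by rewrite mulr_gt0 // exprn_gt0 // invr_gt0.
have rS n : r n.+1 = r n / 2 by rewrite /r exprSr mulrA.
pose w := fix w n := if n is m.+1 then F (r m, w m) else v0.
have gw n : good (r n) (w n).
  elim: n => [|n IH]; first by rewrite /r expr0 mulr1.
  by rewrite rS; have [] := hF (r n, w n) (r0 n) IH.
have dw n x i : cabs (w n.+1 x i 0 - w n x i 0) <= 2 * r n.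
  by have [_] := hF (r n, w n) (r0 n) (gw n); apply.
have dist n m x i : cabs (w (n + m)%N x i 0 - w n x i 0) <= 4 * r n - 4 * r (n + m)%N.
  elim: m => [|m IH]; first by rewrite addn0 !subrr cabs0.
  rewrite addnS -(subrK (w (n + m)%N x i 0) (w (n + m).+1 x i 0)) -addrA.
  rewrite (le_trans (cabsD _ _)) // (le_trans (lerD (dw _ _ _) IH)) //.
  by rewrite rS; lra.
have dist' n m x i : cabs (w (n + m)%N x i 0 - w n x i 0) <= 4 * r n.
  by apply: le_trans (dist n m x i) _; have := r0 (n + m)%N; lra.
have hl (xi : X * 'I_N) : exists l, forall d : R, 0 < d ->
    exists M, forall n, (M <= n)%N -> cabs (w n xi.1 xi.2 0 - l) < d.
  apply: cplx_complete => d d0; have [n hn] := geometric_small (8 * e) d0.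
  exists n => a b ha hb; rewrite -(subnKC ha) -(subnKC hb).
  have h1 := dist' n (a - n)%N xi.1 xi.2; have h2 := dist' n (b - n)%N xi.1 xi.2.
  have -> : w (n + (a - n))%N xi.1 xi.2 0 - w (n + (b - n))%N xi.1 xi.2 0 =
     (w (n + (a - n))%N xi.1 xi.2 0 - w n xi.1 xi.2 0)
     - (w (n + (b - n))%N xi.1 xi.2 0 - w n xi.1 xi.2 0) by rewrite opprB addrA subrK.
  apply: le_lt_trans (cabsD _ _) _; rewrite cabsN; apply: le_lt_trans (lerD h1 h2) _.
  by move: hn; rewrite /r; lra.
have [l {}hl] := choice hl.
pose v x : 'cV[C]_N := \col_i l (x, i).
have wv n x i : cabs (w n x i 0 - v x i 0) <= 4 * r n.
  rewrite mxE; apply/ler_addgt0Pr => d d0; have [M hM] := hl (x, i) _ d0.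
  have h1 := hM (n + M)%N (leq_addl _ _); have h2 := dist' n M x i.
  have -> : w n x i 0 - l (x, i) =
      (w (n + M)%N x i 0 - l (x, i)) - (w (n + M)%N x i 0 - w n x i 0).
    by rewrite opprB [RHS]addrC addrA subrK.
  apply: le_trans (cabsD _ _) _; rewrite cabsN addrC; apply: lerD => //; exact: ltW.
exists v; split.
- move=> i x; apply/continuous_atP => d d0.
  have d3 : 0 < d / 3 by rewrite divr_gt0.
  have [n hn] := geometric_small (4 * e) d3.
  have rn : 4 * r n < d / 3 by rewrite /r mulrA.
  have [cw _] := gw n; have /continuous_atP /(_ _ d3) hc := cw i x.
  apply: filterS hc => x' hx'.
  have -> : v x' i 0 - v x i 0 = (w n x i 0 - v x i 0) +
      ((w n x' i 0 - w n x i 0) - (w n x' i 0 - v x' i 0)).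
    exact: telescope3.
  apply: le_lt_trans (cabsD _ _) _; have := cabsD (w n x' i 0 - w n x i 0) (- (w n x' i 0 - v x' i 0)).
  rewrite cabsN; have := wv n x i; have := wv n x' i; move: rn hx'.
  by move: (cabs _) (cabs _) (cabs _) (cabs _) => a b c f; lra.
- move=> x y Gy; apply/matrixP => i j; rewrite !ord1.
  apply/eqP; rewrite -subr_eq0; apply/eqP; apply: cabs_eq0.
  apply/eqP; rewrite eq_le cabs_ge0 andbT; apply/ler_addgt0Pr => d d0; rewrite add0r.
  pose S := \sum_k cabs (Y (epoint y) i k).
  have [n hn] := geometric_small (S * (4 * e) + 5 * e) d0.
  have [_ dn] := gw n.
  have h1 : cabs ((Y (epoint y) *m (w n x - v x)) i 0) <= S * (4 * r n).
    rewrite mxE /S mulr_suml; elim/big_ind2: _ => [|a b c f hab hcf|k _]; first by rewrite cabs0.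
      by rewrite (le_trans (cabsD _ _)) // lerD.
    rewrite cabsM ler_wpM2l ?cabs_ge0 //; have := wv n x k; by rewrite !mxE.
  have h2 := dn x y Gy i; have h3 := wv n x i.
  have -> : (Y (epoint y) *m v x) i 0 - v x i 0 =
      ((Y (epoint y) *m w n x - w n x) i 0 - (Y (epoint y) *m (w n x - v x)) i 0)
      + (w n x i 0 - v x i 0).
    have mxB (a b : 'cV[C]_N) : (a - b) i 0 = a i 0 - b i 0 by rewrite !mxE.
    by rewrite mulmxBr !mxB; exact: telescope4.
  apply: ltW; apply: le_lt_trans (cabsD _ _) _.
  have := cabsD ((Y (epoint y) *m w n x - w n x) i 0) (- (Y (epoint y) *m (w n x - v x)) i 0).
  rewrite cabsN; move: h1 h2 h3 hn; rewrite -/(r n) /r.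
  move: (cabs _) (cabs _) (cabs _) (cabs _) => a b c f; move: (2^-1 ^+ n) => t; lra.
- move=> x i; have := wv 0%N x i; rewrite /r expr0 mulr1 -cabsN opprB; exact: id.
Qed.

(** The iteration starts at b f, where b is a cutoff vanishing wherever the defect of f is not below
    e; its defect is then at most e over all of X. *)
Lemma invariant_section x0 (f : 'cV[C]_N) (e : R) : 0 < e -> defect_lt x0 f e ->
  exists v : X -> 'cV[C]_N, [/\ forall i, continuous (fun x => v x i 0),
    forall x (y : E x -> E x), G (epoint y) -> Y (epoint y) *m v x = v x &
    forall i, cabs (v x0 i 0 - f i 0) <= 4 * e].
Proof.
move=> e0 hf.
have [b [cb b01 /nbhs_singleton b1 b0]] := bump_function R hX cX (defect_near hf).
pose v0 x : 'cV[C]_N := rc (b x) *: f.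
have [||v [cv vY vf]] := @michael_limit v0 e e0.
- move=> i; have -> : (fun x => v0 x i 0) = (fun x => rc (b x) * f i 0).
    by apply/funext => x; rewrite mxE.
  exact: (continuous_mul (continuous_rc cb) (continuous_const X (f i 0))).
- move=> x y Gy i; have /andP[p0 p1] := b01 x.
  have -> : Y (epoint y) *m v0 x - v0 x = rc (b x) *: (Y (epoint y) *m f - f).
    by rewrite -scalemxAr scalerBr.
  rewrite mxE cabsM cabs_rc ger0_norm //.
  have [h|h] := pselect (defect_lt x f e); last by rewrite b0 // mul0r ltW.
  have := h y Gy i; have := cabs_ge0 ((Y (epoint y) *m f - f) i 0); nra.
exists v; split => // i; have := vf x0 i.
by rewrite /v0 b1 rc1 scale1r.
Qed.
End Averaging.

(** * The crossed product *)

Section Families.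
Variables (R : realType) (X : topologicalType) (d : nat) (E : herm_bundle R X d).
Local Notation C := (cplx R).
Variables (n : nat) (psi : 'I_n -> bsection E).
Hypothesis hpsi : section_frame psi.
Hypotheses (hX : hausdorff_space X) (cX : compact [set: X]).
Variables (O : cstarType R) (iC : (X -> C) -> O) (iE : bsection E -> O).
Hypothesis OE : is_cuntz_pimsner psi iC iE.
Variables (G : set (fendo E)) (hG : compact_group_bundle G).
Local Notation ker := (fib_ker iC setT).
Local Notation hatm x y := (hat (iC := iC) iE (x := x) y).

Lemma hat_auto x (y : E x -> E x) : G (epoint y) -> fib_automorphism (hatm x y).
Proof.
by move=> Gy; have [] := hatP hpsi hX cX OE (group_linear hG Gy) (group_ip hG Gy).
Qed.

(* A finite family of elements whose span is moved by every hat y through the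
   matrix Y y, which represents the groups G_x by partial isometries. *)
Record gfamily (I : finType) (th : I -> O) (Y : fendo E -> I -> I -> C) : Prop := GFamily {
  gf_maps : forall x (y : E x -> E x), G (epoint y) -> forall i,
    maps_class (hatm x y) (th i) (\sum_k Y (epoint y) k i *: th k);
  gf_mul : forall x (y y' : E x -> E x), G (epoint y) -> G (epoint y') -> forall i k,
    Y (epoint (y \o y')) i k = \sum_l Y (epoint y) i l * Y (epoint y') l k;
  gf_inv : forall x (y y' : E x -> E x), G (epoint y) -> G (epoint y') ->
    cancel y y' -> cancel y' y -> forall i k, Y (epoint y') i k = (Y (epoint y) k i)^*;
  gf_cont : forall u, G u -> forall i k, {for u, continuous (fun u => Y u i k)}
}.

Lemma gfamily1 : gfamily (fun _ : unit => 1) (fun _ _ _ => 1).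
Proof.
have s1 (V : zmodType) (F : unit -> V) : \sum_k F k = F tt.
  by rewrite (bigD1 tt) //= big1 ?addr0 // => -[].
split.
- by move=> x y Gy i; rewrite s1 scale1r; apply: auto_one; exact: hat_auto.
- by move=> *; rewrite s1 mulr1.
- by move=> *; rewrite rmorph1.
- by move=> *; exact: cst_continuous.
Qed.

Lemma gfamily_adj (I : finType) (th : I -> O) Y : gfamily th Y ->
  gfamily (fun i => adj (th i)) (fun u i k => (Y u i k)^*).
Proof.
case=> h1 h2 h3 h4; split.
- move=> x y Gy i; have := auto_adj (hat_auto Gy) (h1 x y Gy i).
  rewrite adj_sum => h.
  rewrite (eq_bigr (fun k => adj (Y (epoint y) k i *: th k))) // => k _.
  by rewrite adjZ.
- move=> x y y' Gy Gy' i k; rewrite (h2 _ _ _ Gy Gy') rmorph_sum.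
  by apply: eq_bigr => l _; rewrite rmorphM.
- by move=> x y y' Gy Gy' K K' i k; rewrite (h3 _ _ _ Gy Gy' K K').
- by move=> u Gu i k; apply: continuous_conj; exact: h4.
Qed.

Lemma gfamily_mul (I J : finType) (th : I -> O) Y (th' : J -> O) Y' :
  gfamily th Y -> gfamily th' Y' ->
  gfamily (fun p : I * J => th p.1 * th' p.2) (fun u p q => Y u p.1 q.1 * Y' u p.2 q.2).
Proof.
case=> h1 h2 h3 h4 [k1 k2 k3 k4]; split.
- move=> x y Gy [i l] /=; have := autoM (hat_auto Gy) (h1 x y Gy i) (k1 x y Gy l).
  rewrite big_distrlr /= pair_big /= => h.
  rewrite (eq_bigr (fun p : I * J => Y (epoint y) p.1 i *: th p.1 * (Y' (epoint y) p.2 l *: th' p.2))) //.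
  by move=> p _; rewrite -scalerAl -scalerAr scalerA.
- move=> x y y' Gy Gy' [i l] [k m] /=; rewrite (h2 _ _ _ Gy Gy') (k2 _ _ _ Gy Gy').
  by rewrite big_distrlr /= pair_big; apply: eq_bigr => p _ /=; rewrite mulrACA.
- move=> x y y' Gy Gy' K K' [i l] [k m] /=.
  by rewrite (h3 _ _ _ Gy Gy' K K') (k3 _ _ _ Gy Gy' K K') rmorphM.
- move=> u Gu [i l] [k m] /=; apply: continuousM; [exact: h4 | exact: k4].
Qed.

Lemma hat_section x (y : E x -> E x) phi phi' : G (epoint y) -> cont_section phi ->
  cont_section phi' -> phi' x = y (phi x) -> maps_class (hatm x y) (iE phi) (iE phi').
Proof.
move=> Gy c c' e; have [_] := hatP hpsi hX cX OE (group_linear hG Gy) (group_ip hG Gy).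
by apply; exists phi, phi'.
Qed.

(** [hat] is specified on global sections, so y psi_l(x) is first extended to a section and then
    expanded in the frame at x. The frame identity also gives multiplicativity of the matrices. *)
Lemma gfamily_frame : gfamily (fun l => iE (psi l))
  (fun u k l => vb_ip (psi k (projT1 u)) (projT2 u (psi l (projT1 u)))).
Proof.
have ylin x (y : E x -> E x) (Gy : G (epoint y)) (I : finType) (c : I -> C) (v : I -> E x) :
    y (\sum_i c i *: v i) = \sum_i c i *: y (v i).
  have ly := group_linear hG Gy.
  have y0 : y 0 = 0 by have := ly (-1) 0 0; rewrite scaler0 addr0 scaleN1r addNr.
  have yD v' w' : y (v' + w') = y v' + y w' by rewrite -[v']scale1r ly !scale1r.
  rewrite (big_morph _ yD y0); apply: eq_bigr => i _.
  by rewrite -[_ *: v i]addr0 ly y0 addr0.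
split.
- move=> x y Gy l /=.
  have [phi c e] := section_through hX cX (y (psi l x)).
  have h := hat_section Gy (frame_cont hpsi l) c e.
  apply: (maps_class_congr h); first by rewrite subrr; exact: ker0.
  by have := @iE_const_rep _ _ _ _ _ _ hpsi _ _ _ OE _ x c; rewrite e => /kerN; rewrite opprB.
- move=> x y y' Gy Gy' i k /=.
  rewrite -{1}(frame_id hX cX hpsi (y' (psi k x))) ylin // ip_sumr.
  by apply: eq_bigr => l _; rewrite mulrC.
- move=> x y y' Gy Gy' K K' i k /=.
  by rewrite -vb_ipC -[RHS](group_ip hG Gy') K.
- move=> [x y] Gu i k /=; apply/continuous_atP => e e0.
  have FF := nbhs_filter (epoint y : fendo E).
  have H := group_ip_near hG (frame_cont hpsi i) (frame_cont hpsi k) Gu e0.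
  by apply: filterS H => -[x' y'].
Qed.

Fixpoint word (r : nat) : finType := if r is s.+1 then ('I_n * word s)%type else unit.

Fixpoint word_prod (r : nat) : word r -> O :=
  match r return word r -> O with
  | 0%N => fun=> 1
  | s.+1 => fun w => iE (psi w.1) * word_prod w.2
  end.

Lemma gfamily_word r : exists Y, gfamily (@word_prod r) Y.
Proof.
elim: r => [|r [Y IH]]; first by exists (fun _ _ _ => 1); exact: gfamily1.
by eexists; exact: (gfamily_mul gfamily_frame IH).
Qed.

Lemma sum_enum_val (V : zmodType) (I : finType) (F : I -> V) :
  \sum_i F i = \sum_(i < #|I|) F (enum_val i).
Proof.
rewrite (reindex (@enum_val I predT)) //.
exact: onW_bij (enum_val_bij I).
Qed.

(** Passes from words to ordinals, which index the matrices of the averaging argument. *)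
Lemma gfamily_reindex (I : finType) (th : I -> O) Y : gfamily th Y ->
  gfamily (fun i : 'I_#|I| => th (enum_val i)) (fun u i k => Y u (enum_val i) (enum_val k)).
Proof.
case=> h1 h2 h3 h4; split.
- move=> x y Gy i; have := h1 x y Gy (enum_val i); by rewrite sum_enum_val.
- by move=> x y y' Gy Gy' i k; rewrite (h2 _ _ _ Gy Gy') sum_enum_val.
- by move=> *; exact: h3.
- by move=> *; exact: h4.
Qed.

Lemma word_prod_sum r : \sum_(w : word r) word_prod w * adj (word_prod w) = 1.
Proof.
have [rel _ _] := OE.
elim: r => [|r IH]; first by rewrite (bigD1 tt) //= big1 ?addr0 ?adj1 ?mulr1 // => -[].
rewrite -(cp_sum rel) /= -(pair_big xpredT xpredT (fun a b =>
  iE (psi a) * word_prod b * adj (iE (psi a) * word_prod b))) /=.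
apply: eq_bigr => a _; transitivity (iE (psi a) * 1 * adj (iE (psi a))); last by rewrite mulr1.
rewrite -IH mulr_sumr mulr_suml; apply: eq_bigr => b _.
by rewrite adjM !mulrA.
Qed.
End Families.

Lemma telescope5 (V : zmodType) (t p q w : V) : t - p - (t - q - (p - w)) = q - w.
Proof.
have -> : t - q - (p - w) = (t - p) - (q - w).
  by rewrite !opprB [w - p]addrC [w - q]addrC !addrA [t - q - p]addrAC.
by rewrite opprB addrC subrK.
Qed.

Section CrossedProduct.
Variables (R : realType) (A : cstarType R) (rho : A -> A).
Hypothesis rho_hom : star_hom rho.
Local Notation C := (cplx R).
Local Notation X := (spectrum rho).
Variables (d : nat) (E : herm_bundle R X d).
Variables (n : nat) (psi : 'I_n -> bsection E).
Hypothesis psi_frame : section_frame psi.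
Variables (O : cstarType R) (iC : (X -> C) -> O) (iE : bsection E -> O).
Hypothesis OE : is_cuntz_pimsner psi iC iE.
Variable (G : set (fendo E)).
Hypothesis G_bundle : compact_group_bundle G.
Variables (mu : O -> A) (B : cstarType R) (iA : A -> B) (j : O -> B).
Hypothesis B_crossed : is_crossed_product iC iE G mu iA j.
Local Notation io := (crossed_cx (rho := rho) iA).
Variable alpha : forall x : X, (E x -> E x) -> fibre io setT x -> fibre io setT x.
Hypothesis alpha_gauge : dual_gauge_action iC iE G j alpha.
Local Notation ker := (fib_ker io setT).

Let hX : hausdorff_space X := spectrum_hausdorff (rho := rho).
Let cX : compact [set: X] := compact_base G_bundle.
Let cov : covariant_pair iC iE G mu iA j. Proof. by case: B_crossed. Qed.
Let hA : star_hom iA. Proof. by case: cov. Qed.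
Let hj : star_hom j. Proof. by case: cov. Qed.
Let hio : cfun_hom io. Proof. by case: (cov_cx cov). Qed.
Let cio (f : X -> C) : continuous f -> centre (io f).
Proof. by move=> cf; have [_ _ h] := cov_cx cov; exact: h. Qed.
Let j_io (f : X -> C) : continuous f -> j (iC f) = io f.
Proof. by move=> cf; rewrite (cov_cfun cov cf). Qed.

Lemma alpha_auto x (y : E x -> E x) : G (epoint y) -> fib_automorphism (alpha y).
Proof. by have [[h _ _ _] _] := alpha_gauge; exact: h. Qed.

Lemma alpha_A x (y : E x -> E x) a : G (epoint y) -> maps_class (alpha y) (iA a) (iA a).
Proof.
move=> Gy; have [_ h] := alpha_gauge.
have := h x y Gy a 1 1 (auto_one (hat_auto psi_frame hX cX OE G_bundle Gy)).
by rewrite (star_hom1 hj) mulr1.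
Qed.

Lemma alpha_j x (y : E x -> E x) t t' : G (epoint y) ->
  maps_class (hat (iC := iC) iE y) t t' -> maps_class (alpha y) (j t) (j t').
Proof.
move=> Gy ht; have [_ h] := alpha_gauge.
by have := h x y Gy 1 t t' ht; rewrite (star_hom1 hA) !mul1r.
Qed.

Let kerZ (k : C) b x : ker x b -> ker x (k *: b).
Proof. exact: subspaceZ (fib_ker_subspace _ _ _). Qed.
Let kerM a b x : ker x b -> ker x (a * b).
Proof. by apply: (fib_ker_mull cio). Qed.
Let kerMr a b x : ker x b -> ker x (b * a).
Proof. by apply: (fib_ker_mulr (iota := io)). Qed.

Lemma fib_const x (f : X -> C) : continuous f -> ker x (io f - f x *: 1).
Proof.
move=> cf; rewrite -(iota_cst hio) -(iotaB hio cf (continuous_const X (f x))) -[io _]mulr1.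
have cg : continuous (fun y => f y - f x).
  by move=> y; exact: (continuousB (cf y) (continuous_const X (f x) y)).
exact: (fib_ker_gen cg (subrr (f x)) (I : [set: B] 1)).
Qed.

(** * Fixed points of the gauge action lie in the image of A *)

Section FixedElements.
Variables (N : nat) (th : 'I_N -> O) (Y : fendo E -> 'I_N -> 'I_N -> C).
Hypothesis thY : gfamily iC iE G th Y.

Let Ym u : 'M[C]_N := \matrix_(i, k) Y u i k.
Let Ymul x (y y' : E x -> E x) : G (epoint y) -> G (epoint y') ->
  Ym (epoint (y \o y')) = Ym (epoint y) *m Ym (epoint y').
Proof.
move=> Gy Gy'; apply/matrixP => i k; rewrite !mxE (gf_mul thY Gy Gy').
by apply: eq_bigr => l _; rewrite !mxE.
Qed.
Let Yinv x (y y' : E x -> E x) : G (epoint y) -> G (epoint y') ->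
  cancel y y' -> cancel y' y -> Ym (epoint y') = ctmx (Ym (epoint y)).
Proof.
by move=> Gy Gy' K K'; apply/matrixP => i k; rewrite !mxE (gf_inv thY Gy Gy' K K').
Qed.
Let Ycont u : G u -> forall i k, {for u, continuous (fun u => Ym u i k)}.
Proof.
move=> Gu i k; have -> : (fun u => Ym u i k) = (fun u => Y u i k).
  by apply/funext => v; rewrite mxE.
exact: (gf_cont thY).
Qed.

(** Modulo the kernel at x the coefficients become the scalars v_i(x), and [hat] acts on the column
    of scalars by the matrix of y. *)
Lemma invariant_fixed (v : X -> 'cV[C]_N) : (forall i, continuous (fun x => v x i 0)) ->
  (forall x (y : E x -> E x), G (epoint y) -> Ym (epoint y) *m v x = v x) ->
  fixed_algebra iC iE G (\sum_i iC (fun x => v x i 0) * th i).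
Proof.
move=> cv hv x y Gy; set t := \sum_i _.
have hT := hat_auto psi_frame hX cX OE G_bundle Gy.
have kt : fib_ker iC setT x (t - \sum_i v x i 0 *: th i).
  rewrite -sumrB; apply: (subspace_sum _ (fib_ker_subspace iC setT x)) => i.
  have h := @iC_ker _ _ _ _ _ _ _ _ _ OE _ x (cv i).
  have := fib_ker_mulr (iota := iC) (m := th i) (fun _ _ => I) h.
  by rewrite mulrBl -scalerAl mul1r.
have m1 : maps_class (hat (iC := iC) iE y) (\sum_i v x i 0 *: th i)
    (\sum_i v x i 0 *: \sum_k Y (epoint y) k i *: th k).
  by apply: (auto_sum hT) => i; apply: (autoZ hT); exact: (gf_maps thY Gy).
have e : \sum_i v x i 0 *: (\sum_k Y (epoint y) k i *: th k) = \sum_i v x i 0 *: th i.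
  under eq_bigr do rewrite scaler_sumr.
  rewrite exchange_big; apply: eq_bigr => k _ /=.
  rewrite -{2}(hv x y Gy) mxE scaler_suml; apply: eq_bigr => i _.
  by rewrite scalerA mxE mulrC.
rewrite e in m1; exact: (maps_class_congr m1 kt kt).
Qed.

(** As alpha fixes the c_i, act (Y y) represents the image of t under y, hence t itself in the fibre
    at x; by convexity so does act a for a in the hull. The columns of a nearly invariant a are
    approximated by invariant sections, that is by elements of O_G, which [cov_mu] places in A. *)
Lemma fixed_near_range (c : 'I_N -> A) (t : B) (x : X) (e : R) :
  t = \sum_i iA (c i) * j (th i) ->
  (forall x (y : E x -> E x), G (epoint y) -> maps_class (alpha y) t t) -> 0 < e ->
  exists a k, ker x k /\ rnorm (t - iA a - k) < e.
Proof.
move=> ht ft e0.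
pose act (a : 'M[C]_N) := \sum_i \sum_k a k i *: (iA (c i) * j (th k)).
pose S := \sum_i \sum_k rnorm (iA (c i) * j (th k)).
have S0 : 0 <= S by apply: sumr_ge0 => i _; apply: sumr_ge0 => k _; exact: rnorm_ge0.
(* Each coefficient is moved by at most 4 e1 in [invariant_section], so the total error is at most 4
   e1 S < e. *)
pose e1 := e / (4 * (S + 1)).
have e10 : 0 < e1 by rewrite divr_gt0 // mulr_gt0 // ltr_wpDl.
have e1S : 4 * e1 * S < e.
  have : e1 * (4 * (S + 1)) = e by rewrite /e1 mulfVK // gt_eqF // mulr_gt0 // ltr_wpDl.
  by move: e10; move: e1 => q; nra.
have hull_t a : hull G Ym x a -> ker x (t - act a).
  move=> ha; apply: (ha [set a | ker x (t - act a)]) => [y Gy|b f s /= hb hf /andP[s0 s1]].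
    have hT := alpha_auto Gy.
    have m1 : maps_class (alpha y) t
        (\sum_i iA (c i) * j (\sum_k Y (epoint y) k i *: th k)).
      rewrite {1}ht; apply: (auto_sum hT) => i; apply: (autoM hT); first exact: alpha_A.
      by apply: alpha_j => //; exact: (gf_maps thY Gy).
    rewrite /=; have -> : act (Ym (epoint y)) = \sum_i iA (c i) * j (\sum_k Y (epoint y) k i *: th k).
      apply: eq_bigr => i _; rewrite (star_hom_sum hj) mulr_sumr; apply: eq_bigr => k _.
      by rewrite mxE (star_homZ hj) scalerAr.
    exact: (maps_class_fun m1 (ft x y Gy)).
  have -> : t - act (rc s *: b + rc (1 - s) *: f) =
      rc s *: (t - act b) + rc (1 - s) *: (t - act f).
    rewrite !scalerBr addrACA -scalerDl -rcD subrKC rc1 scale1r -opprD; congr (_ - _).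
    rewrite /act !scaler_sumr -big_split; apply: eq_bigr => i _ /=.
    rewrite !scaler_sumr -big_split; apply: eq_bigr => k _ /=.
    by rewrite !mxE scalerDl !scalerA.
  by apply: kerD; exact: kerZ.
have e12 : 0 < e1 / 2 by rewrite divr_gt0.
(* Applied to the identity matrix, so that one a makes all columns nearly invariant; e1 / 2 makes
   the bound strict. *)
have [a ha da] := approx_fixed G_bundle Ymul Yinv x (1%:M) e12.
pose f i : 'cV[C]_N := col i a.
have df i : defect_lt G Ym x (f i) e1.
  move=> y Gy k; have := da y Gy k i; rewrite mulmx1.
  have -> : (Ym (epoint y) *m f i - f i) k 0 = (Ym (epoint y) *m a - a) k i.
    by rewrite !mxE; congr (_ - _); apply: eq_bigr => l _; rewrite !mxE.
  by move: e10; lra.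
have hv i := invariant_section hX cX G_bundle Ymul Yinv Ycont e10 (df i).
have [v {}hv] := choice hv.
pose tv i := \sum_k iC (fun x => v i x k 0) * th k.
have OG i : fixed_algebra iC iE G (tv i).
  by have [c1 c2 _] := hv i; exact: invariant_fixed.
exists (\sum_i c i * mu (tv i)).
pose w := \sum_i \sum_k v i x k 0 *: (iA (c i) * j (th k)).
have kw : ker x (iA (\sum_i c i * mu (tv i)) - w).
  rewrite (star_hom_sum hA) -sumrB; apply: (subspace_sum _ (fib_ker_subspace io setT x)) => i.
  rewrite (star_homM hA) -(cov_mu cov (OG i)) (star_hom_sum hj) mulr_sumr -sumrB.
  apply: (subspace_sum _ (fib_ker_subspace io setT x)) => k.
  have [ci _ _] := hv i.
  rewrite (star_homM hj) (j_io (ci k)) mulrA -(iotaC cio _ (ci k)) -mulrA.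
  have := @kerMr (iA (c i) * j (th k)) _ _ (@fib_const x _ (ci k)).
  by rewrite mulrBl -scalerAl mul1r.
exists (t - act a - (iA (\sum_i c i * mu (tv i)) - w)); split.
  by apply: kerB => //; exact: hull_t.
have -> : t - iA (\sum_i c i * mu (tv i)) - (t - act a - (iA (\sum_i c i * mu (tv i)) - w)) =
    act a - w.
  exact: telescope5.
rewrite /act /w -sumrB; apply: le_lt_trans e1S.
rewrite (le_trans (rnorm_sum _ _ _)) // /S mulr_sumr; apply: ler_sum => i _.
rewrite -sumrB (le_trans (rnorm_sum _ _ _)) // mulr_sumr; apply: ler_sum => k _.
rewrite -scalerBl rnormZ ler_wpM2r ?rnorm_ge0 //.
have [_ _ h] := hv i; have := h k.
by rewrite mxE -cabsN opprB.
Qed.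
End FixedElements.

Local Notation cutB := (cut io).

(** A cutoff at x makes t - a small in norm. As the cutoff is 1 on the support of the corresponding
    weight, it can be inserted in the glued sum without changing it, and [convex_rnorm] applies. *)
Lemma range_local (t : B) : (forall x (e : R), 0 < e ->
  exists a k, ker x k /\ rnorm (t - iA a - k) < e) -> range iA t.
Proof.
move=> ht; have injA : injective iA := cov_injA cov.
apply: (closed_approx (closed_range hA injA)) => e e0.
(* Each local error is at most 2 r, one r for the kernel element and one for the rest;
   [convex_rnorm] doubles it to 4 r < e. *)
pose r := e / 5; have r0 : 0 < r by rewrite divr_gt0.
have hb (x : X) : exists ab : A * (X -> R), [/\ continuous ab.2, forall y, 0 <= ab.2 y <= 1,
    \forall y \near x, ab.2 y = 1 & rnorm (cutB ab.2 * (t - iA ab.1)) <= 2 * r].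
  have [a [k [kk tk]]] := ht x r r0.
  have [b [cb b01 b1 bk]] := fib_ker_cut hX cX hio cio kk r0.
  exists (a, b); split => //=.
  rewrite -(subrK k (t - iA a)) mulrDr (le_trans (rnormD _ _)) //.
  have := rnormM (cutB b) (t - iA a - k); have := cut_le1 hio cio cb b01.
  have := rnorm_ge0 (t - iA a - k); have := rnorm_ge0 (cutB b); move: tk bk.
  by move: (rnorm (cutB b)) (rnorm (t - _ - _)) => u v; nra.
have [ab {}hb] := choice hb.
have nb (x : X) : nbhs x [set y | (ab x).2 y = 1] by have [_ _ h _] := hb x.
have [I [p [m [cm m1 mV]]]] := partition_of_unity R hX cX nb.
have cmm i : continuous (fun x => rc (m i x * m i x)).
  by apply: continuous_rc => x; exact: (continuousM (cm i x) (cm i x)).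
have cutM i : cutB (m i) * cutB (m i) = io (fun x => rc (m i x * m i x)).
  rewrite -(iotaM hio (continuous_rc (cm i)) (continuous_rc (cm i))).
  by congr io; apply/funext => x; rewrite rcM.
have sum1 : \sum_i cutB (m i) * cutB (m i) = 1.
  under eq_bigr do rewrite cutM.
  rewrite -(iota_sum hio _ cmm) -[RHS]scale1r -(iota_cst hio); congr io.
  by apply/funext => x; rewrite -rc_sum m1 rc1.
exists (iA (\sum_i gelfand_inv (fun x => rc (m i x * m i x)) * (ab (p i)).1)); first by eexists.
have -> : t - iA (\sum_i gelfand_inv (fun x => rc (m i x * m i x)) * (ab (p i)).1) =
    \sum_i cutB (m i) * cutB (m i) * (cutB (ab (p i)).2 * (t - iA (ab (p i)).1)).
  rewrite (star_hom_sum hA) -{1}[t]mul1r -sum1 mulr_suml -sumrB; apply: eq_bigr => i _.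
  rewrite (star_homM hA) -/(io _) -cutM -mulrBr mulrA; congr (_ * _).
  have [cb _ _ _] := hb (p i).
  rewrite cutM -(iotaM hio (cmm i) (continuous_rc cb)); congr io; apply/funext => x.
  have [m0|m0] := eqVneq (m i x) 0; first by rewrite m0 mul0r rc0 mul0r.
  by have := mV i x m0; rewrite /= => ->; rewrite rc1 mulr1.
apply: (@le_lt_trans _ _ (2 * (2 * r))); last by rewrite /r; move: e0; lra.
apply: (convex_rnorm (mu := fun i => cutB (m i))) => //.
- by rewrite mulr_gt0.
- by move=> i; exact: cut_adj.
- by move=> i a; exact: cutC.
- by move=> i; have [_ _ _] := hb (p i).
Qed.

Lemma fixed_range (I : finType) (th : I -> O) Y (c : I -> A) (t : B) :
  gfamily iC iE G th Y -> t = \sum_i iA (c i) * j (th i) ->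
  (forall x (y : E x -> E x), G (epoint y) -> maps_class (alpha y) t t) -> range iA t.
Proof.
move=> hth ht ft; apply: range_local => x e e0.
apply: (fixed_near_range (gfamily_reindex hth) (c := fun i => c (enum_val i))) => //.
by rewrite ht sum_enum_val.
Qed.

(** * The bimodule of intertwiners and its gauge action *)

Section Bimodule.
Hypothesis rel_comm : [set b : B | forall a : A, b * iA a = iA a * b] = centre_image iA.
Local Notation Z := (centre_image iA).
Local Notation e := (fun l => j (iE (psi l))).

Definition itw (r s : nat) : set B :=
  [set b | forall a, b * iA (iter r rho a) = iA (iter s rho a) * b].

Local Notation M := (itw 0 1).

Lemma itw00 : itw 0 0 = Z. Proof. exact: rel_comm. Qed.

Lemma itw_mul r s u b b' : itw s u b -> itw r s b' -> itw r u (b * b').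
Proof. by move=> hb hb' a; rewrite -mulrA hb' mulrA hb mulrA. Qed.

Lemma itw_adj r s b : itw r s b -> itw s r (adj b).
Proof.
move=> hb a; have ra k : iter k rho (adj a) = adj (iter k rho a).
  by elim: k => //= k ->; rewrite (star_hom_adj rho_hom).
have := congr1 (@adj _ B) (hb (adj a)).
by rewrite !adjM !ra !(star_hom_adj hA) !adjK.
Qed.

Lemma itw_subspace r s : subspace (itw r s).
Proof.
split; first by move=> a; rewrite mul0r mulr0.
by move=> k b b' h h' a; rewrite mulrDl mulrDr -scalerAl -scalerAr h h'.
Qed.

Lemma itw_closed r s : closed (itw r s).
Proof.
apply/closedRP => b hb a; apply/eqP; rewrite -subr_eq0; apply/eqP.
apply: rnorm_small => q q0.
pose K := rnorm (iA (iter r rho a)) + rnorm (iA (iter s rho a)).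
have K0 : 0 <= K by rewrite addr_ge0 // rnorm_ge0.
have K1 : 0 < K + 1 by rewrite ltr_wpDl.
have [b' hb' bb] := hb _ (divr_gt0 q0 K1).
have -> : b * iA (iter r rho a) - iA (iter s rho a) * b =
    (b - b') * iA (iter r rho a) - iA (iter s rho a) * (b - b').
  by rewrite mulrBl mulrBr (hb' a) opprB addrA subrK.
rewrite (le_trans (rnormB _ _)) //.
have := rnormM (b - b') (iA (iter r rho a)); have := rnormM (iA (iter s rho a)) (b - b').
move: bb; rewrite ltr_pdivlMr // /K.
have := rnorm_ge0 (b - b').
set c1 := rnorm (_ * _); set c2 := rnorm (_ * _).
move: (rnorm (b - b')) (rnorm (iA (iter r rho a))) (rnorm (iA (iter s rho a))) c1 c2 => u v w f g.
by move=> h1 h2 h3 h4; nra.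
Qed.

Lemma itw_module r s : cx_module io (itw r s).
Proof.
split; [exact: itw_closed | exact: itw_subspace |].
move=> f b cf hb a; rewrite -mulrA hb mulrA (cio cf) mulrA //.
Qed.

Lemma itw_shift r b : M b -> itw r r.+1 b.
Proof. by move=> hb a; exact: hb (iter r rho a). Qed.

Lemma itw_section phi : cont_section phi -> M (j (iE phi)).
Proof. by move=> c a; rewrite /= (cov_rho cov a c). Qed.

Lemma e_sum : \sum_l e l * adj (e l) = 1.
Proof.
have [rel _ _] := OE; rewrite -(star_hom1 hj) -(cp_sum rel) (star_hom_sum hj).
by apply: eq_bigr => l _; rewrite (star_homM hj) (star_hom_adj hj).
Qed.

Lemma itw_e r l : itw r r.+1 (e l).
Proof. by apply/itw_shift/itw_section/frame_cont/psi_frame. Qed.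

Local Notation W w := (j (word_prod psi iE w)).

Lemma itw_word r (w : word n r) : itw 0 r (W w).
Proof.
elim: r w => [|r IH] w /=; first by move=> a; rewrite (star_hom1 hj) mul1r mulr1.
by rewrite (star_homM hj); apply: itw_mul (IH _); exact: itw_e.
Qed.

Lemma word_sum r : \sum_(w : word n r) W w * adj (W w) = 1.
Proof.
rewrite -(star_hom1 hj) -(word_prod_sum OE r) (star_hom_sum hj).
by apply: eq_bigr => w _; rewrite (star_homM hj) (star_hom_adj hj).
Qed.

(** Inserting the sum of e_l adj (e_l) = 1 factors b through M, since adj (e_l) b intertwines the
    iterates 0 and r. *)
Lemma mpowE r : mpow Z M r = itw 0 r.
Proof.
elim: r => [|r IH]; first by rewrite -itw00.
rewrite /= IH; apply/seteqP; split.
  apply: clspan_min; [exact: itw_subspace | exact: itw_closed |].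
  by move=> _ [m hm [b hb <-]]; apply: itw_mul hb; exact: itw_shift.
move=> b hb; rewrite -[b]mul1r -e_sum mulr_suml.
apply: (subspace_sum _ (clspan_subspace _)) => l; apply: clspan_sub.
exists (e l); first exact: (itw_e 0).
exists (adj (e l) * b); last by rewrite mulrA.
by apply: itw_mul hb; apply: itw_adj; exact: itw_e.
Qed.

Lemma mod_arrowsE r s : mod_arrows iA M r s = itw r s.
Proof.
rewrite /mod_arrows !mpowE; apply/seteqP; split.
  apply: clspan_min; [exact: itw_subspace | exact: itw_closed |].
  by move=> _ [m' hm' [m hm <-]]; apply: itw_mul hm' _; exact: itw_adj.
move=> b hb; rewrite -[b]mulr1 -(word_sum r) mulr_sumr.
apply: (subspace_sum _ (clspan_subspace _)) => w; apply: clspan_sub.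
exists (b * W w); first by apply: itw_mul hb _; exact: itw_word.
by exists (W w); [exact: itw_word | rewrite mulrA].
Qed.

Lemma alpha_Z x (y : E x -> E x) z : G (epoint y) -> Z z -> maps_class (alpha y) z z.
Proof. by move=> Gy [a _ <-]; exact: alpha_A. Qed.

Lemma alpha_word r x (y : E x -> E x) (w : word n r) : G (epoint y) ->
  exists2 w', itw 0 r w' & maps_class (alpha y) (W w) w'.
Proof.
move=> Gy; have [Y hY] := gfamily_word psi_frame hX cX OE G_bundle r.
exists (j (\sum_k Y (epoint y) k w *: word_prod psi iE k)); last first.
  by apply: alpha_j => //; exact: (gf_maps hY Gy).
rewrite (star_hom_sum hj); apply: (subspace_sum _ (itw_subspace 0 r)) => k.
by rewrite (star_homZ hj); apply: (subspaceZ _ (itw_subspace 0 r)); exact: itw_word.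
Qed.

(** b is the sum of the W_w times coefficients in Z. These are fixed by alpha, and the words are
    mapped to combinations of words of the same length. *)
Lemma alpha_stable r x (y : E x -> E x) : G (epoint y) ->
  forall b, itw 0 r b -> exists2 b', itw 0 r b' & maps_class (alpha y) b b'.
Proof.
move=> Gy b hb.
have hw (w : word n r) : exists w', itw 0 r w' /\ maps_class (alpha y) (W w) w'.
  by have [w' h1 h2] := alpha_word w Gy; exists w'.
have [w' {}hw] := choice hw.
have hz (w : word n r) : Z (adj (W w) * b).
  by rewrite -itw00; apply: itw_mul hb; apply: itw_adj; exact: itw_word.
exists (\sum_w w' w * (adj (W w) * b)).
  apply: (subspace_sum _ (itw_subspace 0 r)) => w; have [h _] := hw w.
  by apply: itw_mul h _; rewrite itw00.
rewrite -[X in maps_class _ X _]mul1r -(word_sum r) mulr_suml.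
apply: (auto_sum (alpha_auto Gy)) => w; rewrite -mulrA.
by apply: (autoM (alpha_auto Gy)); [case: (hw w) | exact: alpha_Z].
Qed.

(** The sum is the rank of E. If it vanished at one point, that fibre, hence every fibre and every
    section, would be 0, contradicting the relation that the S_l adj (S_l) sum to 1. *)
Lemma frame_ip_neq0 x : \sum_l sec_ip (psi l) (psi l) x != 0.
Proof.
apply/eqP => s0.
have p0 l : psi l x = 0.
  apply: (@vb_ip_eq0 _ _ _ E).
  have := s0; rewrite /sec_ip => /eqP.
  rewrite psumr_eq0; last by move=> k _; exact: vb_ip_ge0.
  by move=> /allP /(_ l); rewrite mem_index_enum => /(_ isT) /eqP.
have triv0 (v : E x) : v = 0.
  rewrite -(frame_id hX cX psi_frame v) big1 // => l _; by rewrite p0 scaler0.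
have [i ix] := vb_dom_cover E x.
have [_ [g _ gK]] := vb_trivP ix.
have triv_eq (y : X) (v : E y) : v = 0.
  have [k ky] := vb_dom_cover E y; have [_ bij] := vb_trivP ky.
  by apply: (bij_inj bij); rewrite -[LHS]gK -[RHS]gK [g _]triv0 [g (vb_triv _ _)]triv0.
have [rel _ _] := OE.
have e0 l : iE (psi l) = 0.
  have -> : psi l = fun y => (fun=> 0 : C) y *: psi l y.
    by apply: functional_extensionality_dep => y; rewrite scale0r; exact: triv_eq.
  rewrite (cp_scale rel (continuous_const X (0 : C)) (frame_cont psi_frame l)).
  by rewrite (iota_cst (cp_cfun rel)) scale0r mulr0.
have := cp_sum rel; rewrite big1 => [/esym/eqP|l _]; last by rewrite e0 mul0r.
by rewrite oner_eq0.
Qed.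

Lemma e_ip phi phi' : cont_section phi -> cont_section phi' ->
  adj (j (iE phi)) * j (iE phi') = io (sec_ip phi phi').
Proof.
move=> c c'; have [rel _ _] := OE.
by rewrite -(star_hom_adj hj) -(star_homM hj) (cp_ip rel c c') (j_io (sec_ip_cont c c')).
Qed.

Lemma frame_expand b : b = \sum_l e l * (adj (e l) * b).
Proof. by rewrite -[LHS]mul1r -e_sum mulr_suml; apply: eq_bigr => l _; rewrite mulrA. Qed.

Lemma itw_coeff l b : M b -> Z (adj (e l) * b).
Proof. by move=> hb; rewrite -itw00; apply: itw_mul hb; apply: itw_adj; exact: (itw_e 0). Qed.

Lemma io_Z (f : X -> C) : continuous f -> Z (io f).
Proof. by move=> cf; rewrite -itw00 => a; rewrite /= (cio cf). Qed.

Lemma M_bimodule : hilbert_bimodule iA M.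
Proof.
have [M0 Mlin] := itw_subspace 0 1.
have MM m m' : M m -> M m' -> Z (adj m * m').
  by move=> hm hm'; rewrite -itw00; apply: itw_mul hm'; exact: itw_adj.
split => //; first exact: itw_closed.
  move=> z m; rewrite -itw00 => hz hm; split; last exact: itw_mul hz.
  by apply: itw_mul hm => a; rewrite (hz (rho a)).
split => //; apply/seteqP; split.
  rewrite -itw00; apply: clspan_min; [exact: itw_subspace | exact: itw_closed |].
  by move=> _ [m hm [m' hm' <-]]; rewrite itw00; exact: MM.
(* Fullness: F is invertible in C(X), so z is the sum of the scalar products of e_l with e_l z /
   F. *)
move=> z hz; pose F x := \sum_l sec_ip (psi l) (psi l) x.
have cl l : continuous (sec_ip (psi l) (psi l)).
  exact: (sec_ip_cont (frame_cont psi_frame l) (frame_cont psi_frame l)).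
have cF : continuous F by move=> x; apply: continuous_sum => l; exact: cl.
have cV : continuous (fun x => (F x)^-1).
  by move=> x; apply: continuousV; [exact: frame_ip_neq0 | exact: cF].
have ioF : \sum_l adj (e l) * e l = io F.
  rewrite (iota_sum hio _ cl); apply: eq_bigr => l _.
  by rewrite (e_ip (frame_cont psi_frame l) (frame_cont psi_frame l)).
have -> : z = \sum_l adj (e l) * (e l * (io (fun x => (F x)^-1) * z)).
  under eq_bigr do rewrite mulrA.
  rewrite -mulr_suml ioF mulrA -(iotaM hio cF cV).
  rewrite (_ : (fun x => F x * (F x)^-1) = fun=> 1).
    by rewrite (iota_cst hio) scale1r mul1r.
  by apply/funext => x; rewrite mulfV //; exact: frame_ip_neq0.
apply: (subspace_sum _ (clspan_subspace _)) => l; apply: clspan_sub.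
exists (e l); first exact: (itw_e 0).
exists (e l * (io (fun x => (F x)^-1) * z)) => //.
apply: itw_mul (itw_e 0 l) _; apply: (@itw_mul 0 0 0).
  by rewrite itw00; exact: io_Z.
by rewrite itw00.
Qed.

Lemma M_cx : cx_bimodule rho iA M.
Proof. by move=> f m [_ rf] hm; have := hm f; rewrite /= rf. Qed.

Lemma M_finitely_generated : finitely_generated iA M.
Proof.
exists n, e; split=> [l|b hb]; first exact: (itw_e 0).
exists (fun l => adj (e l) * b); split; last exact: frame_expand.
by move=> l; exact: itw_coeff.
Qed.

Lemma M_support_one : support_one M.
Proof. by exists n, e; split; [exact: (itw_e 0) | exact: e_sum]. Qed.

Definition tensor_elt (s : formal_tensor E) : B := \sum_(p <- s) j (iE p.1) * iA p.2.

Lemma is_tensor_cons p (s : formal_tensor E) :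
  is_tensor (p :: s) <-> (cont_section p.1 /\ centre p.2) /\ is_tensor s.
Proof.
split=> [h|[hp hs] q /= [<-|]] //; last exact: hs.
by split=> [|q hq]; apply: h; [left | right].
Qed.

Lemma is_tensor_cat (s t : formal_tensor E) :
  is_tensor s -> is_tensor t -> is_tensor (s ++ t).
Proof.
by elim: s => // p s IH /is_tensor_cons[hp hs] ht; apply/is_tensor_cons; split => //; exact: IH.
Qed.

Lemma is_tensor_act (s : formal_tensor E) z : is_tensor s -> centre z ->
  is_tensor (tensor_act s z).
Proof.
move=> + hz; elim: s => // p s IH /is_tensor_cons[[h1 h2] hs].
apply/is_tensor_cons; split; last exact: IH.
by split => //= a; rewrite -mulrA hz mulrA h2 mulrA.
Qed.

Lemma tensor_elt_ip s t : is_tensor s -> is_tensor t ->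
  adj (tensor_elt s) * tensor_elt t = iA (tensor_ip s t).
Proof.
rewrite /tensor_elt /tensor_ip => + ht; elim: s => [|p s IH].
  by rewrite !big_nil adj0 mul0r (star_hom0 hA).
move=> /is_tensor_cons[[h1 h2] hs].
rewrite !big_cons adjD mulrDl IH // (star_homD hA); congr (_ + _).
elim: t ht {IH} => [|q t IHt]; first by rewrite !big_nil mulr0 (star_hom0 hA).
move=> /is_tensor_cons[[k1 k2] ht].
rewrite !big_cons mulrDr IHt // (star_homD hA); congr (_ + _).
rewrite adjM !(star_homM hA) (star_hom_adj hA) -/(io _) -(e_ip h1 k1).
by rewrite !mulrA.
Qed.

Lemma tensor_elt_act s z : tensor_elt (tensor_act s z) = tensor_elt s * iA z.
Proof.
rewrite /tensor_elt big_map mulr_suml; apply: eq_bigr => p _ /=.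
by rewrite (star_homM hA) mulrA.
Qed.

Lemma M_iso_tensor : iso_tensor E iA M.
Proof.
have cen1 : centre (-1 : A) by move=> a; rewrite mulN1r mulrN1.
have sumD s t : tensor_elt (s ++ t) = tensor_elt s + tensor_elt t.
  by rewrite /tensor_elt big_cat.
exists tensor_elt; split => //; first 1 last.
- apply/seteqP; split=> [_ [s hs <-]|b hb].
    elim: s hs => [_|p s IH /is_tensor_cons[[h1 h2] hs]]; rewrite /tensor_elt.
      by rewrite big_nil; case: (itw_subspace 0 1).
    rewrite big_cons; apply: (subspaceD (itw_subspace 0 1)); last exact: IH.
    apply: itw_mul (itw_section h1) _; rewrite itw00; by exists p.2.
  have hz l : exists z, centre z /\ iA z = adj (e l) * b.
    by have [z h1 h2] := itw_coeff l hb; exists z.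
  have [z {}hz] := choice hz.
  exists [seq (psi l, z l) | l <- index_enum 'I_n].
    elim: (index_enum _) => //= l r IH; apply/is_tensor_cons; split => //.
    by split; [exact: frame_cont | case: (hz l)].
  rewrite /tensor_elt big_map [RHS]frame_expand; apply: eq_bigr => l _ /=.
  by case: (hz l) => _ ->.
- by move=> s z hs hz; exact: tensor_elt_act.
- exact: tensor_elt_ip.
move=> s t hs ht; rewrite /tensor_eq.
set u := s ++ _; have hu : is_tensor u.
  by apply: is_tensor_cat => //; exact: is_tensor_act.
have eu : tensor_elt u = tensor_elt s - tensor_elt t.
  by rewrite sumD tensor_elt_act (star_homN hA) (star_hom1 hA) mulrN1.
have ip := tensor_elt_ip hu hu.
split=> [st|u0].
  apply: (cov_injA cov); rewrite -ip eu st subrr mulr0 (star_hom0 hA) //.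
apply/eqP; rewrite -subr_eq0 -eu; apply/eqP/rnorm_eq0.
have := rnorm_adjl (tensor_elt u); rewrite ip u0 (star_hom0 hA) rnorm0 => /esym/eqP.
by rewrite sqrf_eq0 => /eqP.
Qed.

Let mI r : cx_module io (itw 0 r) := itw_module 0 r.

(** Off G, where [alpha y] is not known to stabilize M, the identity is a default value. *)
Definition module_action (x : X) (y : E x -> E x) (u : fibre io M x) : fibre io M x :=
  if `[< G (epoint y) >] then fib_restrict (alpha y) u else u.
Local Notation U := module_action.

Lemma U_restrict x (y : E x -> E x) : G (epoint y) ->
  U y = fib_restrict (N := M) (alpha y).
Proof. by move=> Gy; apply/funext => u; rewrite /U asboolT. Qed.

Lemma maps_restrict r x (y : E x -> E x) m m' : G (epoint y) ->
  maps_class (fib_restrict (N := itw 0 r) (alpha y)) m m' <->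
  [/\ itw 0 r m, itw 0 r m' & maps_class (alpha y) m m'].
Proof.
by move=> Gy; exact: (maps_fib_restrict hX cX hio cio (mI r) (alpha_stable Gy)).
Qed.

Lemma maps_U x (y : E x -> E x) m m' : G (epoint y) ->
  maps_class (U y) m m' <-> [/\ M m, M m' & maps_class (alpha y) m m'].
Proof. by move=> Gy; rewrite U_restrict //; exact: maps_restrict. Qed.

Lemma ker_Z x a : Z a -> ker x a -> fib_ker io Z x a.
Proof. by move=> hz; exact: (fib_ker_restrict hX cX hio cio). Qed.

(** alpha maps adj m n0 to adj m' n'; it also fixes adj m n0, which lies in Z. *)
Lemma U_ip x (y : E x -> E x) m m' n0 n' : G (epoint y) -> maps_class (U y) m m' ->
  maps_class (U y) n0 n' -> fib_ker io Z x (adj m' * n' - adj m * n0).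
Proof.
move=> Gy /(maps_U _ _ Gy)[Mm Mm' h] /(maps_U _ _ Gy)[Mn Mn' h'].
have MM a b : M a -> M b -> Z (adj a * b).
  by move=> ha hb; rewrite -itw00; apply: itw_mul hb; exact: itw_adj.
apply: ker_Z.
  rewrite -itw00; apply: (subspaceB (itw_subspace 0 0)); rewrite itw00; exact: MM.
apply: (maps_class_fun (alpha_Z Gy (MM _ _ Mm Mn))).
exact: (autoM (alpha_auto Gy) (auto_adj (alpha_auto Gy) h) h').
Qed.

(** The quotient norm is determined by the scalar product: for a cutoff h at x, h m' has squared
    norm |h^2 adj m' m'|, which exceeds |m|^2 by as little as desired. *)
Lemma small_representative x m m' (q : R) : M m' -> ker x (adj m' * m' - adj m * m) ->
  rnorm m < q -> exists2 b, fib_class io M x m' b & rnorm b < q.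
Proof.
move=> Mm' k mq; have m0 := rnorm_ge0 m.
have e0 : 0 < q ^+ 2 - rnorm m ^+ 2 by rewrite subr_gt0 ltr_pXn2r // nnegrE; lra.
have [h [ch h01 /nbhs_singleton hx hb]] := fib_ker_cut hX cX hio cio k e0.
exists (cutB h * m').
  rewrite /fib_class /= -opprB; apply: kerN.
  exact: (fib_ker_cut_compl hio ch hx Mm').
have c1 := cut_le1 hio cio ch h01.
have sq : rnorm (cutB h * m') ^+ 2 < q ^+ 2.
  have -> : rnorm (cutB h * m') ^+ 2 = rnorm (cutB h * (cutB h * (adj m' * m'))).
    rewrite -rnorm_adjl adjM (cut_adj hio ch); congr rnorm.
    by rewrite !mulrA -(cutC cio (adj m') ch) -!mulrA (mulrA (adj m')) -(cutC cio (adj m') ch) !mulrA.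
  apply: (@le_lt_trans _ _ (rnorm (cutB h * (adj m' * m')))).
    have := rnormM (cutB h) (cutB h * (adj m' * m')).
    have := rnorm_ge0 (cutB h * (adj m' * m')); have := rnorm_ge0 (cutB h); move: c1.
    by move: (rnorm (cutB h)) (rnorm (cutB h * _)) (rnorm _) => s t p; nra.
  have -> : adj m' * m' = (adj m' * m' - adj m * m) + adj m * m by rewrite subrK.
  rewrite mulrDr (le_lt_trans (rnormD _ _)) //.
  have := rnormM (cutB h) (adj m * m); rewrite rnorm_adjl.
  move: hb c1; have := rnorm_ge0 (cutB h); have := sqr_ge0 (rnorm m).
  set c2 := rnorm (_ * _); set c3 := rnorm (_ * _); move: (rnorm (cutB h)) c2 c3 (rnorm m ^+ 2) => s t p u.
  by move=> h1 h2 h3 h4 h5; nra.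
by move: sq; rewrite ltr_pXn2r // ?nnegrE ?rnorm_ge0 //; lra.
Qed.

Lemma U_norm x (y : E x -> E x) v : G (epoint y) -> fib_norm (U y v) = fib_norm v.
Proof.
move=> Gy; have [m Mm vm] := fib_mem_ex v.
have [m' Mm' Uvm'] := fib_mem_ex (U y v).
have hm : maps_class (U y) m m' by apply/maps_classP; [exact: vm | exact: Uvm'].
have tr (u u' : fibre io M x) (s : R) :
    (forall a, sval u a -> exists2 a', sval u' a' & fib_ker io Z x (adj a' * a' - adj a * a)) ->
    fib_norm u < s -> fib_norm u' < s.
  move=> h /fib_norm_lt[b ub bs]; have [a' ua' k] := h b ub.
  have Ma' : M a' by exact: (fib_mem_mod (mI 1) ua').
  have k' : ker x (adj a' * a' - adj b * b) by exact: fib_kerS k.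
  have [b' kb' bs'] := small_representative Ma' k' bs.
  by apply/fib_norm_lt; exists b' => //; exact/(fib_mem_ker _ ua').
apply/eqP; rewrite eq_le; apply/andP; split; rewrite leNgt; apply/negP.
  move=> h; have := tr v (U y v) _ _ h; rewrite ltxx => F; apply/notF/F => a va.
  exists m' => //; apply: (U_ip Gy) => //; exact/(maps_classP _ _ va).
move=> h; have := tr (U y v) v _ _ h; rewrite ltxx => F; apply/notF/F => a va.
exists m => //; rewrite -opprB; apply: kerN; apply: (U_ip Gy) => //.
  exact/(maps_classP _ _ vm).
exact/(maps_classP _ _ vm).
Qed.

Lemma incl_inj x : injective (@fib_incl _ _ _ io M x).
Proof.
move=> u v uv; have [a Na ua] := fib_mem_ex u.
apply: (fib_mem_inj ua).
by apply/(fib_inclP hX cX hio cio (mI 1) v Na); rewrite -uv; apply/(fib_inclP hX cX hio cio (mI 1) u Na).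
Qed.

Lemma incl_U x (y : E x -> E x) v : G (epoint y) -> fib_incl (U y v) = alpha y (fib_incl v).
Proof.
move=> Gy; rewrite U_restrict //.
exact: (fib_incl_restrict hX cX hio cio (mI 1) (alpha_stable Gy)).
Qed.

Lemma U_action : group_action G U.
Proof.
have [_ _ Gid Gcomp _] := G_bundle; have [[_ [a1 a2] _ _] _] := alpha_gauge.
split=> [x v|x y y' v Gy Gy']; apply: incl_inj; first by rewrite incl_U.
by rewrite !incl_U //; [exact: a2 | exact: Gcomp].
Qed.

(** A tube of B may be centred outside M. It is recentred at a representative m of v in M, and
    [fib_ker_near] keeps the classes of m and of the old centre close over nearby points. *)
Lemma incl_continuous x (v : fibre io M x) (Q : set (fbundle io setT)) :
  nbhs (fpoint (fib_incl v)) Q ->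
  nbhs (fpoint v) [set w : fbundle io M | Q (fpoint (fib_incl (projT2 w)))].
Proof.
pose f (w : fbundle io M) : fbundle io setT := fpoint (fib_incl (projT2 w)).
have FF : Filter (f @ nbhs (fpoint v)) by apply: fmap_filter; exact: nbhs_filter.
apply: (nbhs_tubes (F := f @ nbhs (fpoint v))) => _ [V [c [q [oV _ q0 ->]]]] /tubeP[Vx [b ib bc]].
change (V x) in Vx; change (sval (fib_incl v) b) in ib.
have [m Mm vm] := fib_mem_ex v.
have im : sval (fib_incl v) m by apply/(fib_inclP hX cX hio cio (mI 1)).
have k := (fib_mem_ker _ ib).1 im.
(* Half of the slack is the radius of the new tube, the other half absorbs the variation of the
   centre. *)
pose q1 := (q - rnorm (b - c)) / 2.
have q10 : 0 < q1 by have : 0 < q - rnorm (b - c); [rewrite subr_gt0 | rewrite /q1; lra].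
have near1 : rnorm ((m - c) - (m - b)) < q - q1.
  have -> : m - c - (m - b) = b - c by rewrite opprB addrC addrA subrK.
  by rewrite /q1; lra.
have nV := fib_ker_near hX cX hio cio k near1.
pose V1 := V `&` interior [set y | exists2 c', ker y c' & rnorm (m - c - c') < q - q1].
have nV1 : nbhs x V1.
  by apply: filterI; [exact: open_nbhs_nbhs | exact: nbhs_interior].
pose S := tube (iota := io) (N := M) (interior V1) m q1.
have tS : tubes S by exists (interior V1), m, q1; split => //; exact: open_interior.
have Sv : S (fpoint v).
  apply/tubeP; split; first exact: nV1.
  by exists m; rewrite ?subrr ?rnorm0.
apply: (@filterS _ _ _ S); last by apply: open_nbhs_nbhs; split => //; exact: open_tube.
move=> w /tubeP[/interior_subset[Vw /interior_subset[c' kc' mc']] [a wa am]].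
apply/tubeP; split => //; exists (a - c').
  have Ma := fib_mem_mod (mI 1) wa.
  have ia : sval (fib_incl (projT2 w)) a by apply/(fib_inclP hX cX hio cio (mI 1)).
  by apply/(fib_mem_ker _ ia); rewrite addrAC subrr sub0r; exact: kerN.
have -> : a - c' - c = (a - m) + (m - c - c') by rewrite [a - c' - c]addrAC !addrA subrK.
by rewrite (le_lt_trans (rnormD _ _)) //; move: am mc'; lra.
Qed.

(** U is alpha seen through the embedding of the bundle of M. That embedding is continuous, and by
    [fib_mem_shrink] a tube of B centred in M cuts out the tube of M with the same centre and
    radius. *)
Lemma U_continuous : jointly_continuous G U.
Proof.
move=> x y v Gy; have [[_ _ _ cal] _] := alpha_gauge.
(* The admissible W form a filter, which reduces the claim to tubes. *)
pose F (W : set (fbundle io M)) := exists (P : set (fendo E)) (Q : set (fbundle io M)),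
  [/\ nbhs (epoint y) P, nbhs (fpoint v) Q &
     forall x' (y' : E x' -> E x') (v' : fibre io M x'),
       G (epoint y') -> P (epoint y') -> Q (fpoint v') -> W (fpoint (U y' v'))].
have FF : Filter F.
  split.
  - by exists setT, setT; split => //; exact: filterT.
  - move=> W W' [P [Q [nP nQ h]]] [P' [Q' [nP' nQ' h']]].
    exists (P `&` P'), (Q `&` Q'); split; [exact: filterI | exact: filterI |].
    by move=> x' y' v' Gy' [? ?] [? ?]; split; [exact: h | exact: h'].
  - move=> W W' WW' [P [Q [nP nQ h]]]; exists P, Q; split => //.
    by move=> *; apply: WW'; exact: h.
apply: (nbhs_tubes FF) => _ [V [m [q [oV Mm q0 ->]]]] /tubeP[Vx [b Ub bm]].
change (V x) in Vx; change (sval (U y v) b) in Ub.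
have Mb := fib_mem_mod (mI 1) Ub.
pose T : set (fbundle io setT) := tube V m q.
have nT : nbhs (fpoint (alpha y (fib_incl v))) T.
  apply: open_nbhs_nbhs; split; first by apply: open_tube; exists V, m, q; split.
  apply/tubeP; split => //; exists b => //.
  by rewrite -incl_U //; apply/(fib_inclP hX cX hio cio (mI 1)).
have [P [Q [nP nQ h]]] := cal x y (fib_incl v) Gy T nT.
exists P, [set w : fbundle io M | Q (fpoint (fib_incl (projT2 w)))].
split=> //; first exact: incl_continuous.
move=> x' y' v' Gy' Py' Qv'.
have /tubeP[Vx' [b' ib' bm']] := h x' y' (fib_incl v') Gy' Py' Qv'.
change (sval (alpha y' (fib_incl v')) b') in ib'; rewrite -incl_U // in ib'.
by apply/tubeP; split => //; exact: (fib_mem_shrink hX cX hio cio (mI 1) Mm ib' bm').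
Qed.

Lemma U_linear x (y : E x -> E x) : G (epoint y) -> fib_linear (U y).
Proof.
move=> Gy; rewrite U_restrict //.
apply: (fib_restrict_linear hX cX hio cio (mI 1) (alpha_stable Gy)).
by case: (alpha_auto Gy).
Qed.

Lemma U_gauge : module_gauge_action G Z U.
Proof.
split; [|exact: U_action|exact: U_continuous] => x y Gy; split.
- exact: U_linear.
- by move=> v; exact: U_norm.
- by move=> m m' n0 n'; exact: U_ip.
- move=> z m m' hz /(maps_U _ _ Gy)[Mm Mm' h]; apply/(maps_U _ _ Gy).
  have [_ _ _ h2 _] := M_bimodule.
  split; [exact: (h2 _ _ hz Mm).1 | exact: (h2 _ _ hz Mm').1 |].
  exact: (autoM (alpha_auto Gy) (alpha_Z Gy hz) h).
Qed.

Local Notation tp x y r := (@tpow R X B io Z M x (maps_class (U (x := x) y)) r).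

Let mP r : cx_module io (mpow Z M r).
Proof. by rewrite mpowE; exact: itw_module. Qed.
Let stabP r x (y : E x -> E x) : G (epoint y) ->
  forall b, mpow Z M r b -> exists2 b', mpow Z M r b' & maps_class (alpha y) b b'.
Proof. by rewrite mpowE; exact: alpha_stable. Qed.

(** [tpow] is selected by a specification. The restriction of alpha to M^r satisfies it, and every
    map satisfying it agrees with this one, because b is the sum of the products of e_l in M with
    adj (e_l) b in the lower power. *)
Lemma maps_tpow r x (y : E x -> E x) xi xi' : G (epoint y) ->
  maps_class (tp x y r) xi xi' <-> [/\ itw 0 r xi, itw 0 r xi' & maps_class (alpha y) xi xi'].
Proof.
move=> Gy; elim: r xi xi' => [|r IH] xi xi'.
  split=> [h|[]].
    have [] := maps_class_mod (mP 0) h; rewrite /= -itw00 => h1 h2; split => //.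
    have [u [u1 u2]] := h; rewrite /= in u2.
    have k := (fib_mem_ker _ u1).1 u2.
    rewrite itw00 in h1; apply: (maps_class_congr (alpha_Z Gy h1)).
      by rewrite subrr; exact: ker0.
    exact: fib_kerS k.
  rewrite itw00 => h1 h2 h.
  exists (fib_pt io x (N := mpow Z M 0) h1); split; first exact: fib_pt_mem.
  apply/(fib_mem_ker _ (fib_pt_mem io x (N := mpow Z M 0) h1)).
  apply: ker_Z; last exact: (maps_class_fun (alpha_Z Gy h1) h).
  by rewrite -itw00; apply: (subspaceB (itw_subspace 0 0)); rewrite itw00.
pose V0 := fib_restrict (N := mpow Z M r.+1) (alpha y).
pose P := [set V : fibre io (mpow Z M r.+1) x -> fibre io (mpow Z M r.+1) x |
  fib_linear V /\ forall m m' n0 n', maps_class (U y) m m' -> maps_class (tp x y r) n0 n' ->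
    maps_class V (m * n0) (m' * n')].
have VP a b : maps_class V0 a b <-> [/\ itw 0 r.+1 a, itw 0 r.+1 b & maps_class (alpha y) a b].
  have h := maps_fib_restrict hX cX hio cio (mP r.+1) (stabP Gy) a b.
  by rewrite [X in and3 (X a)]mpowE [X in and3 _ (X b)]mpowE in h.
have PV0 : P V0.
  split; first by apply: (fib_restrict_linear hX cX hio cio (mP r.+1) (stabP Gy)); case: (alpha_auto Gy).
  move=> m m' n0 n' /(maps_U _ _ Gy)[Mm Mm' h] /IH[hn hn' h']; apply/VP; split.
  - by apply: itw_mul hn; exact: itw_shift.
  - by apply: itw_mul hn'; exact: itw_shift.
  - exact: (autoM (alpha_auto Gy) h h').
have PT : P (tp x y r.+1) by exact: (@xgetI _ _ _ _ PV0).
suff -> : tp x y r.+1 = V0 by exact: VP.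
apply/funext => u; have [b Nb ub] := fib_mem_ex u.
have hb : itw 0 r.+1 b by rewrite -mpowE.
have he l : exists e', maps_class (U y) (e l) e'.
  have [e' h1 h2] := alpha_stable Gy (itw_e 0 l).
  by exists e'; apply/(maps_U _ _ Gy); split => //; exact: (itw_e 0).
have hc l : exists c', maps_class (tp x y r) (adj (e l) * b) c'.
  have hl : itw 0 r (adj (e l) * b) by apply: itw_mul hb; apply: itw_adj; exact: itw_e.
  by have [c' h1 h2] := alpha_stable Gy hl; exists c'; apply/IH.
have [e' {}he] := choice he; have [c' {}hc] := choice hc.
have PU V : P V -> maps_class V b (\sum_l e' l * c' l).
  case=> lV hV; rewrite {1}[b]frame_expand; apply: (maps_class_sum _ lV).
    by have [_ [] ] := mP r.+1.
  by move=> l; exact: hV.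
apply: (fib_mem_inj (a := \sum_l e' l * c' l)); apply/(maps_classP _ _ ub); exact: PU.
Qed.

(** Write t as the sum of (t W_w) adj (W_w). If W_w is mapped to w', equivariance maps t W_w to t
    w', so t is mapped to t times the image of 1. *)
Lemma equivariant_fixed r s t x (y : E x -> E x) : G (epoint y) ->
  tpow_equivariant io Z M x (maps_class (U y)) r s t -> maps_class (alpha y) t t.
Proof.
move=> Gy ht; have hT := alpha_auto Gy.
have hw (w : word n r) : exists w', itw 0 r w' /\ maps_class (alpha y) (W w) w'.
  by have [w' h1 h2] := alpha_word w Gy; exists w'.
have [w' {}hw] := choice hw.
have h1 : maps_class (alpha y) 1 (\sum_w w' w * adj (w' w)).
  rewrite -(word_sum r); apply: (auto_sum hT) => w; have [_ h] := hw w.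
  exact: (autoM hT h (auto_adj hT h)).
have ht' : maps_class (alpha y) t (t * \sum_w w' w * adj (w' w)).
  rewrite -{1}[t]mulr1 -(word_sum r) !mulr_sumr; apply: (auto_sum hT) => w; have [iw h] := hw w.
  have /ht /(maps_tpow _ _ _ Gy)[_ _ h'] : maps_class (tp x y r) (W w) (w' w).
    by apply/(maps_tpow _ _ _ Gy); split => //; exact: itw_word.
  by rewrite !mulrA; exact: (autoM hT h' (auto_adj hT h)).
apply: (maps_class_congr ht'); first by rewrite subrr; exact: ker0.
rewrite -{1}[t]mulr1 -mulrBr; apply: kerM.
exact: (maps_class_fun h1 (auto_one hT)).
Qed.

(** The coefficients z of t between words lie in Z, and W_v z = rho^s(z) W_v moves them to the left,
    where [fixed_range] expects coefficients from A. *)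
Lemma itw_fixed_range r s t : itw r s t ->
  (forall x (y : E x -> E x), G (epoint y) -> maps_class (alpha y) t t) -> range iA t.
Proof.
move=> ht; have [Y hY] := gfamily_word psi_frame hX cX OE G_bundle s.
have [Y' hY'] := gfamily_word psi_frame hX cX OE G_bundle r.
have hz (p : word n s * word n r) : exists z : A, iA z = adj (W p.1) * t * W p.2.
  have : Z (adj (W p.1) * t * W p.2).
    rewrite -itw00; apply: itw_mul (itw_word _); apply: itw_mul ht.
    by apply: itw_adj; exact: itw_word.
  by case=> z _ <-; exists z.
have [z {}hz] := choice hz.
have gY := gfamily_mul psi_frame hX cX OE G_bundle hY (gfamily_adj psi_frame hX cX OE G_bundle hY').
apply: (fixed_range (c := fun p => iter s rho (z p)) gY).
rewrite -[LHS]mul1r -[LHS]mulr1 -{1}(word_sum s) -(word_sum r).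
rewrite -[LHS]mulrA mulr_sumr big_distrlr pair_big /=.
apply: eq_bigr => p _ /=; rewrite (star_homM hj) (star_hom_adj hj) [RHS]mulrA -itw_word hz.
by rewrite !mulrA.
Qed.

Lemma intertwiner_itw r s a : intertwiners rho r s a <-> itw r s (iA a).
Proof.
split=> h b; first by rewrite -!(star_homM hA) h.
by apply: (cov_injA cov); rewrite !(star_homM hA) h.
Qed.

Lemma equivariant_intertwiners r s :
  equivariant_mod_arrows G U r s = [set iA t | t in intertwiners rho r s].
Proof.
apply/seteqP; split=> [t [] |_ [a ha <-]].
  rewrite mod_arrowsE => ht hE.
  have [a _ at_] : range iA t.
    by apply: (itw_fixed_range ht) => x y Gy; exact: (equivariant_fixed Gy (hE x y Gy)).
  by exists a => //; apply/intertwiner_itw; rewrite at_.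
have ia : itw r s (iA a) by exact/intertwiner_itw.
split; first by rewrite mod_arrowsE.
move=> x y Gy xi xi' /(maps_tpow _ _ _ Gy)[h1 h2 h]; apply/(maps_tpow _ _ _ Gy); split.
- exact: itw_mul h1.
- exact: itw_mul h2.
- exact: (autoM (alpha_auto Gy) (alpha_A a Gy) h).
Qed.
End Bimodule.
End CrossedProduct.

Theorem theorem5p2 (R : realType)
  (* the unital endomorphism rho of A *)
  (A : cstarType R) (rho : A -> A) (rho_hom : star_hom rho)
  (* the vector bundle E over X^rho and a finite frame of sections *)
  (d : nat) (E : herm_bundle R (spectrum rho) d)
  (n : nat) (psi : 'I_n -> bsection E) (psi_frame : section_frame psi)
  (* the Cuntz-Pimsner algebra O of E *)
  (O : cstarType R) (iC : (spectrum rho -> cplx R) -> O)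
  (iE : bsection E -> O) (OE : is_cuntz_pimsner psi iC iE)
  (* the compact group bundle G, with G = SG *)
  (G : set (fendo E)) (G_bundle : compact_group_bundle G)
  (G_SG : G = stabilizer_bundle iC iE G)
  (* the dual action mu *)
  (mu : O -> A) (mu_dual : dual_action psi iC iE G mu)
  (* the crossed product B and its gauge action *)
  (B : cstarType R) (iA : A -> B) (j : O -> B)
  (B_crossed : is_crossed_product iC iE G mu iA j)
  (alpha : forall x : spectrum rho, (E x -> E x) ->
     fibre (crossed_cx (rho := rho) iA) setT x ->
     fibre (crossed_cx (rho := rho) iA) setT x)
  (alpha_gauge : dual_gauge_action iC iE G j alpha)
  (* the relative commutant of A in B is the centre of A *)
  (rel_comm : [set b : B | forall a : A, b * iA a = iA a * b] =
              centre_image iA) :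
  exists M : set B,
    [/\ hilbert_bimodule iA M, cx_bimodule rho iA M, finitely_generated iA M,
        support_one M & iso_tensor E iA M] /\
    exists U : forall x : spectrum rho, (E x -> E x) ->
        fibre (crossed_cx (rho := rho) iA) M x ->
        fibre (crossed_cx (rho := rho) iA) M x,
      [/\ module_gauge_action G (centre_image iA) U,
          forall (x : spectrum rho) (y : E x -> E x), G (epoint y) ->
            forall m m' : B, maps_class (U x y) m m' ->
              maps_class (alpha x y) m m' &
          forall r s : nat,
            equivariant_mod_arrows G U r s =
            [set iA t | t in intertwiners rho r s]].
Proof.
exists (itw rho iA 0 1); split.
  split; [ exact: (M_bimodule rho_hom psi_frame OE G_bundle B_crossed rel_comm)
         | exact: M_cx
         | exact: (M_finitely_generated rho_hom psi_frame OE B_crossed rel_comm)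
         | exact: (M_support_one psi_frame OE B_crossed)
         | exact: (M_iso_tensor rho_hom psi_frame OE B_crossed rel_comm) ].
exists (module_action G alpha); split.
- exact: (U_gauge rho_hom psi_frame OE G_bundle B_crossed alpha_gauge rel_comm).
- move=> x y Gy m m'.
  by case/(maps_U rho_hom psi_frame OE G_bundle B_crossed alpha_gauge rel_comm _ _ Gy).
- exact: (equivariant_intertwiners rho_hom psi_frame OE G_bundle B_crossed alpha_gauge rel_comm).
Qed.
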